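(* Let $V$ be a commutative valuation domain with quotient field $F$ such that $J(V)$ is a principal ideal of $V$, let $K/F$ be a finite Galois extension with group $G$ which is tamely ramified and defectless, let $S$ be the integral closure of $V$ in $K$, and let $f:G\times G\to S\setminus\{0\}$ be a normalized $2$-cocycle. Then the following are equivalent: (1) $A_f$ is semihereditary; (2) $A_f$ is an extremal $V$-order; (3) $O_l(J(A_f))=A_f$; (4) for every maximal ideal $M$ of $S$, $f(\sigma,\sigma^{-1})\notin M^2$ for all $\sigma\in G$; (5) for every maximal ideal $M$ of $S$, $f(\sigma,\tau)\notin M^2$ for all $\sigma,\tau\in G$; (6) $J(A_f)$ is a projective ideal of $A_f$. When this happens then, for each maximal ideal $M$ of $S$, the graph $\mathrm{Gr}(f^M)$ is a chain.
   Context: $V$ has arbitrary Krull dimension. A normalized 2-cocycle satisfies $\sigma(f(\tau,\gamma))f(\sigma,\tau\gamma)=f(\sigma,\tau)f(\sigma\tau,\gamma)$, $f(1,\sigma)=f(\sigma,1)=1$; values need not be units. $A_f=\bigoplus_{\sigma\in G}Sx_\sigma$ (free left $S$-module) with $(sx_\sigma)(tx_\tau)=s\,\sigma(t)f(\sigma,\tau)x_{\sigma\tau}$, a $V$-order in $\Sigma_f=\bigoplus_\sigma Kx_\sigma=(K/F,G,f)$. $J(R)$ is the Jacobson radical, $U(R)$ the unit group. A $V$-order in a central simple $F$-algebra $Q$ is a subring $R\supseteq V$ with $RF=Q$, integral over $V$; $R$ is extremal if every $V$-order $B\supseteq R$ with $J(B)\supseteq J(R)$ equals $R$. $O_l(I)=\{x\in\Sigma_f: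 xI\subseteq I\}$. Semihereditary: finitely generated one-sided ideals are projective. $H=\{\sigma\in G:f(\sigma,\sigma^{-1})\in U(S)\}$. For a maximal ideal $M$ of $S$, define a preorder on $G/H$ by $\sigma H\le_M\tau H$ iff $f(\sigma,\sigma^{-1}\tau)\notin M$; $\mathrm{Gr}(f^M)$ is the induced partial order on the equivalence classes (classes of mutually $\le_M$-comparable-both-ways cosets). ''Chain'' means totally ordered. Tamely ramified and defectless: for a maximal ideal $M$ of $S$, with $e=[\Gamma_{S_M}:\Gamma_V]$, residue fields $\overline{S_M},\overline V$ and $r$ the number of maximal ideals of $S$, $[K:F]=e[\overline{S_M}:\overline V]r$, $\mathrm{char}\,\overline V\nmid e$ and $\overline{S_M}/\overline V$ separable. *)

(* Defs.v *)
From HB Require Import structures.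
From mathcomp Require Import all_boot all_order all_fingroup all_algebra all_field.
Set Implicit Arguments. Unset Strict Implicit. Unset Printing Implicit Defensive.
Import GRing.Theory.
Local Open Scope ring_scope.

Section RingNotions.
Variables (T : zmodType) (mul : T -> T -> T) (one : T).

Definition subring (R : T -> Prop) :=
  [/\ R 0, R one, (forall x y, R x -> R y -> R (x - y))
    & (forall x y, R x -> R y -> R (mul x y))].

Definition left_ideal (R I : T -> Prop) :=
  [/\ (forall x, I x -> R x), I 0, (forall x y, I x -> I y -> I (x - y))
    & (forall r x, R r -> I x -> I (mul r x))].

Definition max_left_ideal (R I : T -> Prop) :=
  [/\ left_ideal R I, (exists x, R x /\ ~ I x)
    & forall I', left_ideal R I' -> (forall x, I x -> I' x) ->
         (forall x, I' x -> I x) \/ (forall x, R x -> I' x)].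

Definition jacobson (R : T -> Prop) (x : T) :=
  R x /\ forall I, max_left_ideal R I -> I x.

Definition unit_of (R : T -> Prop) (u : T) :=
  R u /\ exists v, [/\ R v, mul u v = one & mul v u = one].

Fixpoint lgen (R : T -> Prop) (gs : seq T) (x : T) : Prop :=
  match gs with
  | [::] => x = 0
  | g :: gs' => exists r y, [/\ R r, lgen R gs' y & x = mul r g + y]
  end.

Definition is_lmod (R : T -> Prop) (M : zmodType) (act : T -> M -> M) :=
  [/\ (forall r m n, R r -> act r (m + n) = act r m + act r n),
      (forall r s m, R r -> R s -> act (r + s) m = act r m + act s m),
      (forall r s m, R r -> R s -> act (mul r s) m = act r (act s m))
    & (forall m, act one m = m)].

Definition lin_map (R : T -> Prop) (M N : zmodType) (actM : T -> M -> M)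
    (actN : T -> N -> N) (h : M -> N) :=
  (forall m n, h (m - n) = h m - h n) /\
  (forall r m, R r -> h (actM r m) = actN r (h m)).

Definition lin_on (R I : T -> Prop) (N : zmodType) (actN : T -> N -> N)
    (g : T -> N) :=
  (forall x y, I x -> I y -> g (x - y) = g x - g y) /\
  (forall r x, R r -> I x -> g (mul r x) = actN r (g x)).

Definition lprojective (R I : T -> Prop) :=
  forall (M N : zmodType) (actM : T -> M -> M) (actN : T -> N -> N),
    is_lmod R actM -> is_lmod R actN ->
    forall p : M -> N, lin_map R actM actN p -> (forall n, exists m, p m = n) ->
    forall g : T -> N, lin_on R I actN g ->
    exists h : T -> M, lin_on R I actM h /\ forall x, I x -> p (h x) = g x.

End RingNotions.

(* opposite multiplication: right notions are left notions for it *)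
Definition opmul (T : Type) (mul : T -> T -> T) := fun x y : T => mul y x.

Definition projective_ideal (T : zmodType) (mul : T -> T -> T) (one : T)
    (R I : T -> Prop) :=
  lprojective mul one R I /\ lprojective (opmul mul) one R I.

Definition semihereditary (T : zmodType) (mul : T -> T -> T) (one : T)
    (R : T -> Prop) :=
  forall gs : seq T, (forall g, g \in gs -> R g) ->
    lprojective mul one R (lgen mul R gs) /\
    lprojective (opmul mul) one R (lgen (opmul mul) R gs).

Definition ideal_sq (T : comPzRingType) (M : T -> Prop) (x : T) :=
  exists n (a b : 'I_n -> T),
    (forall i, M (a i) /\ M (b i)) /\ x = \sum_(i < n) a i * b i.

Section Valuation.
Variables (F : fieldType) (L : splittingFieldType F) (V : F -> Prop).

Definition valuation_domain :=
  @subring F *%R 1 V /\ forall x : F, x != 0 -> V x \/ V x^-1.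

Definition JV := @jacobson F *%R V.

Definition principal_JV :=
  exists pi, V pi /\ forall x, JV x <-> exists v, V v /\ x = v * pi.

Definition polyV (p : {poly F}) := forall i, V p`_i.

Definition intclos (x : L) :=
  exists p : {poly F}, [/\ p \is monic, polyV p & root (map_poly (in_alg L) p) x].

Definition maxS (M : L -> Prop) := @max_left_ideal L *%R intclos M.

Definition loc (M : L -> Prop) (x : L) :=
  exists s t, [/\ intclos s, intclos t, ~ M t & x = s / t].
Definition JSM M := @jacobson L *%R (loc M).
Definition USM M := @unit_of L *%R 1 (loc M).

(* x and y have the same class in Gamma_{S_M} modulo the image of Gamma_V *)
Definition vrel M (x y : L) :=
  exists (a : F) (u : L), [/\ a != 0, USM M u & x = in_alg L a * u * y].

(* e = [Gamma_{S_M} : Gamma_V] : number of classes of K^x *)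
Definition ram_index M (e : nat) :=
  exists xs : 'I_e -> L,
    [/\ (forall i, xs i != 0), (forall i j, i != j -> ~ vrel M (xs i) (xs j))
      & forall y, y != 0 -> exists i, vrel M y (xs i)].

(* [ \bar{S_M} : \bar V ] = n : residues of ys form a \bar V-basis *)
Definition res_deg M (n : nat) :=
  exists ys : 'I_n -> L,
    [/\ (forall i, loc M (ys i)),
        (forall cs : 'I_n -> F, (forall i, V (cs i)) ->
           JSM M (\sum_(i < n) in_alg L (cs i) * ys i) -> forall i, JV (cs i))
      & (forall y, loc M y -> exists cs : 'I_n -> F,
           (forall i, V (cs i)) /\ JSM M (y - \sum_(i < n) in_alg L (cs i) * ys i))].

(* \bar{S_M} / \bar V separable: every residue is a root of a polynomial
   whose reduction pbar is separable, i.e. coprime to its derivative *)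
Definition res_separable M :=
  forall y, loc M y -> exists p a b : {poly F},
    [/\ polyV p, polyV a, polyV b,
        JSM M (map_poly (in_alg L) p).[y]
      & forall i, JV (a * p + b * p^`() - 1)`_i].

Definition nmax (r : nat) :=
  exists Ms : 'I_r -> (L -> Prop),
    [/\ (forall i, maxS (Ms i)),
        (forall i j, i != j -> ~ (forall x, Ms i x <-> Ms j x))
      & forall M, maxS M -> exists i, forall x, M x <-> Ms i x].

Definition tame_defectless :=
  forall M, maxS M -> exists e fr r : nat,
    [/\ ram_index M e, res_deg M fr, nmax r
      & (\dim {:L} = e * fr * r)%N] /\
    (forall p, prime p -> JV p%:R -> ~~ (p %| e)%N) /\
    res_separable M.

(* Galois group; mathcomp composes automorphisms diagrammatically
   ((s * t)%g a = t (s a)), so the paper's composition st is gcomp s t. *)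
Notation gal := (gal_of (fullv : {subfield L})).
Definition gcomp (s t : gal) : gal := (t * s)%g.

Definition normalized_cocycle (f : gal -> gal -> L) :=
  [/\ (forall s t : gal, intclos (f s t) /\ f s t != 0),
      (forall s t g : gal, s (f t g) * f s (gcomp t g) = f s t * f (gcomp s t) g)
    & (forall s : gal, f 1%g s = 1 /\ f s 1%g = 1)].

(* Sigma_f = (+)_s K x_s represented by coefficient functions *)
Definition cpT := {ffun gal -> L}.

Definition cpmul (f : gal -> gal -> L) (a b : cpT) : cpT :=
  [ffun rho : gal => \sum_(s : gal)
       a s * s (b (gcomp (s^-1)%g rho)) * f s (gcomp (s^-1)%g rho)].

Definition cpemb (x : L) : cpT := [ffun s => if s == 1%g then x else 0].
Definition cpone : cpT := cpemb 1.

Fixpoint cppow f (b : cpT) (n : nat) : cpT :=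
  match n with 0 => cpone | n'.+1 => cpmul f b (cppow f b n') end.

Definition Af (x : cpT) := forall s, intclos (x s).

Definition JAf f := jacobson (cpmul f) Af.

Definition Vorder f (B : cpT -> Prop) :=
  [/\ subring (cpmul f) cpone B,
      (forall v, V v -> B (cpemb (in_alg L v))),
      (forall q : cpT, exists n (bs : 'I_n -> cpT) (cs : 'I_n -> F),
          (forall i, B (bs i)) /\
          q = \sum_(i < n) cpmul f (bs i) (cpemb (in_alg L (cs i))))
    & (forall b, B b -> exists p : {poly F},
          [/\ p \is monic, polyV p &
              \sum_(i < size p) cpmul f (cpemb (in_alg L p`_i)) (cppow f b i) = 0])].

Definition extremal f (R : cpT -> Prop) :=
  Vorder f R /\
  forall B, Vorder f B -> (forall x, R x -> B x) ->
    (forall x, jacobson (cpmul f) R x -> jacobson (cpmul f) B x) ->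
    forall x, B x -> R x.

Definition Ol f (I : cpT -> Prop) (x : cpT) := forall y, I y -> I (cpmul f x y).

(* Gr(f^M) is a chain: the preorder sH <=_M tH iff f(s, s^-1 t) \notin M
   is total *)
Definition gr_chain (f : gal -> gal -> L) (M : L -> Prop) :=
  forall s t : gal, ~ M (f s (gcomp (s^-1)%g t)) \/ ~ M (f t (gcomp (t^-1)%g s)).

End Valuation.

(* Main.v *)
Require Import Defs.
From HB Require Import structures.
From mathcomp Require Import all_boot all_order all_fingroup all_algebra all_field.
From mathcomp Require Import boolp.
From mathcomp Require classical_sets.
From mathcomp Require Import ring.
Set Implicit Arguments. Unset Strict Implicit. Unset Printing Implicit Defensive.
Import GRing.Theory.
Local Open Scope ring_scope.

(** Tameness gives, for each maximal ideal [M] of [S], an element of trace [1] lying in all the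
    other maximal ideals.  With it, [A_f] is semisimple modulo
    [J = {a | a_s in M whenever f s s^-1 is not in M}], and as multiplication by [J] climbs in
    the graphs [Gr(f^M)], [J] is the Jacobson radical.
    Everything is compared with (4).  If (4) holds then [J J' = A_f] for
    [J' = {x | x J <= A_f}], as one sees at each [M] on the least [s] with [f s s^-1] in [M];
    then [K /\ J^n = J K] for the syzygies [K] of a left ideal, so that the right identities
    modulo [J] lift to a retraction onto [K], and [A_f] is left semihereditary.
    If (4) fails, a greatest [s] with [f s s^-1] in [M^2] gives an element of [O_l(J)] outside
    [A_f].  When [B] is an order with [J <= J(B)], elements of [B J] have small trace, which
    under (4) forces [B <= A_f]; conversely [O_l(J)] is itself an order of this kind.  If [J] is
    right projective, a dual basis gives [J J' = A_f], hence [J' J = A_f] and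
    [{x | J x <= J} <= A_f].  The cocycle [s t (f t^-1 s^-1)], whose crossed product is opposite
    to that of [f], exchanges left and right. *)

(** As [V] may have any Krull dimension, [S] and [A_f] need not be Noetherian, and no discrete
    valuation or completion is at hand. Two facts replace them: every localization of [S] at a
    maximal ideal [M] is a valuation ring of [L], and [J(V)] principal and nonzero forces [M] to
    differ from [M^2]. The second yields, for each [s], a generator of the ideal of [s]-coefficients
    of [J]; thus [J] is finitely generated on both sides, and divisibility by an element outside
    [M^2] is implied by membership in [M]. When [J(V) = 0] there is no uniformizer, but then [S = L]
    and [J = 0], and this case is split off each time. The passage from [J J'] to [J' J] rests on
    left inverses in [Sigma_f] being right inverses, by finite dimension over [L]. Rings and ideals
    are predicates on an ambient type, so that an order, its overorders and its fractional ideals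
    live in one algebra. Automorphisms compose diagrammatically: the usual product [st] is written
    [t * s], and the usual [s^-1 t] is [t * s^-1]. *)

Definition zsub (T : zmodType) (P : T -> Prop) :=
  P 0 /\ forall x y, P x -> P y -> P (x - y).

Section Zsub.
Variables (T : zmodType) (P : T -> Prop).
Hypothesis hP : zsub P.

Lemma zsub0 : P 0. Proof. by case: hP. Qed.

Lemma zsubB x y : P x -> P y -> P (x - y). Proof. by case: hP => _; apply. Qed.

Lemma zsubN x : P x -> P (- x).
Proof. by move=> Px; rewrite -[- x]add0r; apply: zsubB => //; apply: zsub0. Qed.

Lemma zsubD x y : P x -> P y -> P (x + y).
Proof. by move=> Px Py; rewrite -[y]opprK; apply: zsubB => //; apply: zsubN. Qed.

Lemma zsub_sum (I : Type) (r : seq I) (Q : pred I) (F : I -> T) :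
  (forall i, Q i -> P (F i)) -> P (\sum_(i <- r | Q i) F i).
Proof. by move=> h; apply: big_ind => //; [apply: zsub0 | apply: zsubD]. Qed.

(** Projectivity is tested against modules that are types, so a submodule given by a predicate must
    be carried to a type of its own. *)
Lemma zsub_zmodType : exists (Z : zmodType) (i : Z -> T),
  [/\ injective i, forall x y, i (x - y) = i x - i y & forall t, P t <-> exists z, i z = t].
Proof.
pose p : {pred T} := fun t => `[< P t >].
have cl : zmod_closed p.
  split; first by apply/asboolP; apply: zsub0.
  by move=> x y /asboolP Px /asboolP Py; apply/asboolP; apply: zsubB.
pose pZ : zmodClosed T := HB.pack p (GRing.isZmodClosed.Build T p cl).
pose Z0 := {x : T | x \in pZ}.
pose Z : zmodType := HB.pack Z0 [SubChoice_isSubZmodule of Z0 by <:].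
exists Z, (fun z : Z0 => sval z); split=> //; first exact: val_inj.
move=> t; split; last by move=> [[z /= /asboolP hz] <-].
by move=> /asboolP Pt; exists (exist _ t Pt).
Qed.

End Zsub.

(** * Left ideals, the Jacobson radical and Nakayama's lemma *)

Section LeftIdeals.
Variables (A : pzRingType) (R : A -> Prop).
Hypothesis hR : subring *%R 1 R.

Lemma subring_zsub : zsub R. Proof. by case: hR. Qed.
Lemma subring1 : R 1. Proof. by case: hR. Qed.
Lemma subringM x y : R x -> R y -> R (x * y). Proof. by case: hR => _ _ _; apply. Qed.
Local Notation zR := subring_zsub.

Lemma left_ideal_zsub I : left_ideal *%R R I -> zsub I.
Proof. by case. Qed.

Lemma left_ideal_self : left_ideal *%R R R.
Proof. by case: hR. Qed.

Lemma left_idealD I I' : left_ideal *%R R I -> left_ideal *%R R I' ->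
  left_ideal *%R R (fun x => exists y z, [/\ I y, I' z & x = y + z]).
Proof.
move=> hI hI'; have zI := left_ideal_zsub hI; have zI' := left_ideal_zsub hI'.
case: hI hI' => sI _ _ mI [sI' _ _ mI']; split.
- by move=> _ [y [z [/sI Ry /sI' Rz ->]]]; apply: (zsubD zR).
- by exists 0, 0; rewrite addr0; split=> //; apply: zsub0.
- move=> _ _ [y [z [Iy Iz ->]]] [y' [z' [Iy' Iz' ->]]].
  exists (y - y'), (z - z'); split; last by rewrite opprD addrACA.
    exact: (zsubB zI).
  exact: (zsubB zI').
- move=> r _ Rr [y [z [Iy Iz ->]]]; exists (r * y), (r * z).
  by split; rewrite ?mulrDr //; [apply: mI | apply: mI'].
Qed.

Lemma left_ideal_principal x : R x ->
  left_ideal *%R R (fun y => exists r, R r /\ y = r * x).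
Proof.
move=> Rx; split.
- by move=> _ [r [Rr ->]]; apply: subringM.
- by exists 0; rewrite mul0r; split=> //; apply: (zsub0 zR).
- by move=> _ _ [r [Rr ->]] [s [Rs ->]]; exists (r - s); rewrite mulrBl; split=> //; apply: (zsubB zR).
- by move=> r _ Rr [s [Rs ->]]; exists (r * s); rewrite mulrA; split=> //; apply: subringM.
Qed.

Lemma max_left_ideal_not1 M : max_left_ideal *%R R M -> ~ M 1.
Proof.
case=> [[_ _ _ mM] [x [Rx nMx]] _] M1; apply: nMx.
by rewrite -[x]mulr1; apply: mM.
Qed.

Lemma max_left_ideal_cover M x : max_left_ideal *%R R M -> R x -> ~ M x ->
  exists r, R r /\ M (1 - r * x).
Proof.
move=> [hM [z [Rz nMz]] mM] Rx nMx.
case: (mM _ (left_idealD hM (left_ideal_principal Rx))).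
- move=> y My; exists y, 0; rewrite addr0; split=> //.
  by exists 0; rewrite mul0r; split=> //; apply: (zsub0 zR).
- move=> h; case: nMx; apply: h; exists 0, x; rewrite add0r.
  split=> //; first exact: zsub0 (left_ideal_zsub hM).
  by exists 1; rewrite mul1r; split=> //; apply: subring1.
- move=> h; case: (h 1 subring1) => y [_ [My [r [Rr ->]] e]].
  by exists r; split=> //; rewrite e addrK.
Qed.

Lemma max_left_ideal_above I : left_ideal *%R R I -> ~ I 1 ->
  exists M, max_left_ideal *%R R M /\ forall x, I x -> M x.
Proof.
move=> hI nI1.
pose good (X : A -> Prop) := [/\ left_ideal *%R R X, ~ X 1 & forall x, I x -> X x].
(* Zorn's lemma is applied to the unions of all chains; the empty chain has empty union, hence the
   second disjunct. *)
pose P (X : A -> Prop) := good X \/ forall x, ~ X x.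
have [F FP Ftot|M [PM Mmax]] := @classical_sets.Zorn_bigcup A P.
  case: (EM (exists X x, F X /\ X x)) => [[X0 [x0 [FX0 X0x0]]]|none]; last first.
    by right=> x [X FX Xx]; apply: none; exists X, x.
  have goodF X x : F X -> X x -> good X.
    by move=> FX Xx; case: (FP _ FX) => // /(_ x).
  left; split.
  - split.
    + by move=> x [X FX Xx]; case: (goodF X x FX Xx) => [[+ _ _ _] _ _]; apply.
    + by exists X0 => //; case: (goodF _ _ FX0 X0x0) => [[]].
    + move=> x y [X FX Xx] [Y FY Yy].
      case: (Ftot X Y FX FY) => h.
        by exists Y => //; case: (goodF Y y FY Yy) => [[_ _ + _] _ _]; apply=> //; apply: h.
      by exists X => //; case: (goodF X x FX Xx) => [[_ _ + _] _ _]; apply=> //; apply: h.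
    + move=> r x Rr [X FX Xx]; exists X => //.
      by case: (goodF X x FX Xx) => [[_ _ _ +] _ _]; apply.
  - by move=> [X FX X1]; case: (goodF X 1 FX X1) => _.
  - by move=> x Ix; exists X0 => //; case: (goodF _ _ FX0 X0x0) => _ _; apply.
have I0 : I 0 by case: hI.
have [hM nM1 IM] : good M.
  case: PM => // M0; exfalso; apply: (Mmax I); last by left; split.
  by split; [move=> x /M0 | move=> h; apply: (M0 0); apply: h].
exists M; split=> //; split=> //; first by exists 1; split=> //; apply: subring1.
move=> I' hI' MI'; case: (EM (I' 1)) => [I'1|nI'1].
  by right=> x Rx; rewrite -[x]mulr1; case: hI' => _ _ _; apply.
left=> x I'x; apply: contrapT => nMx; apply: (Mmax I').
  by split=> // h; apply: nMx; apply: h.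
by left; split=> // y /IM; apply: MI'.
Qed.

Lemma quasi_regular_jacobson I : left_ideal *%R R I ->
  (forall j, I j -> exists u, R u /\ u * (1 - j) = 1) ->
  forall j, I j -> jacobson *%R R j.
Proof.
move=> hI qr j Ij; have Rj : R j by case: hI => + _ _ _; apply.
split=> // M hM; apply: contrapT => nMj.
have [r [Rr M1]] := max_left_ideal_cover hM Rj nMj.
have [u [Ru e]] := qr (r * j) (match hI with And4 _ _ _ m => m r j Rr Ij end).
by apply: (max_left_ideal_not1 hM); rewrite -e; case: hM => [[_ _ _ +] _ _]; apply.
Qed.

Lemma local_ring_max N : left_ideal *%R R N -> ~ N 1 ->
  (forall x, R x -> ~ N x -> exists y, R y /\ y * x = 1) -> max_left_ideal *%R R N.
Proof.
move=> hN n1 hu; split=> //; first by exists 1; split=> //; apply: subring1.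
move=> I [sI _ _ mI] sub; case: (EM (exists2 x, I x & ~ N x)) => [[x Ix nx]|no].
  right=> z Rz; have [y [Ry e]] := hu x (sI _ Ix) nx.
  by rewrite -[z]mulr1 -e mulrA; apply: mI => //; apply: subringM.
by left=> x Ix; apply: contrapT => h; apply: no; exists x.
Qed.

Lemma local_ring_jacobson N x : left_ideal *%R R N -> ~ N 1 ->
  (forall x, R x -> ~ N x -> exists y, R y /\ y * x = 1) -> jacobson *%R R x <-> N x.
Proof.
move=> hN n1 hu; split; first by case=> _; apply; apply: local_ring_max.
move=> Nx; apply: (quasi_regular_jacobson hN) Nx => j Nj; apply: hu.
  by apply: (zsubB zR); [apply: subring1 | case: hN => + _ _ _; apply].
by move=> h; apply: n1; rewrite -(subrK j 1); apply: (zsubD (left_ideal_zsub hN)).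
Qed.

Lemma jacobson_left_ideal : left_ideal *%R R (jacobson *%R R).
Proof.
split.
- by move=> x [].
- by split; [apply: (zsub0 zR) | move=> I [[]]].
- move=> x y [Rx hx] [Ry hy]; split; first exact: (zsubB zR).
  move=> I hI; have zI : zsub I by case: hI => /left_ideal_zsub.
  by apply: (zsubB zI); [apply: hx | apply: hy].
- move=> r x Rr [Rx hx]; split; first exact: subringM.
  by move=> I hI; move: (hx I hI); case: hI => [[_ _ _ +] _ _] => h Ix; apply: h.
Qed.

Lemma jacobson_quasi_regular x : jacobson *%R R x -> exists u, R u /\ u * (1 - x) = 1.
Proof.
move=> [Rx hx]; have R1x : R (1 - x) by apply: (zsubB zR) => //; apply: subring1.
apply: contrapT => no.
have [|M [hM sM]] := max_left_ideal_above (left_ideal_principal R1x).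
  by move=> [u [Ru e]]; apply: no; exists u.
have zM : zsub M by case: hM => /left_ideal_zsub.
apply: (max_left_ideal_not1 hM); rewrite -[1](subrK x); apply: (zsubD zM); last exact: hx.
by apply: sM; exists 1; rewrite mul1r; split=> //; apply: subring1.
Qed.

End LeftIdeals.

(** Elimination: [1 - c0 ord0] is left invertible, so the first relation is solved for [k ord0] and
    substituted into the others, whose coefficients stay in [J]. Only relations are handled; no
    quotient module is formed. *)
Lemma nakayama (A : pzRingType) (R J : A -> Prop) (V : lmodType A) (Q : V -> Prop) :
  subring *%R 1 R -> left_ideal *%R R J ->
  (forall j, J j -> exists u, R u /\ u * (1 - j) = 1) ->
  zsub Q -> (forall r v, R r -> Q v -> Q (r *: v)) ->
  forall m (k : 'I_m -> V),
    (forall i, exists q (c : 'I_m -> A),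
       [/\ Q q, forall l, J (c l) & k i = q + \sum_l c l *: k l]) ->
  forall i, Q (k i).
Proof.
move=> hR hJ qr zQ sQ; have zJ := left_ideal_zsub hJ; case: hJ => sJ _ _ mJ.
elim=> [|m IHm] k hk; first by case.
have [q0 [c0 [Qq0 Jc0 e0]]] := hk ord0.
have [u [Ru eu]] := qr _ (Jc0 ord0).
have e0' : k ord0 = u *: q0 + \sum_l (u * c0 (lift ord0 l)) *: k (lift ord0 l).
  rewrite -[LHS]scale1r -eu -scalerA scalerBl scale1r {1}e0 big_ord_recl /=.
  rewrite [c0 ord0 *: _ + _]addrC addrA addrK scalerDr scaler_sumr.
  by congr (_ + _); apply: eq_bigr => l _; rewrite scalerA.
have Qs l : Q (k (lift ord0 l)).
  apply: (IHm (fun l => k (lift ord0 l))) => {}l.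
  have [q [c [Qq Jc e]]] := hk (lift ord0 l).
  exists (q + (c ord0 * u) *: q0), (fun i => c (lift ord0 i) + c ord0 * u * c0 (lift ord0 i)).
  split.
  - by apply: (zsubD zQ) => //; apply: sQ => //; apply: (subringM hR) => //; apply: sJ.
  - move=> i; apply: (zsubD zJ) => //; apply: mJ => //.
    by apply: (subringM hR) => //; apply: sJ.
  - rewrite e big_ord_recl /= e0' scalerDr scalerA -!addrA; congr (_ + (_ + _)).
    rewrite scaler_sumr [RHS](_ : _ = \sum_(i < m) (c (lift ord0 i) *: k (lift ord0 i) +
        (c ord0 * u * c0 (lift ord0 i)) *: k (lift ord0 i))); last first.
      by apply: eq_bigr => i _; rewrite scalerDl.
    rewrite big_split /= addrC; congr (_ + _); apply: eq_bigr => i _.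
    by rewrite scalerA !mulrA.
move=> i; case: (unliftP ord0 i) => [j|] -> //.
rewrite e0'; apply: (zsubD zQ); first exact: sQ.
apply: (zsub_sum zQ) => l _; apply: sQ => //; apply: (subringM hR) => //; exact: sJ.
Qed.

(** * Projectivity of finitely generated left ideals *)

Definition submod (A : pzRingType) (V : lmodType A) (R : A -> Prop) (K : V -> Prop) :=
  zsub K /\ forall r v, R r -> K v -> K (r *: v).

(* The property of [R / J] being semisimple, phrased through right identities
   modulo [J] of left ideals. *)
Definition semisimple_mod (A : pzRingType) (R J : A -> Prop) :=
  forall I, left_ideal *%R R I -> exists e, I e /\ forall x, I x -> J (x - x * e).

Section Generic.
Variables (A : pzRingType) (R J : A -> Prop).
Hypotheses (hR : subring *%R 1 R) (hJ : left_ideal *%R R J).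
Let zR := subring_zsub hR.
Let zJ := left_ideal_zsub hJ.
Let sJ : forall x, J x -> R x. Proof. by case: hJ. Qed.
Let mJ : forall r x, R r -> J x -> J (r * x). Proof. by case: hJ. Qed.

(** Induction on the length. The row [w] lifts a right identity for the left ideal of first
    coordinates; subtracting [x 0 0 *: w] brings the first coordinate into [J], and the induction
    hypothesis treats the tails of such rows. *)
Lemma semisimple_mod_rows n (K : 'rV[A]_n -> Prop) :
  semisimple_mod R J -> submod R K -> (forall x i, K x -> R (x 0 i)) ->
  exists k : 'M[A]_n, (forall i, K (row i k)) /\
    forall x, K x -> forall j, J ((x - x *m k) 0 j).
Proof.
move=> ss; elim: n K => [|n IHn] K [zK mK] RK.
  by exists 0; split; [case | move=> x _; case].
pose I y := exists x, K x /\ y = x 0 0.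
have hI : left_ideal *%R R I.
  split.
  - by move=> _ [x [Kx ->]]; apply: RK.
  - by exists 0; rewrite mxE; split=> //; apply: (zsub0 zK).
  - by move=> _ _ [x [Kx ->]] [y [Ky ->]]; exists (x - y); rewrite !mxE; split=> //; apply: (zsubB zK).
  - by move=> r _ Rr [x [Kx ->]]; exists (r *: x); rewrite mxE; split=> //; apply: mK.
have [_ [[w [Kw ->]] hw]] := ss I hI.
pose K' (y : 'rV[A]_n) := exists x : 'rV[A]_n.+1,
  [/\ K x, J (x 0 0) & y = \row_i x 0 (lift ord0 i)].
have [||k' [Kk' hk']] := IHn K'.
- split.
    split; first by exists 0; rewrite mxE; split; [exact: (zsub0 zK)|exact: (zsub0 zJ)|apply/rowP=> i; rewrite !mxE].
    move=> _ _ [x [Kx Jx ->]] [y [Ky Jy ->]]; exists (x - y); split.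
    + exact: (zsubB zK).
    + by rewrite !mxE; apply: (zsubB zJ).
    + by apply/rowP=> i; rewrite !mxE.
  move=> r _ Rr [x [Kx Jx ->]]; exists (r *: x); split.
    + exact: mK.
    + by rewrite !mxE; apply: mJ.
    + by apply/rowP=> i; rewrite !mxE.
- by move=> _ i [x [Kx _ ->]]; rewrite mxE; apply: RK.
have [l hl] := choice Kk'.
have Kl i : K (l i) by case: (hl i).
have Jl i : J (l i 0 0) by case: (hl i).
have el i j : k' i j = l i 0 (lift ord0 j).
  by case: (hl i) => _ _ /rowP/(_ j); rewrite !mxE.
(* With first row [v] and further rows [l i], the difference of [x] and its image is
   [y - \sum_i y_i l_i] for [y = x - x 0 0 *: w]: what the [l i] contribute through the tail of [w]
   is removed in advance. *)
pose v := w - \sum_i w 0 (lift ord0 i) *: l i.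
exists (\matrix_(i, j) if unlift ord0 i is Some i' then l i' 0 j else v 0 j); split.
  move=> i; case: (unliftP ord0 i) => [i'|] ->.
    by rewrite (_ : row _ _ = l i') //; apply/rowP=> j; rewrite !mxE liftK.
  rewrite (_ : row _ _ = v); last by apply/rowP=> j; rewrite !mxE unlift_none.
  apply: (zsubB zK) => //; apply: (zsub_sum zK) => i' _.
  by apply: mK; [apply: RK | ].
move=> x Kx.
pose y := x - x 0 0 *: w.
have Ky : K y by apply: (zsubB zK) => //; apply: mK => //; apply: RK.
have Jy0 : J (y 0 0) by rewrite !mxE; apply: hw; exists x.
have e : x - x *m (\matrix_(i, j) if unlift ord0 i is Some i' then l i' 0 j else v 0 j) =
    y - \sum_i y 0 (lift ord0 i) *: l i.
  rewrite /y -addrA; congr (_ + _); rewrite -opprD; congr (- _).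
  apply/rowP=> j; rewrite !mxE big_ord_recl !mxE unlift_none  /v ?mxE.
  rewrite !summxE mulrDr mulrN mulr_sumr -addrA; congr (_ + _).
  rewrite addrC -sumrB; apply: eq_bigr => i _.
  by rewrite !mxE liftK mulrBl mulrA.
rewrite e => j; case: (unliftP ord0 j) => [j'|] ->; last first.
  rewrite !mxE summxE; apply: (zsubB zJ); first by move: Jy0; rewrite !mxE.
  by apply: (zsub_sum zJ) => i _; rewrite mxE; apply: mJ => //; apply: RK.
have := hk' (\row_i y 0 (lift ord0 i)) _ j'; rewrite !mxE summxE => h.
rewrite (eq_bigr (fun i => (\row_i y 0 (lift ord0 i)) 0 i * k' i j')).
  by apply: h; exists y.
by move=> i _; rewrite el !mxE.
Qed.

Lemma lgenP (gs : seq A) x :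
  lgen *%R R gs x <-> exists c : 'rV[A]_(size gs),
    (forall i, R (c 0 i)) /\ x = (c *m \col_i gs`_i) 0 0.
Proof.
elim: gs x => [|g gs IH] x /=.
  split=> [->|[c [_ ->]]]; last by rewrite mxE big_ord0.
  by exists 0; rewrite mul0mx mxE; split=> // -[].
split.
  move=> [r [y [Rr /IH [c [Rc ->]] ->]]].
  exists (\row_i if unlift ord0 i is Some i' then c 0 i' else r); split.
    by move=> i; rewrite mxE; case: unliftP.
  rewrite !mxE big_ord_recl !mxE unlift_none; congr (_ + _).
  by apply: eq_bigr => i _; rewrite !mxE liftK.
move=> [c [Rc ->]]; exists (c 0 0), (((\row_(i < size gs) c 0 (lift ord0 i)) *m (\col_(i < size gs) gs`_i) : 'M[A]_1) 0 0).
split=> //.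
  by apply/IH; exists (\row_i c 0 (lift ord0 i)); split=> // i; rewrite mxE.
rewrite !mxE big_ord_recl !mxE; congr (_ + _).
by apply: eq_bigr => i _; rewrite !mxE.
Qed.

Section LModules.
Variables (M : zmodType) (act : A -> M -> M).
Hypothesis hM : is_lmod *%R 1 R act.

Lemma lmod_act0r m : act 0 m = 0.
Proof.
case: hM => _ h _ _; have R0 := zsub0 zR.
by have := h 0 0 m R0 R0; rewrite addr0 => /eqP; rewrite -subr_eq0 opprD addrA subrr sub0r oppr_eq0 => /eqP.
Qed.

Lemma lmod_actBl r s m : R r -> R s -> act (r - s) m = act r m - act s m.
Proof.
case: hM => _ h _ _ Rr Rs; apply/eqP; rewrite eq_sym subr_eq -h ?subrK //.
exact: (zsubB zR).
Qed.

Lemma lmod_act_sumr r (I : finType) (F : I -> M) : R r ->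
  act r (\sum_i F i) = \sum_i act r (F i).
Proof.
case: hM => h _ _ _ Rr; apply: (big_morph (act r)) => [m n|]; first exact: h.
have := h r 0 0 Rr; rewrite addr0 => /eqP.
by rewrite -subr_eq0 opprD addrA subrr sub0r oppr_eq0 => /eqP.
Qed.
End LModules.

Lemma lin_on_comb n (I : A -> Prop) (N : zmodType) (act : A -> N -> N) (g : A -> N)
    (c : 'rV[A]_n) (x : 'cV[A]_n) :
  is_lmod *%R 1 R act -> lin_on *%R R I act g -> left_ideal *%R R I ->
  (forall i, R (c 0 i)) -> (forall i, I (x i 0)) ->
  g ((c *m x) 0 0) = \sum_i act (c 0 i) (g (x i 0)).
Proof.
move=> hN [gB gM] hI Rc Ix; have zI := left_ideal_zsub hI.
have g0 : g 0 = 0 by have := gB 0 0 (zsub0 zI) (zsub0 zI); rewrite !subrr.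
have gN z : I z -> g (- z) = - g z.
  by move=> Iz; rewrite -[- z]sub0r gB ?g0 ?sub0r //; exact: (zsub0 zI).
have gD y z : I y -> I z -> g (y + z) = g y + g z.
  by move=> Iy Iz; rewrite -{1}[z]opprK gB ?gN ?opprK //; exact: (zsubN zI).
have hcx i : I (c 0 i * x i 0) by case: hI => _ _ _; apply.
rewrite mxE.
suff: I (\sum_i c 0 i * x i 0) /\ g (\sum_i c 0 i * x i 0) = \sum_i act (c 0 i) (g (x i 0)) by case.
apply: (big_rec2 (fun a b => I a /\ g a = b)); first by split=> //; apply: (zsub0 zI).
move=> i a b _ [Ia gab]; split; first exact: (zsubD zI).
by rewrite gD // gab gM.
Qed.

(** [k] retracts [R^n] onto the syzygies of [g], so [1 - k] identifies the ideal with a direct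
    summand of [R^n]. A lift sends [c *m g] to the combination of the [m i] with coefficients
    [c - c *m k], and these depend on [c *m g] only. *)
Lemma lprojective_of_retraction n (g : 'cV[A]_n) (k : 'M[A]_n) :
  (forall i, R (g i 0)) -> (forall i j, R (k i j)) -> k *m g = 0 ->
  (forall x : 'rV[A]_n, (forall i, R (x 0 i)) -> x *m g = 0 -> x *m k = x) ->
  lprojective *%R 1 R (fun x => exists c : 'rV[A]_n, (forall i, R (c 0 i)) /\ x = (c *m g) 0 0).
Proof.
move=> Rg Rk kg hk; set I := (fun x => _).
have hI : left_ideal *%R R I.
  split.
  - move=> _ [c [Rc ->]]; rewrite mxE; apply: (zsub_sum zR) => i _.
    exact: (subringM hR).
  - by exists 0; rewrite mul0mx mxE; split=> // i; rewrite mxE; apply: (zsub0 zR).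
  - move=> _ _ [c [Rc ->]] [d [Rd ->]]; exists (c - d); rewrite mulmxBl !mxE; split=> // i.
    by rewrite !mxE; apply: (zsubB zR).
  - move=> r _ Rr [c [Rc ->]]; exists (r *: c); rewrite -scalemxAl [RHS]mxE; split=> // i.
    by rewrite mxE; apply: (subringM hR).
have Ig i : I (g i 0).
  exists (delta_mx 0 i); split.
    by move=> j; rewrite mxE; case: eqP => _; case: eqP => _ /=; [exact: subring1 hR|exact: (zsub0 zR)|exact: (zsub0 zR)|exact: (zsub0 zR)].
  by rewrite -rowE mxE.
move=> M N actM actN hM hN p [pB pM] psurj f hf.
have [m hm] := choice (fun i => psurj (f (g i 0))).
have p0 : p 0 = 0 by have := pB 0 0; rewrite !subrr.
have pD a b : p (a + b) = p a + p b.
  by rewrite -{1}[b]opprK pB -[- b]sub0r pB p0 sub0r opprK.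
pose E (c : 'rV[A]_n) := \sum_i actM ((c - c *m k) 0 i) (m i).
have Rck (c : 'rV[A]_n) i : (forall i, R (c 0 i)) -> R ((c *m k) 0 i).
  move=> Rc; rewrite mxE; apply: (zsub_sum zR) => j _; exact: (subringM hR).
have Rcc (c : 'rV[A]_n) i : (forall i, R (c 0 i)) -> R ((c - c *m k) 0 i).
  by move=> Rc; rewrite mxE [X in _ + X]mxE; apply: (zsubB zR) => //; apply: Rck.
have EB (c d : 'rV[A]_n) : (forall i, R (c 0 i)) -> (forall i, R (d 0 i)) -> E (c - d) = E c - E d.
  move=> Rc Rd; rewrite /E -sumrB; apply: eq_bigr => i _.
  rewrite -(lmod_actBl hM) //; try exact: Rcc.
  by rewrite mulmxBl opprD addrACA -opprD [in LHS]mxE [X in _ + X]mxE.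
have E0 (c : 'rV[A]_n) : (forall i, R (c 0 i)) -> c *m g = 0 -> E c = 0.
  move=> Rc cg; rewrite /E hk // subrr big1 // => i _.
  by rewrite mxE (lmod_act0r hM).
have Ewd (c d : 'rV[A]_n) : (forall i, R (c 0 i)) -> (forall i, R (d 0 i)) -> (c *m g) 0 0 = (d *m g) 0 0 ->
    E c = E d.
  move=> Rc Rd e; apply/eqP; rewrite -subr_eq0 -EB // E0 //.
    by move=> i; rewrite !mxE; apply: (zsubB zR).
  by apply/matrixP=> i j; rewrite !ord1 mulmxBl !mxE; move: e; rewrite !mxE => ->; rewrite subrr.
pose h x := if pselect (I x) is left Ix then E (sval (cid Ix)) else 0.
have hE (c : 'rV[A]_n) : (forall i, R (c 0 i)) -> h ((c *m g) 0 0) = E c.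
  move=> Rc; rewrite /h; case: pselect => [Ix|[]]; last by exists c.
  by case: (cid Ix) => d [Rd e] /=; apply: Ewd.
exists h; split; [split|].
- move=> _ _ [c [Rc ->]] [d [Rd ->]].
  rewrite (_ : _ - _ = ((c - d : 'rV[A]_n) *m g) 0 0); last by rewrite mulmxBl !mxE.
  by rewrite !hE // ?EB // => i; rewrite !mxE; apply: (zsubB zR).
- move=> r _ Rr [c [Rc ->]].
  rewrite (_ : r * _ = ((r *: c) *m g) 0 0); last by rewrite -scalemxAl [RHS]mxE.
  rewrite !hE //; last by move=> i; rewrite mxE; apply: (subringM hR).
  rewrite /E (lmod_act_sumr hM) //; apply: eq_bigr => i _.
  have [_ _ hA _] := hM; rewrite -hA //; last exact: Rcc.
  have -> : r *: c - (r *: c) *m k = r *: (c - c *m k) by rewrite -scalemxAl scalerBr.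
  by rewrite [in LHS]mxE.
- move=> _ [c [Rc ->]]; rewrite hE // /E.
  rewrite (big_morph p (id1 := 0) (op1 := +%R)) //.
  have -> : c *m g = (c - c *m k) *m g by rewrite mulmxBl -mulmxA kg mulmx0 subr0.
  rewrite (lin_on_comb hN hf hI) //; last by move=> i; apply: Rcc.
  by apply: eq_bigr => i _; rewrite pM ?hm //; apply: Rcc.
Qed.

(** The action is a total function of the scalar, meaningful on [R] only; for scalars outside [R]
    its value is arbitrary. *)
Lemma submod_lmod (V : lmodType A) (P : V -> Prop) : submod R P ->
  exists (Z : zmodType) (i : Z -> V) (act : A -> Z -> Z),
  [/\ is_lmod *%R 1 R act, injective i, forall x y, i (x - y) = i x - i y,
      forall t, P t <-> exists z, i z = t & forall r z, R r -> i (act r z) = r *: i z].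
Proof.
move=> [zP mP]; have [Z [i [inj iB im]]] := zsub_zmodType zP.
have ex r z : exists z', R r -> i z' = r *: i z.
  case: (EM (R r)) => [Rr|nR]; last by exists 0.
  have /im [z' e] : P (r *: i z) by apply: mP => //; apply/im; exists z.
  by exists z'.
have [act hact] := choice (fun rz : A * Z => ex rz.1 rz.2).
pose a r z := act (r, z).
have ha r z : R r -> i (a r z) = r *: i z by move=> Rr; apply: (hact (r, z)).
have i0 : i 0 = 0 by have := iB 0 0; rewrite !subrr.
have iD x y : i (x + y) = i x + i y by rewrite -{1}[y]opprK iB -[- y]sub0r iB i0 sub0r opprK.
exists Z, i, a; split=> //; split.
- by move=> r x y Rr; apply: inj; rewrite iD !ha // iD scalerDr.
- by move=> r s x Rr Rs; apply: inj; rewrite iD !ha //; [rewrite scalerDl | apply: (zsubD zR)].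
- by move=> r s x Rr Rs; apply: inj; rewrite !ha ?scalerA //; apply: (subringM hR).
- by move=> x; apply: inj; rewrite ha ?scale1r //; apply: (subring1 hR).
Qed.

(** A linear map [h] from [I] to [R^n] is right multiplication by the row [q h(p)]: as [p] is
    central, [p h(x) = h(p x) = h(x p) = x h(p)]. Applied to a section of the presentation of [I] by
    [g], this turns projectivity into an identity [y g = 1] with [I y] contained in [R^n]. *)
Lemma lprojective_dual_basis n (g : 'cV[A]_n) (I : A -> Prop) (p q : A) :
  left_ideal *%R R I ->
  (forall x, I x -> exists c : 'rV[A]_n, (forall i, R (c 0 i)) /\ x = (c *m g) 0 0) ->
  (forall i, I (g i 0)) -> lprojective *%R 1 R I ->
  I p -> (forall x, p * x = x * p) -> q * p = 1 -> 
  exists y : 'rV[A]_n, (forall i x, I x -> R (x * y 0 i)) /\ y *m g = 1%:M.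
Proof.
move=> hI gen Ig proj Ip cp qp; have zI := left_ideal_zsub hI.
have sI x : I x -> R x by case: hI => + _ _ _; apply.
have mI r x : R r -> I x -> I (r * x) by case: hI => _ _ _; apply.
have [M [i [actM [hM iI iB iP iA]]]] :
    exists (Z : zmodType) (i : Z -> 'rV[A]_n) (act : A -> Z -> Z),
    [/\ is_lmod *%R 1 R act, injective i, forall x y, i (x - y) = i x - i y,
      forall t : 'rV[A]_n, (forall j, R (t 0 j)) <-> exists z, i z = t & forall r z, R r -> i (act r z) = r *: i z].
  apply: submod_lmod; split.
    split; first by move=> j; rewrite mxE; apply: (zsub0 zR).
    by move=> x y Rx Ry j; rewrite !mxE; apply: (zsubB zR).
  by move=> r x Rr Rx j; rewrite mxE; apply: (subringM hR).
have [N [k [actN [hN kI kB kP kA]]]] :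
    exists (Z : zmodType) (i : Z -> A^o) (act : A -> Z -> Z),
    [/\ is_lmod *%R 1 R act, injective i, forall x y, i (x - y) = i x - i y,
      forall t, I t <-> exists z, i z = t & forall r z, R r -> i (act r z) = r *: i z].
  by apply: submod_lmod; split=> // r v Rr; apply: mI.
have exf x : exists z, I x -> k z = x :> A.
  case: (EM (I x)) => [Ix|nI]; last by exists 0.
  by case/kP: Ix => z e; exists z.
have [f hf] := choice exf.
have exP z : exists z', k z' = (i z *m g) 0 0.
  apply/kP; rewrite mxE; apply: (zsub_sum zI) => j _; apply: mI => //.
  by move: j; apply/iP; exists z.
have [P hP] := choice exP.
have [|||h [[hB hA] hPh]] := proj M N actM actN hM hN P _ _ f _.
- split.
    by move=> x y; apply: kI; rewrite kB !hP iB mulmxBl !mxE.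
  by move=> r x Rr; apply: kI; rewrite kA // !hP iA // -scalemxAl mxE.
- move=> z; have Iz : I (k z) by apply/kP; exists z.
  have [c [Rc e]] := gen _ Iz; case/iP: Rc => z' e'.
  by exists z'; apply: kI; rewrite hP e' -e.
- split.
    by move=> x y Ix Iy; apply: kI; rewrite kB !hf //; apply: (zsubB zI).
  by move=> r x Rr Ix; apply: kI; rewrite kA // !hf //; apply: mI.
have pq : p * q = 1 by rewrite cp.
have cq x : q * x = x * q.
  by rewrite -[LHS]mulr1 -pq !mulrA -(mulrA q) -cp mulrA qp mul1r.
have hE x : I x -> i (h x) = x *: (q *: i (h p)).
  move=> Ix; have Rx := sI _ Ix; have Rp := sI _ Ip.
  by rewrite scalerA -cq -scalerA -(iA x) // -hA // -cp hA // iA // scalerA qp scale1r.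
exists (q *: i (h p)); split.
  move=> j x Ix; have : forall j, R (i (h x) 0 j) by apply/iP; exists (h x).
  by move/(_ j); rewrite hE // mxE.
have e : (i (h p) *m g) 0 0 = p by rewrite -hP hPh // hf.
rewrite -scalemxAl; apply/matrixP=> a b; rewrite !ord1 mxE e qp.
by rewrite mxE.
Qed.

(** With [J'] the set of [c] such that [c J] is in [R], the hypotheses put [1] in [J J']. What is
    needed is [1] in [J' J]: if [1 = \sum c d] with [c] in [J'] and [d] in [J], then
    [x = \sum c (d x)] with [d x] in [J]. *)
Lemma radical_order_sub n (a : 'rV[A]_n) (b : 'cV[A]_n) m (g : 'cV[A]_m) (p q : A) :
  semisimple_mod R J -> (forall j, J j -> exists u, R u /\ u * (1 - j) = 1) ->
  (forall x r, J x -> R r -> J (x * r)) ->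
  (forall i, J (a 0 i)) -> (forall i x, J x -> R (b i 0 * x)) -> a *m b = 1%:M ->
  (forall i, J (g i 0)) ->
  (forall x, J x -> exists c : 'rV[A]_m, (forall i, R (c 0 i)) /\ x = (c *m g) 0 0) ->
  J p -> q * p = 1 -> (forall x y : A, x * y = 1 -> y * x = 1) ->
  forall x, (forall y, J y -> J (y * x)) -> R x.
Proof.
move=> ss qr rJ Ja Rb ab Jg gen Jp qp dfin x Jx.
(* [T] is [J' J], taken as the intersection of the left ideals that contain all products. *)
pose T y := forall I, left_ideal *%R R I ->
  (forall c d, (forall z, J z -> R (c * z)) -> J d -> I (c * d)) -> I y.
have hT : left_ideal *%R R T.
  split.
  - by move=> y; apply; [exact: left_ideal_self | move=> c d hc Jd; apply: hc].
  - by move=> I [].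
  - move=> y z Ty Tz I hI hcd; apply: (zsubB (left_ideal_zsub hI)); [exact: Ty | exact: Tz].
  - by move=> r y Rr Ty I hI hcd; have [_ _ _] := hI; apply=> //; apply: Ty.
have TE c d : (forall z, J z -> R (c * z)) -> J d -> T (c * d) by move=> hc Jd I hI; apply.
have zT := left_ideal_zsub hT.
have [e [Te he]] := ss T hT.
have Re : R e by case: hT => + _ _ _; apply.
have absum z : z = \sum_i a 0 i * (b i 0 * z).
  have := congr1 (fun M : 'M[A]_1 => M 0 0 * z) ab; rewrite !mxE /= mul1r mulr_suml => {1}<-.
  by apply: eq_bigr => i _; rewrite mulrA.
(* [J = J J' J], and modulo [J] the right identity [e] of [J' J] can be inserted:
   [J = J e + J J], so [J = J e] by Nakayama. *)
pose Q (z : A^o) := exists y, J y /\ z = y * e.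
have zQ : zsub Q.
  split; first by exists 0; rewrite mul0r; split=> //; apply: (zsub0 zJ).
  by move=> _ _ [y [Jy ->]] [z [Jz ->]]; exists (y - z); rewrite mulrBl; split=> //; apply: (zsubB zJ).
have mQ r (z : A^o) : R r -> Q z -> Q (r *: z).
  by move=> Rr [y [Jy ->]]; exists (r * y); split; [apply: mJ | exact: mulrA].
have Qg i : Q (g i 0).
  apply: (nakayama (k := fun i => g i 0 : A^o) hR hJ qr zQ mQ) => {}i.
  have Jd l : J (b l 0 * g i 0 - b l 0 * g i 0 * e) by apply: he; apply: TE => // z; apply: Rb.
  have [c hc] := choice (fun l => gen _ (Jd l)).
  have Rc l j : R (c l 0 j) by case: (hc l).
  exists (g i 0 * e), (fun j => \sum_l a 0 l * c l 0 j); split.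
  - by exists (g i 0).
  - by move=> j; apply: (zsub_sum zJ) => l _; apply: rJ.
  - apply/eqP; rewrite addrC -subr_eq; apply/eqP.
    rewrite [LHS](_ : _ = \sum_l a 0 l * (b l 0 * g i 0 - b l 0 * g i 0 * e)); last first.
      rewrite {1}(absum (g i 0)) (absum (g i 0 * e)) -sumrB.
      by apply: eq_bigr => l _; rewrite mulrBr !mulrA.
    under eq_bigr => l _ do rewrite (proj2 (hc l)) mxE mulr_sumr.
    rewrite exchange_big /=; apply: eq_bigr => j _; rewrite /GRing.scale /= mulr_suml.
    by apply: eq_bigr => l _; rewrite mulrA.
have JQ z : J z -> Q z.
  move=> /gen [c [Rc ->]]; rewrite mxE; apply: (zsub_sum zQ) => i _.
  exact: (mQ _ (g i 0 : A^o)).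
have [y [Jy ey]] := JQ p Jp.
(* From [p = y e], the element [q y] is a left inverse of [e], hence also a right inverse; so [e]
   can be cancelled on the right in [(1 - e) e = z e]. *)
have ef : e * (q * y) = 1 by apply: dfin; rewrite -mulrA -ey.
have [z [Jz ez]] : Q (e - e * e) by apply: JQ; apply: he.
have e1 : 1 - e = z.
  have : (1 - e) * e * (q * y) = z * e * (q * y) by rewrite -ez mulrBl mul1r.
  by rewrite -!(mulrA _ e) ef !mulr1.
have [u [Ru eu]] := qr z Jz.
have T1 : T 1.
  have [_ _ _ mT] := hT.
  by rewrite -eu -e1 opprB addrC subrK; apply: mT.
have [||_ Rx] := T1 (fun t => R t /\ R (t * x)).
- split.
  + by move=> t [].
  + by rewrite mul0r; split; apply: (zsub0 zR).
  + by move=> s t [Rs Rsx] [Rt Rtx]; rewrite mulrBl; split; apply: (zsubB zR).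
  + by move=> r t Rr [Rt Rtx]; rewrite -mulrA; split; apply: (subringM hR).
- by move=> c d hc Jd; rewrite -mulrA; split; apply: hc => //; apply: Jx.
by rewrite mul1r in Rx.
Qed.

(** [k0] acts on the syzygies [K] as the identity modulo [J]. Since the elements of [K] with entries
    in [J] form [J K], Nakayama gives [K = K k0]. After clearing denominators, [k0] is onto the
    syzygies over [A], where surjective implies injective; inverting it on [K] supplies the
    retraction. *)
Lemma lprojective_lgen (gs : seq A) :
  semisimple_mod R J -> (forall j, J j -> exists u, R u /\ u * (1 - j) = 1) ->
  (forall x r, J x -> R r -> J (x * r)) ->
  (forall x, J x -> x = 0) \/ (exists n (a : 'rV[A]_n) (b : 'cV[A]_n),
     [/\ forall i, J (a 0 i), forall i x, J x -> R (b i 0 * x) & a *m b = 1%:M]) ->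
  (forall n (u : 'rV[A]_n), exists d d', d' * d = 1 /\ forall i, R ((d *: u) 0 i)) ->
  (forall n (U : 'rV[A]_n -> Prop) (k : 'M[A]_n), submod (fun=> True) U ->
     (forall u, U u -> U (u *m k)) -> (forall u, U u -> exists v, U v /\ v *m k = u) ->
     forall u, U u -> u *m k = 0 -> u = 0) ->
  (forall n (g : 'cV[A]_n), (forall i, R (g i 0)) -> exists m (k : 'M[A]_(m, n)),
     [/\ forall i j, R (k i j), k *m g = 0 & forall x : 'rV[A]_n, (forall i, R (x 0 i)) ->
        x *m g = 0 -> exists c : 'rV[A]_m, (forall i, R (c 0 i)) /\ x = c *m k]) ->
  (forall g, g \in gs -> R g) -> lprojective *%R 1 R (lgen *%R R gs).
Proof.
move=> ss qr rJ invJ den inj fg Rgs.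
rewrite (_ : lgen _ _ _ = fun x => exists c : 'rV[A]_(size gs),
    (forall i, R (c 0 i)) /\ x = (c *m \col_i gs`_i) 0 0); last first.
  by apply/funext => x; apply/propext; apply: lgenP.
set g := (\col_i gs`_i); have Rg i : R (g i 0) by rewrite mxE; apply: Rgs; rewrite mem_nth.
move: g Rg; move: (size gs) => n {gs Rgs} g Rg.
pose K (x : 'rV[A]_n) := (forall i, R (x 0 i)) /\ x *m g = 0.
have hK : submod R K.
  split; [split|].
  - by split; [move=> i; rewrite mxE; apply: (zsub0 zR) | rewrite mul0mx].
  - move=> x y [Rx xg] [Ry yg]; split; last by rewrite mulmxBl xg yg subrr.
    by move=> i; rewrite !mxE; apply: (zsubB zR).
  - move=> r x Rr [Rx xg]; split; last by rewrite -scalemxAl xg scaler0.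
    by move=> i; rewrite mxE; apply: (subringM hR).
have [k0 [Kk0 hk0]] := semisimple_mod_rows ss hK (fun x i h => proj1 h i).
have [zK mK] := hK.
have Kmul m (c : 'rV[A]_m) (k : 'M[A]_(m, n)) : (forall i, R (c 0 i)) ->
    (forall i, K (row i k)) -> K (c *m k).
  move=> Rc Kk; rewrite mulmx_sum_row; apply: (zsub_sum zK) => i _; exact: mK.
have [m [k [Rk kg genK]]] := fg n g Rg.
have Kk i : K (row i k).
  by split; [move=> j; rewrite mxE | rewrite -row_mul kg; apply/rowP=> j; rewrite !mxE].
(* Each [b l 0 *: x] is again a syzygy with entries in [R], so [x = \sum_l a_l (b_l x)] has
   coefficients in [J] over the generators. *)
have JK x : K x -> (forall i, J (x 0 i)) ->
    exists c : 'rV[A]_m, (forall i, J (c 0 i)) /\ x = c *m k.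
  move=> [Rx xg] Jx; case: invJ => [J0|[p [a [b [Ja Rb ab]]]]].
    exists 0; split; first by move=> i; rewrite mxE; apply: (zsub0 zJ).
    by rewrite mul0mx; apply/rowP=> i; rewrite mxE (J0 (x 0 i)).
  have Kbx l : K (b l 0 *: x).
    by split; [move=> i; rewrite mxE; apply: Rb | rewrite -scalemxAl xg scaler0].
  have [c hc] := choice (fun l => genK _ (proj1 (Kbx l)) (proj2 (Kbx l))).
  exists (\sum_l a 0 l *: c l); split.
    move=> i; rewrite summxE; apply: (zsub_sum zJ) => l _; rewrite mxE; apply: rJ => //.
    by case: (hc l).
  rewrite mulmx_suml -[LHS]mul1mx -ab.
  rewrite (_ : a *m b = (\sum_l a 0 l * b l 0)%:M); last first.
    by apply/matrixP=> i j; rewrite !ord1 !mxE.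
  rewrite mul_scalar_mx scaler_suml; apply: eq_bigr => l _.
  by rewrite -scalemxAl -(proj2 (hc l)) scalerA.
pose Q (x : 'rV[A]_n) := exists y, K y /\ x = y *m k0.
have zQ : zsub Q.
  split; first by exists 0; rewrite mul0mx; split=> //; apply: (zsub0 zK).
  move=> _ _ [y [Ky ->]] [z [Kz ->]]; exists (y - z); rewrite mulmxBl; split=> //.
  exact: (zsubB zK).
have mQ r x : R r -> Q x -> Q (r *: x).
  by move=> Rr [y [Ky ->]]; exists (r *: y); rewrite -scalemxAl; split=> //; apply: mK.
have Kk0' x : K x -> K (x *m k0) by move=> [Rx _]; apply: Kmul.
have Qk i : Q (row i k).
  apply: (nakayama (k := fun i => row i k) hR hJ qr zQ mQ) => {}i.
  have [||c [Jc ec]] := JK (row i k - row i k *m k0).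
  - by apply: (zsubB zK) => //; apply: Kk0'.
  - by apply: hk0.
  exists (row i k *m k0), (fun j => c 0 j); split=> //; first by exists (row i k).
  by rewrite -mulmx_sum_row -ec addrC subrK.
have QK x : K x -> Q x.
  move=> [Rx xg]; have [c [Rc ->]] := genK x Rx xg.
  by rewrite mulmx_sum_row; apply: (zsub_sum zQ) => i _; apply: mQ.
have [l hl] := choice (fun i => QK _ (Kk0 i)).
(* The rows of [k'] are preimages in [K] of the rows of [k0]. As [k' *m k0 = k0], for [x] in [K] the
   row [x - x *m k'] is killed by [k0], hence zero. *)
pose k' := \matrix_(i, j) l i 0 j.
have rk' i : row i k' = l i by apply/rowP=> j; rewrite !mxE.
have Kk' i : K (row i k') by rewrite rk'; case: (hl i).
have k'k0 : k' *m k0 = k0.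
  by apply/row_matrixP=> i; rewrite row_mul rk'; case: (hl i) => _ <-.
pose U (x : 'rV[A]_n) := x *m g = 0.
have injK x : K x -> x *m k0 = 0 -> x = 0.
  move=> [_ xg]; apply: (inj n U) => //.
  - split; [split|].
    + by rewrite /U mul0mx.
    + by move=> u v; rewrite /U mulmxBl => -> ->; rewrite subrr.
    + by move=> r v _; rewrite /U -scalemxAl => ->; rewrite scaler0.
  - move=> u _; rewrite /U -mulmxA.
    rewrite (_ : k0 *m g = 0) ?mulmx0 //; apply/row_matrixP=> i.
    by rewrite row_mul; case: (Kk0 i) => _ ->; apply/rowP=> j; rewrite !mxE.
  - move=> u Uu; have [d [d' [d'd Rdu]]] := den n u.
    have [|v [[Rv vg] e]] := QK (d *: u).
      by split=> //; rewrite -scalemxAl Uu scaler0.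
    exists (d' *: v); rewrite /U -!scalemxAl vg scaler0; split=> //.
    by rewrite -e scalerA d'd scale1r.
apply: (lprojective_of_retraction (k := k')) => //.
- by move=> i j; have [+ _] := Kk' i; move/(_ j); rewrite mxE.
- apply/row_matrixP=> i; rewrite row_mul; case: (Kk' i) => _ ->.
  by apply/rowP=> j; rewrite !mxE.
- move=> x Rx xg; apply/eqP; rewrite -subr_eq0; apply/eqP; apply: injK.
    by apply: (zsubB zK) => //; apply: Kmul.
  by rewrite mulmxBl -mulmxA k'k0 subrr.
Qed.

End Generic.

(** * The integral closure and its maximal ideals *)

Section SubringType.
Variables (K : comNzRingType) (R : K -> Prop).
Hypothesis hR : subring *%R 1 R.

(** Integral elements, ideal quotients and characteristic polynomials are treated over rings that
    are types; this carries a subring to one. *)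
Lemma subring_comNzRingType : exists (B : comNzRingType) (i : {rmorphism B -> K}),
  injective i /\ forall t, R t <-> exists b, i b = t.
Proof.
pose p : {pred K} := fun t => `[< R t >].
have cl : subring_closed p.
  case: hR => R0 R1 RB RM; split; first by apply/asboolP.
    by move=> x y /asboolP Rx /asboolP Ry; apply/asboolP; apply: RB.
  by move=> x y /asboolP Rx /asboolP Ry; apply/asboolP; apply: RM.
pose pZ : subringClosed K := HB.pack p (GRing.isSubringClosed.Build K p cl).
pose Z0 := {x : K | x \in pZ}.
pose Z : subComNzRingType _ := HB.pack Z0 [SubChoice_isSubComNzRing of Z0 by <:].
exists Z, (val : {rmorphism Z -> K}); split; first exact: val_inj.
move=> t; split; last by move=> [[z /= /asboolP hz] <-].
by move=> /asboolP Pt; exists (exist _ t Pt).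
Qed.
End SubringType.

Section Subring.
Variables (K : comNzRingType) (R : K -> Prop).
Hypothesis hR : subring *%R 1 R.

Lemma subring_prod (I : Type) (r : seq I) (P : pred I) (F : I -> K) :
  (forall i, P i -> R (F i)) -> R (\prod_(i <- r | P i) F i).
Proof. by move=> h; apply: big_ind => //; [apply: subring1 hR | apply: (subringM hR)]. Qed.

Lemma subringX x n : R x -> R (x ^+ n).
Proof.
move=> Rx; elim: n => [|n IH]; first by rewrite expr0; apply: subring1 hR.
by rewrite exprS; apply: (subringM hR).
Qed.

Lemma subringXn n : R n%:R.
Proof.
elim: n => [|n IH]; first exact: zsub0 (subring_zsub hR).
by rewrite -addn1 natrD; apply: (zsubD (subring_zsub hR)) => //; apply: subring1 hR.
Qed.
End Subring.

Section Valuation.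
Variables (F : fieldType) (L : splittingFieldType F) (V : F -> Prop).
Hypothesis hV : valuation_domain V.
Notation S := (@intclos F L V).

Let ringV : subring *%R 1 V. Proof. by case: hV. Qed.
Let zV := subring_zsub ringV.

Lemma valuation_total x : x != 0 -> V x \/ V x^-1.
Proof. by case: hV => _; apply. Qed.

Let nonunit x := V x /\ (x != 0 -> ~ V x^-1).

Lemma nonunit_ideal : left_ideal *%R V nonunit.
Proof.
have mN r x : V r -> nonunit x -> nonunit (r * x).
  move=> Vr [Vx nx]; split; first exact: (subringM ringV).
  rewrite mulf_eq0 negb_or invfM => /andP[r0 x0] h; apply: (nx x0).
  by rewrite -[x^-1]mul1r -(divff r0) -mulrA; apply: (subringM ringV).
have aN x y : x != 0 -> y != 0 -> V (x / y) -> nonunit x -> nonunit y -> nonunit (x + y).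
  move=> x0 y0 Vxy nx ny.
  have -> : x + y = (x / y + 1) * y by rewrite mulrDl mul1r divfK.
  by apply: mN => //; apply: (zsubD zV) => //; apply: subring1 ringV.
split.
- by move=> x [].
- by split; [apply: (zsub0 zV) | rewrite eqxx].
- move=> x y nx ny.
  have ny' : nonunit (- y) by rewrite -mulN1r; apply: mN => //; apply: (zsubN zV); apply: subring1 ringV.
  have [->|x0] := eqVneq x 0; first by rewrite sub0r.
  have [->|y0] := eqVneq y 0; first by rewrite subr0.
  have y0' : - y != 0 by rewrite oppr_eq0.
  have := valuation_total (mulf_neq0 x0 (invr_neq0 y0')).
  case=> [h|]; first exact: aN.
  by rewrite invfM invrK mulrC addrC => h; apply: aN.
- exact: mN.
Qed.

Lemma nonunit1 : ~ nonunit 1.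
Proof. by move=> [_]; rewrite oner_neq0 invr1 => /(_ isT); apply; apply: subring1 ringV. Qed.

Lemma nonunit_inv x : V x -> ~ nonunit x -> exists y, V y /\ y * x = 1.
Proof.
move=> Vx nx; have [e|x0] := eqVneq x 0; first by case: nx; rewrite e; case: nonunit_ideal.
by exists x^-1; rewrite mulVf //; split=> //; apply: contrapT => h; apply: nx.
Qed.

Lemma JVP x : JV V x <-> V x /\ (x != 0 -> ~ V x^-1).
Proof. exact: (local_ring_jacobson ringV x nonunit_ideal nonunit1 nonunit_inv). Qed.

Lemma JV_left_ideal : left_ideal *%R V (JV V).
Proof. exact: (jacobson_left_ideal ringV). Qed.

Lemma JV_unit x : V x -> ~ JV V x -> x != 0 /\ V x^-1.
Proof.
move=> Vx nJ; have [e|x0] := eqVneq x 0.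
  by case: nJ; apply/JVP; rewrite e eqxx; split=> //; apply: (zsub0 zV).
by split=> //; apply: contrapT => h; apply: nJ; apply/JVP.
Qed.

Lemma JV_not1 : ~ JV V 1.
Proof. by move/JVP => [V1]; rewrite oner_neq0 invr1 => /(_ isT). Qed.

Lemma JV_max : max_left_ideal *%R V (JV V).
Proof.
rewrite (_ : JV V = nonunit); last by apply/funext => x; apply/propext; apply: JVP.
exact: (local_ring_max ringV nonunit_ideal nonunit1 nonunit_inv).
Qed.

Lemma intclos_integralOver : exists (B : comNzRingType) (i : {rmorphism B -> F}),
  (forall t, V t <-> exists b, i b = t) /\
  forall x : L, S x <-> integralOver (in_alg L \o i) x.
Proof.
have [B [i [inj im]]] := subring_comNzRingType ringV.
exists B, i; split=> // x; split.
  move=> [p [mp pV px]].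
  have [q hq] := choice (fun j => iffLR (im _) (pV j)).
  have e : map_poly i (\poly_(j < size p) q j) = p.
    apply/polyP=> j; rewrite coef_map coef_poly; case: ltnP => h; first exact: hq.
    by rewrite nth_default //; exact: (rmorph0 i).
  exists (\poly_(j < size p) q j); last by rewrite map_poly_comp e.
  apply/monicP/inj; rewrite rmorph1 -(monicP mp) -[in RHS]e.
  by rewrite (lead_coef_map_inj inj (rmorph0 i)).
move=> [q mq qx]; exists (map_poly i q); rewrite -map_poly_comp; split=> //.
- by apply: monic_map.
- by move=> j; apply/im; exists q`_j; rewrite coef_map.
Qed.

Lemma intclos_subring : subring *%R 1 S.
Proof.
have [B [i [_ h]]] := intclos_integralOver; split.
- by apply/h; apply: integral0.
- by apply/h; apply: integral1.
- by move=> x y /h ? /h ?; apply/h; apply: integral_sub.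
- by move=> x y /h ? /h ?; apply/h; apply: integral_mul.
Qed.
Lemma intclos_root_monic (p : {poly L}) x :
  p \is monic -> (forall i, S p`_i) -> root p x -> S x.
Proof.
have [B [i [_ h]]] := intclos_integralOver => mp Sp px; apply/h.
apply: (integral_root_monic mp px) => y /(nthP 0)[j _ <-]; exact/h.
Qed.

Lemma intclos_alg a : V a -> S a%:A.
Proof.
have [B [i [im h]]] := intclos_integralOver => /im [b <-]; apply/h.
exact: (integral_id (in_alg L \o i)).
Qed.

(** Valuation rings are integrally closed: if [a^-1] is in [V], write [a = a^(m+1) a^-m] and rewrite
    [a^(m+1)] by the integral equation; only nonnegative powers of [a^-1] remain. *)
Lemma algV_intclos a : S a%:A -> V a.
Proof.
move=> [p [mp pV]]; rewrite fmorph_root => /rootP pa; apply: contrapT => nVa.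
have a0 : a != 0 by apply: contra_notN nVa => /eqP->; apply: (zsub0 zV).
have [//|Va] := valuation_total a0; apply: nVa.
have sz := size_poly_eq0 p; rewrite (negPf (monic_neq0 mp)) in sz.
have := pa; rewrite horner_coef; case E: (size p) sz => [//|m] _.
rewrite big_ord_recr /= (_ : p`_m = 1); last by rewrite -(monicP mp) lead_coefE E.
rewrite mul1r => /eqP; rewrite addrC addr_eq0 => /eqP e.
case: m E e => [|m] E e.
  by move/eqP: e; rewrite big_ord0 expr0 oppr0 oner_eq0.
have -> : a = a ^+ m.+1 * a^-1 ^+ m by rewrite exprS -mulrA exprVn divff ?mulr1 // expf_neq0.
rewrite e mulNr mulr_suml; apply: (zsubN zV); apply: (zsub_sum zV) => i _.
rewrite -mulrA; apply: (subringM ringV) => //.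
have im : (i <= m)%N by rewrite -ltnS.
move: (nat_of_ord i) im => {i} j im.
rewrite -(subnKC im) exprD mulrA exprVn divff ?expf_neq0 // mul1r.
exact: subringX.
Qed.

End Valuation.

Section Locals.
Variables (K : fieldType) (D : K -> Prop).
Hypotheses (D0 : D 0) (D1 : D 1) (DM : forall x y, D x -> D y -> D (x * y)).
Hypothesis Dtot : forall x, x != 0 -> D x \/ D x^-1.

(** [D] is kept abstract because an entry of least value is needed both for [V] and for the
    localizations of [S]. *)
Lemma valuation_least n (c : 'I_n -> K) : (exists i, c i != 0) ->
  exists j, c j != 0 /\ forall i, D (c i / c j).
Proof.
elim: n c => [|n IH] c; first by case=> [[]].
case: (EM (exists i, c (lift ord0 i) != 0)) => [/IH [j [j0 hj]] _|no [i i0]].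
  have [e|c0] := eqVneq (c ord0) 0.
    exists (lift ord0 j); split=> // i; case: (unliftP ord0 i) => [i'|] -> //.
    by rewrite e mul0r.
  have [h|h] := Dtot (mulf_neq0 c0 (invr_neq0 j0)).
    by exists (lift ord0 j); split=> // i; case: (unliftP ord0 i) => [i'|] ->.
  exists ord0; split=> // i; case: (unliftP ord0 i) => [i'|] ->; last by rewrite divff.
  have -> : c (lift ord0 i') / c ord0 = c (lift ord0 i') / c (lift ord0 j) * (c (lift ord0 j) / c ord0) by rewrite mulrA divfK.
  apply: DM => //.
  by move: h; rewrite invfM invrK mulrC.
have z i' : c (lift ord0 i') = 0.
  by apply/eqP; apply: contrapT => /negP h; apply: no; exists i'.
exists ord0; have c0 : c ord0 != 0 by case: (unliftP ord0 i) i0 => [i'|] -> //; rewrite z eqxx.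
by split=> // i1; case: (unliftP ord0 i1) => [i'|] ->; rewrite ?z ?mul0r ?divff.
Qed.
End Locals.

Section MaximalIdeals.
Variables (F : fieldType) (L : splittingFieldType F) (V : F -> Prop).
Hypotheses (hV : valuation_domain V) (hG : galois 1%VS (fullv : {subfield L})).
Notation S := (@intclos F L V).
Notation gal := (gal_of (fullv : {subfield L})).

Let ringV : subring *%R 1 V. Proof. by case: hV. Qed.
Let ringS : subring *%R 1 S := intclos_subring L hV.
Let zS := subring_zsub ringS.
Let S1 : S 1 := subring1 ringS.
Let SM : forall x y, S x -> S y -> S (x * y) := subringM ringS.

Lemma intclos_gal (s : gal) x : S x -> S (s x).
Proof.
move=> [p [mp pV px]]; exists p; split=> //.
have -> : map_poly (in_alg L) p = map_poly s (map_poly (in_alg L) p).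
  by rewrite -map_poly_comp; apply: eq_map_poly => a /=; rewrite rmorph_alg.
by rewrite fmorph_root.
Qed.

Lemma gal_full (s : gal) : s \in ('Gal({:L} / 1))%g.
Proof. by rewrite gal_kAut ?sub1v // kAut1E limg_gal. Qed.

Lemma gal_fixed (x : L) : (forall s : gal, s x = x) -> exists a, x = a%:A.
Proof.
move=> fx; have /galois_fixedField e := hG.
have : x \in fixedField ('Gal({:L} / 1))%g by apply/fixedFieldP; rewrite ?memvf.
by rewrite e => /vlineP [a ->]; exists a.
Qed.

Lemma card_gal : #|{: gal}| = \dim {:L}.
Proof.
have := galois_dim hG; rewrite dimv1 divn1 => ->.
by apply: eq_card => s; rewrite inE gal_full.
Qed.

Lemma galMx (s t : gal) x : (s * t)%g x = t (s x).
Proof. by rewrite galM ?memvf. Qed.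

Lemma gal_charpoly (x : L) : exists p : {poly F},
  [/\ p \is monic, map_poly (in_alg L) p = \prod_(s : gal) ('X - (s x)%:P) & S x -> polyV V p].
Proof.
set P := \prod_(s : gal) _.
have fixP (t : gal) : map_poly t P = P.
  rewrite rmorph_prod /= [RHS](reindex_inj (mulIg t)) /=; apply: eq_bigr => s _.
  by rewrite rmorphB /= map_polyX map_polyC /= galMx.
have [c hc] := choice (fun i => gal_fixed (fun t => etrans (esym (coef_map t P i)) (congr1 (fun Q : {poly L} => Q`_i) (fixP t)))).
have e : map_poly (in_alg L) (\poly_(i < size P) c i) = P.
  apply/polyP=> i; rewrite coef_map coef_poly; case: ltnP => h; first exact: esym.
  by rewrite nth_default //; exact: (rmorph0 (in_alg L)).
exists (\poly_(i < size P) c i); split=> //.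
  by rewrite -(map_monic (in_alg L)) e monic_prod_XsubC.
move=> Sx i; apply: (algV_intclos (L := L) hV).
have -> : ((\poly_(i < size P) c i)`_i)%:A = P`_i by rewrite -[in RHS]e coef_map.
have : forall i, S P`_i; last exact.
apply: (big_ind (fun Q : {poly L} => forall i, S Q`_i)).
- by move=> j; rewrite coef1; case: eqP => _ //; apply: (zsub0 zS).
- move=> Q Q' hQ hQ' j; rewrite coefM; apply: (zsub_sum zS) => l _; exact: SM.
- move=> s _ j; rewrite coefB coefX coefC; apply: (zsubB zS).
    by case: eqP => _ //; apply: (zsub0 zS).
  by case: eqP => _; [apply: intclos_gal | apply: (zsub0 zS)].
Qed.

Lemma algebraic_monic (x : L) : exists p : {poly F},
  p \is monic /\ root (map_poly (in_alg L) p) x.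
Proof.
have [p [mp e _]] := gal_charpoly x; exists p; split=> //.
rewrite e; apply/rootP; rewrite horner_prod; apply/eqP.
by rewrite prodf_seq_eq0; apply/hasP; exists 1%g; rewrite ?mem_index_enum //= gal_id !hornerE subrr.
Qed.

Lemma intclos_denom (x : L) : exists a, [/\ V a, a != 0 & S (a%:A * x)].
Proof.
have [p [mp px]] := algebraic_monic x.
case E : (size p) => [|m]; first by move/eqP: E; rewrite size_poly_eq0 (negPf (monic_neq0 mp)).
have pm : p`_m = 1 by rewrite -(monicP mp) lead_coefE E.
have [|j [j0 hj]] := valuation_least (D := V) (zsub0 (subring_zsub ringV)) (subring1 ringV) (subringM ringV) (valuation_total hV) (c := fun i : 'I_m.+1 => p`_i).
  by exists ord_max; rewrite /= pm oner_neq0.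
have Va : V (p`_j)^-1 by have := hj ord_max; rewrite /= pm mul1r.
(* Dividing by the coefficient of least value puts all [a p_i] in [V]. Then [a x] is a root of the
   monic [q], whose coefficient [p_i a^(m-i)] contains the factor [a p_i] for [i < m]. *)
exists (p`_j)^-1; rewrite invr_eq0; split=> //; set a := _^-1 in Va *.
have hp i : (i < m)%N -> V (a * p`_i).
  by move=> im; have := hj (Ordinal (leqW im)); rewrite mulrC.
pose q := \poly_(i < m.+1) (p`_i * a ^+ (m - i)).
have qm : q`_m = 1 by rewrite coef_poly ltnSn subnn expr0 mulr1.
have szq : size q = m.+1 by rewrite size_poly_eq // subnn expr0 mulr1 pm oner_neq0.
exists q; split; first by rewrite monicE lead_coefE szq /= qm.
  move=> i; rewrite coef_poly; case: ltnP => [|_]; last exact: zsub0 (subring_zsub ringV).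
  rewrite ltnS leq_eqVlt => /orP[/eqP->|im]; first by rewrite subnn expr0 mulr1 pm; apply: subring1 ringV.
  rewrite -(prednK (n := m - i)) ?subn_gt0 // exprS mulrA [p`_i * a]mulrC.
  by apply: (subringM ringV); [apply: hp | apply: (subringX ringV)].
apply/rootP; rewrite (horner_coef_wide (n := m.+1)) ?size_map_poly ?szq //.
move/rootP: px; rewrite (horner_coef_wide (n := m.+1)) ?size_map_poly ?E // => px.
rewrite -[RHS](mulr0 (a%:A ^+ m)) -[X in _ = _ * X]px mulr_sumr; apply: eq_bigr => i _.
rewrite !coef_map coef_poly ltn_ord /= -!in_algE rmorphM rmorphXn /= exprMn.
have im : (i <= m)%N by rewrite -ltnS.
have -> : a%:A ^+ m = a%:A ^+ (m - i) * a%:A ^+ i :> L by rewrite -exprD subnK.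
ring.
Qed.

End MaximalIdeals.

Section Localization.
Variables (F : fieldType) (L : splittingFieldType F) (V : F -> Prop).
Hypotheses (hV : valuation_domain V) (hG : galois 1%VS (fullv : {subfield L})).
Notation S := (@intclos F L V).
Notation gal := (gal_of (fullv : {subfield L})).

Let ringV : subring *%R 1 V. Proof. by case: hV. Qed.
Let ringS : subring *%R 1 S := intclos_subring L hV.
Let zS := subring_zsub ringS.
Let S0 : S 0 := zsub0 zS.
Let S1 : S 1 := subring1 ringS.
Let SM : forall x y, S x -> S y -> S (x * y) := subringM ringS.

Lemma gal1x (x : L) : (1%g : gal) x = x. Proof. exact: gal_id. Qed.

Lemma galKx (s : gal) x : (s^-1)%g (s x) = x.
Proof. by rewrite -galMx mulgV gal1x. Qed.

Lemma galVKx (s : gal) x : s ((s^-1)%g x) = x.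
Proof. by rewrite -galMx mulVg gal1x. Qed.

Implicit Types (M N : L -> Prop).

Lemma maxS_zsub M : maxS V M -> zsub M.
Proof. by case=> /left_ideal_zsub. Qed.

Lemma maxS_sub M x : maxS V M -> M x -> S x.
Proof. by case=> -[+ _ _ _] _ _; apply. Qed.

Lemma maxSM M r x : maxS V M -> S r -> M x -> M (r * x).
Proof. by case=> -[_ _ _ +] _ _; apply. Qed.

Lemma maxSMr M r x : maxS V M -> S r -> M x -> M (x * r).
Proof. by move=> hM Sr Mx; rewrite mulrC; apply: maxSM. Qed.

Lemma maxS1 M : maxS V M -> ~ M 1.
Proof. exact: max_left_ideal_not1. Qed.

Lemma maxS_inv M x : maxS V M -> S x -> ~ M x -> exists r, S r /\ M (1 - r * x).
Proof. exact: (max_left_ideal_cover ringS). Qed.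

Lemma maxS_prime M x y : maxS V M -> S x -> S y -> M (x * y) -> M x \/ M y.
Proof.
move=> hM Sx Sy Mxy; case: (EM (M x)) => [|nMx]; [by left | right].
have [r [Sr Mr]] := maxS_inv hM Sx nMx; have zM := maxS_zsub hM.
have -> : y = (1 - r * x) * y + r * (x * y) by ring.
by apply: (zsubD zM); [apply: maxSMr | apply: maxSM].
Qed.

Lemma maxS_eq M N : maxS V M -> maxS V N -> (forall x, M x -> N x) -> forall x, N x -> M x.
Proof.
move=> hM hN MN; have [_ _ h] := hM; case: (h N) => //; first by case: hN.
by move=> h1; case: (maxS1 hN); apply: h1.
Qed.

Lemma maxS_neq M N : maxS V M -> maxS V N -> ~ (forall x, M x <-> N x) ->
  exists x, M x /\ ~ N x.
Proof.
move=> hM hN ne; apply: contrapT => no; apply: ne => x.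
have MN y : M y -> N y by move=> My; apply: contrapT => nNy; apply: no; exists y.
by split; [apply: MN | apply: (maxS_eq hM hN MN)].
Qed.

Lemma maxS_gal M (s : gal) : maxS V M -> maxS V (fun x => M (s x)).
Proof.
move=> hM; have zM := maxS_zsub hM; have Sg := @intclos_gal _ _ V s.
have Sgi x : S (s x) -> S x.
  by move=> h; rewrite -(gal1x x) -(mulgV s) galMx; apply: intclos_gal.
have sK x : s ((s^-1)%g x) = x by rewrite -galMx mulVg gal1x.
split.
- split.
  + by move=> x /(maxS_sub hM) /Sgi.
  + by rewrite rmorph0; apply: (zsub0 zM).
  + by move=> x y Mx My; rewrite rmorphB; apply: (zsubB zM).
  + by move=> r x Sr Mx; rewrite rmorphM; apply: maxSM => //; apply: Sg.
- by exists 1; rewrite rmorph1; split=> //; apply: maxS1.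
- move=> I hI MI; have [_ _ h] := hM; case: (h (fun x => I ((s^-1)%g x))).
  + have zI := left_ideal_zsub hI; case: hI => sI _ _ mI; split.
    * by move=> x /sI; rewrite -{2}[x]sK => /Sg.
    * by rewrite rmorph0; apply: (zsub0 zI).
    * by move=> x y Ix Iy; rewrite rmorphB; apply: (zsubB zI).
    * by move=> r x Sr Ix; rewrite rmorphM; apply: mI => //; apply: intclos_gal.
  + by move=> x Mx; apply: MI; rewrite sK.
  + by move=> h1; left=> x Ix; apply: h1; rewrite -galMx mulgV gal1x.
  + move=> h1; right=> x Sx; rewrite -[x]gal1x -(mulgV s) galMx; apply: h1.
    exact: Sg.
Qed.

Lemma ideal_full I : left_ideal *%R S I ->
  (forall M, maxS V M -> exists x, I x /\ ~ M x) -> I 1.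
Proof.
move=> hI h; apply: contrapT => nI1.
have [M [hM sM]] := max_left_ideal_above ringS hI nI1.
by have [x [Ix]] := h M hM; apply; apply: sM.
Qed.

Lemma exists_maxS : exists M : L -> Prop, maxS V M.
Proof.
have [||M [hM _]] := @max_left_ideal_above _ _ ringS (fun x => x = 0).
- split=> //; first by move=> x ->.
    by move=> x y -> ->; rewrite subrr.
  by move=> r x _ ->; rewrite mulr0.
- by move/eqP; rewrite oner_eq0.
- by exists M.
Qed.

Lemma maxS_JV M a : maxS V M -> JV V a -> M a%:A.
Proof.
move=> hM /[dup] Ja /JVP [] // Va _; apply: contrapT => nMa.
have Sa : S a%:A := intclos_alg L hV Va.
have [r [Sr Mr]] := maxS_inv hM Sa nMa.
(* the norm of [1 - r a] is congruent to [1] modulo [a V], hence a unit of [V] *)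
have [p [mp e /(_ Sr) pV]] := gal_charpoly hV hG r.
pose N := \prod_(s : gal) (1 - s r * a%:A).
have MN : M N.
  rewrite /N (bigD1 1%g) //= gal1x; apply: maxSMr => //.
  apply: (subring_prod ringS) => s _; apply: (zsubB zS) => //; apply: SM => //.
  exact: intclos_gal.
have [b [Vb eN]] : exists b, V b /\ N = (1 - a * b)%:A.
  suff [b [Sb fb eb]] : exists b : L, [/\ S b, (forall t : gal, t b = b) & N = 1 - a%:A * b].
    have [c ec] := gal_fixed hG fb; exists c; split.
      by apply: (algV_intclos (L := L) hV); rewrite -ec.
    by rewrite eb ec scalerBl scale1r -scalerAl mul1r scalerA.
  have [a0|a0] := eqVneq a 0.
    exists 0; split=> //; first by move=> t; rewrite rmorph0.
    rewrite mulr0 subr0 /N big1 // => s _.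
    by rewrite a0 scale0r mulr0 subr0.
  have aA0 : a%:A != 0 :> L by rewrite scaler_eq0 oner_eq0 orbF.
  exists ((1 - N) / a%:A); split; last by rewrite mulrC divfK // subKr.
    suff : exists b, S b /\ 1 - N = b * a%:A by move=> [b [Sb ->]]; rewrite mulfK.
    rewrite /N; apply: (big_ind (fun x => exists b, S b /\ 1 - x = b * a%:A)).
    - by exists 0; rewrite mul0r subrr.
    - move=> x y [b [Sb eb]] [c [Sc ec]]; exists (b + c - b * c * a%:A).
      have -> : x = 1 - b * a%:A by rewrite -eb subKr.
      have -> : y = 1 - c * a%:A by rewrite -ec subKr.
      split; last by ring.
      by apply: (zsubB zS); [apply: (zsubD zS) | apply: SM => //; apply: SM].
    - by move=> s _; exists (s r); rewrite subKr; split=> //; apply: intclos_gal.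
  move=> t; rewrite fmorph_div rmorphB rmorph1 /= rmorph_alg; congr ((1 - _) / _).
  rewrite rmorph_prod [RHS](reindex_inj (mulIg t)) /=; apply: eq_bigr => s _.
  by rewrite rmorphB rmorph1 rmorphM /= rmorph_alg galMx.
have nJ : ~ JV V (1 - a * b).
  move=> h; apply: (JV_not1 hV); rewrite -(subrK (a * b) 1).
  have hJ := JV_left_ideal hV; apply: (zsubD (left_ideal_zsub hJ)) => //.
  by rewrite mulrC; case: hJ => _ _ _; apply.
have [|c0 Vc] := JV_unit hV _ nJ.
  by apply: (zsubB (subring_zsub ringV)); [apply: subring1 ringV | apply: (subringM ringV)].
apply: (maxS1 hM); rewrite -[1](divff (x := (1 - a * b)%:A)) ?scaler_eq0 ?oner_eq0 ?orbF //.
rewrite -eN mulrC; apply: maxSM => //.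
by rewrite eN -(rmorphV (in_alg L)) ?unitfE //; apply: intclos_alg.
Qed.

Lemma maxS_alg M a : maxS V M -> M a%:A -> JV V a.
Proof.
move=> hM Ma; have Va : V a by apply: (algV_intclos (L := L) hV); apply: maxS_sub Ma.
apply: contrapT => nJ; have [a0 Vi] := JV_unit hV Va nJ.
apply: (maxS1 hM); have := maxSM hM (intclos_alg L hV Vi) Ma.
by rewrite -scalerAl mul1r scalerA mulVf // scale1r.
Qed.

(** The localization [loc V M] described by denominators. [locS V M (x / y)] expresses that [x] has
    value at least that of [y] at [M]; no value group appears. *)
Definition locS (M : L -> Prop) (z : L) := exists t, [/\ S t, ~ M t & S (t * z)].

Lemma locS_int M z : maxS V M -> S z -> locS M z.
Proof. by move=> hM Sz; exists 1; rewrite mul1r; split=> //; apply: maxS1. Qed.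

Lemma locSM M x y : maxS V M -> locS M x -> locS M y -> locS M (x * y).
Proof.
move=> hM [t [St nt Stx]] [u [Su nu Suy]]; exists (t * u); split; first exact: SM.
  by move=> /(maxS_prime hM St Su) [].
by rewrite mulrACA; apply: SM.
Qed.

Lemma locSD M x y : maxS V M -> locS M x -> locS M y -> locS M (x + y).
Proof.
move=> hM [t [St nt Stx]] [u [Su nu Suy]]; exists (t * u); split; first exact: SM.
  by move=> /(maxS_prime hM St Su) [].
by rewrite mulrDr (mulrC t) -mulrA [u * t * y]mulrAC mulrC (mulrC (u * y)) mulrC;
  apply: (zsubD zS); apply: SM.
Qed.

Lemma intclos_loc z : (forall M, maxS V M -> locS M z) -> S z.
Proof.
move=> h; pose I t := S t /\ S (t * z).
suff [_ ?] : I 1 by rewrite -[z]mul1r.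
apply: ideal_full; last by move=> M /h [t [St nt Stz]]; exists t.
split.
- by move=> t [].
- by rewrite /I mul0r.
- by move=> t u [St Stz] [Su Suz]; split; rewrite ?mulrBl; apply: (zsubB zS).
- by move=> r t Sr [St Stz]; split; rewrite -?mulrA; apply: SM.
Qed.

(** Descent on the degree, showing that the localization is a valuation ring. The product [b] of the
    leading coefficient by [x] is integral over [S]. If the leading coefficient is outside [M], then
    [x] is local; if [b] is outside [M], then [x^-1] is. Otherwise both lie in [M], and absorbing
    [b] in the next coefficient lowers the degree while some coefficient stays outside [M]. *)
Lemma locS_relation M x n (a : nat -> L) : maxS V M -> x != 0 ->
  (forall i, S (a i)) -> (exists2 i, (i <= n)%N & ~ M (a i)) ->
  \sum_(i < n.+1) a i * x ^+ i = 0 -> locS M x \/ locS M x^-1.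
Proof.
move=> hM x0; have zM := maxS_zsub hM; elim: n a => [|n IH] a Sa [i ile nMi].
  rewrite big_ord1 expr0 mulr1 => a0; case: nMi.
  by move: ile; rewrite leqn0 => /eqP ->; rewrite a0; apply: (zsub0 zM).
move=> rel; set b := a n.+1 * x.
have Sb : S b.
  (* The relation multiplied by [a n.+1 ^+ n] is a monic equation for [b]. *)
  pose q := 'X^(n.+1) + \poly_(i < n.+1) (a i * a n.+1 ^+ (n - i)).
  have szp : (size (\poly_(i < n.+1) (a i * a n.+1 ^+ (n - i)%N)%R) < size ('X^(n.+1) : {poly L}))%N.
    by rewrite size_polyXn ltnS size_poly.
  apply: (intclos_root_monic (p := q) hV).
  - by rewrite monicE lead_coefDl // lead_coefXn.
  - move=> j; rewrite coefD coefXn coef_poly; apply: (zsubD zS); first by case: eqP.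
    by case: ltnP => // _; apply: SM => //; apply: (subringX ringS).
  - apply/rootP; rewrite hornerD hornerXn horner_poly.
    rewrite -[RHS](mulr0 (a n.+1 ^+ n)) -[X in _ = _ * X]rel [in RHS]big_ord_recr /= mulrDr addrC.
    congr (_ + _); last by rewrite /b exprMn mulrA -exprSr.
    rewrite mulr_sumr; apply: eq_bigr => j _; rewrite /b exprMn.
    have jn : (j <= n)%N by rewrite -ltnS.
    have -> : a n.+1 ^+ n = a n.+1 ^+ (n - j) * a n.+1 ^+ j by rewrite -exprD subnK.
    ring.
case: (EM (M (a n.+1))) => [Ma|nMa]; last by left; exists (a n.+1).
case: (EM (M b)) => [Mb|nMb]; last first.
  by right; exists b; split=> //; rewrite /b mulfK.
apply: (IH (fun j => if j == n then a n + b else a j)).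
- by move=> j; case: eqP => _ //; apply: (zsubD zS).
- move: ile; rewrite leq_eqVlt => /orP[/eqP e|]; first by rewrite e in nMi.
  rewrite ltnS => ile; exists i => //; case: eqP => // e h; apply: nMi.
  by rewrite e -[a n](addrK b); apply: (zsubB zM).
- move: rel; rewrite !big_ord_recr /= eqxx => e; rewrite -[RHS]e.
  rewrite -addrA mulrDl /b; congr (_ + _); last by rewrite exprS mulrA.
  by apply: eq_bigr => j _; rewrite ltn_eqF.
Qed.

Lemma locS_total M x : maxS V M -> x != 0 -> locS M x \/ locS M x^-1.
Proof.
move=> hM x0; have [p [mp px]] := algebraic_monic hV hG x.
case E : (size p) => [|m]; first by move/eqP: E; rewrite size_poly_eq0 (negPf (monic_neq0 mp)).
have pm : p`_m = 1 by rewrite -(monicP mp) lead_coefE E.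
have [|j [j0 hj]] := valuation_least (D := V) (zsub0 (subring_zsub ringV)) (subring1 ringV) (subringM ringV) (valuation_total hV) (c := fun i : 'I_m.+1 => p`_i).
  by exists ord_max; rewrite /= pm oner_neq0.
apply: (locS_relation (n := m) (a := fun i => (p`_i / p`_j)%:A)) => //.
- move=> i; case: (ltnP i m.+1) => h.
    by apply: intclos_alg => //; apply: (hj (Ordinal h)).
  by rewrite nth_default ?E // mul0r scale0r.
- by exists j; [rewrite -ltnS | rewrite divff // scale1r; apply: maxS1].
move/rootP: px; rewrite (horner_coef_wide (n := m.+1)) ?size_map_poly ?E // => px.
rewrite -[RHS](mulr0 (p`_j)^-1%:A) -[X in _ = _ * X]px mulr_sumr; apply: eq_bigr => i _.
by rewrite coef_map -!in_algE rmorphM mulrCA mulrA mulrC !mulrA.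
Qed.

Lemma ideal_sqD M x y : ideal_sq M x -> ideal_sq M y -> ideal_sq M (x + y).
Proof.
move=> [n [a [b [h ->]]]] [m [c [d [h' ->]]]].
exists (n + m)%N, (fun i => match split i with inl j => a j | inr j => c j end),
  (fun i => match split i with inl j => b j | inr j => d j end).
split; first by move=> i; case: split.
rewrite big_split_ord /=; congr (_ + _); apply: eq_bigr => i _.
  by rewrite (unsplitK (inl i)).
by rewrite (unsplitK (inr i)).
Qed.

Lemma ideal_sqM M x y : M x -> M y -> ideal_sq M (x * y).
Proof. by move=> Mx My; exists 1%N, (fun=> x), (fun=> y); rewrite big_ord1. Qed.

Lemma ideal_sqMl M r x : maxS V M -> S r -> ideal_sq M x -> ideal_sq M (r * x).
Proof.
move=> hM Sr [n [a [b [h ->]]]]; exists n, (fun i => r * a i), b; split.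
  by move=> i; case: (h i) => Ma Mb; split=> //; apply: maxSM.
by rewrite mulr_sumr; apply: eq_bigr => i _; rewrite mulrA.
Qed.

Lemma ideal_sqS M x : maxS V M -> ideal_sq M x -> M x.
Proof.
move=> hM [n [a [b [h ->]]]]; apply: (zsub_sum (maxS_zsub hM)) => i _.
by case: (h i) => Ma Mb; apply: maxSM => //; apply: maxS_sub Ma.
Qed.

Lemma ideal_sq_cancel M t x : maxS V M -> S t -> ~ M t -> S x -> ideal_sq M (t * x) -> ideal_sq M x.
Proof.
move=> hM St nt Sx h; have [r [Sr Mr]] := maxS_inv hM St nt.
(* With [u = r t] this is [1 = (2 - u) u + (1 - u)^2]: an inverse modulo [M] yields one modulo
   [M^2]. *)
have -> : x = ((2%:R - r * t) * r) * (t * x) + x * ((1 - r * t) * (1 - r * t)) by ring.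
apply: ideal_sqD; apply: ideal_sqMl => //.
  by apply: SM => //; apply: (zsubB zS); [apply: (subringXn ringS) | apply: SM].
exact: ideal_sqM.
Qed.

(* In terms of the valuation of [M]: an element outside [M ^ 2] has at most the
   least positive value. *)
Lemma locS_div M j g : maxS V M -> M j -> S g -> ~ ideal_sq M g -> locS M (j / g).
Proof.
move=> hM Mj Sg ng; have zM := maxS_zsub hM; have Sj := maxS_sub hM Mj.
have [->|j0] := eqVneq j 0; first by rewrite mul0r; apply: locS_int.
have g0 : g != 0.
  apply: contra_notN ng => /eqP ->; exists 0%N, (fun=> 0), (fun=> 0); rewrite big_ord0.
  by split=> // -[].
case: (locS_total hM (mulf_neq0 j0 (invr_neq0 g0))) => //.
rewrite invfM invrK mulrC => -[t [St nt Su]].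
set u := t * (g / j) in Su.
have e : t * g = u * j by rewrite /u mulrA divfK.
case: (EM (M u)) => [Mu|nMu].
  by case: ng; apply: (ideal_sq_cancel hM St nt Sg); rewrite e; apply: ideal_sqM.
by exists u; split=> //; rewrite mulrA -e mulfK.
Qed.

Lemma locS_divU M j g : maxS V M -> S j -> S g -> ~ M g -> locS M (j / g).
Proof.
move=> hM Sj Sg ng; exists g; split=> //; rewrite mulrC divfK //.
by apply: contra_notN ng => /eqP ->; apply: (zsub0 (maxS_zsub hM)).
Qed.

End Localization.

Section ResidueField.
Variables (K : comNzRingType) (R M : K -> Prop).
Hypotheses (hR : subring *%R 1 R) (hM : max_left_ideal *%R R M).

(** [phi] is a total function on [K], meaningful on [R] only, so that elements of [L] and [F] can be
    reduced without naming a subring type. *)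
Lemma residue_field : exists (E : fieldType) (phi : K -> E),
  [/\ phi 1 = 1, (forall x y, R x -> R y -> phi (x - y) = phi x - phi y),
      (forall x y, R x -> R y -> phi (x * y) = phi x * phi y),
      (forall x, R x -> (phi x = 0 <-> M x)) & forall e, exists x, R x /\ phi x = e].
Proof.
have [B [i [inj im]]] := subring_comNzRingType hR.
have [hMi _ _] := hM; have zM := left_ideal_zsub hMi.
have RM x : M x -> R x by case: hMi => + _ _ _; apply.
pose p : {pred B} := fun b => `[< M (i b) >].
have cl : idealr_closed p.
  split.
  - by apply/asboolP; rewrite rmorph0; apply: (zsub0 zM).
  - by apply/asboolP; rewrite rmorph1; apply: (max_left_ideal_not1 hM).
  - move=> a u v /asboolP Mu /asboolP Mv; apply/asboolP.
    rewrite rmorphD rmorphM; apply: (zsubD zM) => //.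
    by case: hMi => _ _ _; apply=> //; apply/im; exists a.
pose pI : idealr B := HB.pack p (isIdealr.Build B p cl).
pose Q : comNzRingType := {ideal_quot pI}.
pose pi : {rmorphism B -> Q} := (\pi_({ideal_quot pI}))%qT.
have pi_eq x y : M (i (x - y)) -> pi x = pi y.
  by move=> Mxy; apply/eqP; rewrite -Quotient.idealrBE; apply/asboolP.
have piE x : pi x = 0 <-> M (i x).
  rewrite -(rmorph0 pi); split; last by move=> Mx; apply: pi_eq; rewrite subr0.
  by move/eqP; rewrite -Quotient.idealrBE subr0 => /asboolP.
have pi_surj (x : Q) : exists y, pi y = x by elim/quotW: x => x; exists x.
have ex (x : Q) : exists y : Q, (x != 0 -> y * x = 1) /\ (x = 0 -> y = 0).
  have [->|x0] := eqVneq x 0; first by exists 0.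
  case: (pi_surj x) x0 => {}x <- x0.
  have Rx : R (i x) by apply/im; exists x.
  have nM : ~ M (i x) by move/piE/eqP; apply/negP.
  have [r [/im[r' <-] Mr]] := max_left_ideal_cover hR hM Rx nM.
  exists (pi r'); split; last by move/eqP; rewrite (negPf x0).
  move=> _; rewrite -rmorphM -(rmorph1 pi); apply/esym/pi_eq.
  by rewrite rmorphB rmorph1 rmorphM.
have [inv hinv] := choice ex.
pose E : fieldType := HB.pack Q (GRing.ComNzRing_isField.Build Q
  (fun x x0 => proj1 (hinv x) x0) (proj2 (hinv 0) erefl)).
have exb x : exists b, R x -> i b = x.
  by case: (EM (R x)) => [/im [b e]|nR]; [exists b | exists 0].
have [g hg] := choice exb.
exists E, (fun x => pi (g x)); split.
- by rewrite (_ : g 1 = 1) ?rmorph1 //; apply: inj; rewrite hg ?rmorph1 //; apply: subring1 hR.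
- move=> x y Rx Ry; rewrite -[RHS](rmorphB pi); congr (pi _).
  by apply: inj; rewrite rmorphB !hg //; apply: (zsubB (subring_zsub hR)).
- move=> x y Rx Ry; rewrite -[RHS](rmorphM pi); congr (pi _).
  by apply: inj; rewrite rmorphM !hg //; apply: (subringM hR).
- by move=> x Rx; rewrite -{2}(hg x Rx); apply: piE.
- move=> e; have [b <-] := pi_surj e; exists (i b); have Rb : R (i b) by apply/im; exists b.
  by split=> //; congr (pi _); apply: inj; rewrite hg.
Qed.

End ResidueField.

(** * Tameness and traces *)

Section ReductionOfPolynomials.
Variables (K E : comNzRingType) (R : K -> Prop) (phi : K -> E).
Hypotheses (hR : subring *%R 1 R) (phi1 : phi 1 = 1).
Hypothesis phiB : forall x y, R x -> R y -> phi (x - y) = phi x - phi y.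
Hypothesis phiM : forall x y, R x -> R y -> phi (x * y) = phi x * phi y.
Let zR := subring_zsub hR.
Let R0 : R 0 := zsub0 zR.
Let R1 : R 1 := subring1 hR.

Lemma red0 : phi 0 = 0.
Proof. by have := phiB R0 R0; rewrite !subrr. Qed.

Lemma redD x y : R x -> R y -> phi (x + y) = phi x + phi y.
Proof.
move=> Rx Ry; have Rny := zsubN zR Ry.
by rewrite -{1}[y]opprK phiB // -[- y]sub0r phiB // red0 sub0r opprK.
Qed.

Lemma red_sum (I : Type) (r : seq I) (P : pred I) (G : I -> K) :
  (forall i, P i -> R (G i)) -> phi (\sum_(i <- r | P i) G i) = \sum_(i <- r | P i) phi (G i).
Proof.
move=> RG; suff [] : R (\sum_(i <- r | P i) G i) /\
  phi (\sum_(i <- r | P i) G i) = \sum_(i <- r | P i) phi (G i) by [].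
apply: (big_rec2 (fun x y => R x /\ phi x = y)); first by split; rewrite ?red0.
move=> i y x Pi [Rx <-]; split; last by rewrite redD //; apply: RG.
by apply: (zsubD zR) => //; apply: RG.
Qed.

(** A relation rather than [map_poly phi], since [phi] is additive on [R] only. *)
Definition red_poly (p : {poly K}) (q : {poly E}) := forall i, R p`_i /\ phi p`_i = q`_i.

Implicit Types (p : {poly K}) (q : {poly E}).

Lemma red_poly_ex p : (forall i, R p`_i) -> exists q, red_poly p q.
Proof.
move=> Rp; exists (\poly_(i < size p) phi p`_i) => i; split=> //.
by rewrite coef_poly; case: ltnP => // h; rewrite nth_default // red0.
Qed.

Lemma red_polyC c : R c -> red_poly c%:P (phi c)%:P.
Proof. by move=> Rc i; rewrite !coefC; case: eqP => _; rewrite ?red0. Qed.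

Lemma red_polyX : red_poly 'X 'X.
Proof. by move=> i; rewrite !coefX; case: eqP => _; rewrite ?red0 ?phi1. Qed.

Lemma red_polyB p q p' q' : red_poly p q -> red_poly p' q' -> red_poly (p - p') (q - q').
Proof.
move=> h h' i; have [Rp e] := h i; have [Rp' e'] := h' i.
by rewrite !coefB phiB // e e'; split=> //; apply: (zsubB zR).
Qed.

Lemma red_polyD p q p' q' : red_poly p q -> red_poly p' q' -> red_poly (p + p') (q + q').
Proof.
move=> h h' i; have [Rp e] := h i; have [Rp' e'] := h' i.
by rewrite !coefD redD // e e'; split=> //; apply: (zsubD zR).
Qed.

Lemma red_polyM p q p' q' : red_poly p q -> red_poly p' q' -> red_poly (p * p') (q * q').
Proof.
move=> h h' i; rewrite !coefM.
have Rm (j : 'I_i.+1) : R (p`_j * p'`_(i - j)).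
  by apply: (subringM hR); [case: (h j) | case: (h' (i - j)%N)].
split; first exact: (zsub_sum zR).
rewrite red_sum //; apply: eq_bigr => j _.
by have [Rp <-] := h j; have [Rp' <-] := h' (i - j)%N; rewrite phiM.
Qed.

Lemma red_poly_deriv p q : red_poly p q -> red_poly p^`() q^`().
Proof.
move=> h i; have [Rp e] := h i.+1; rewrite !coef_deriv -e.
move: (p`_i.+1) Rp => x Rx; elim: (i.+1) => [|n [Rn en]]; first by rewrite !mulr0n red0.
by rewrite !mulrSr redD // en; split=> //; apply: (zsubD zR).
Qed.

Lemma red_poly_horner p q x : red_poly p q -> R x -> R p.[x] /\ phi p.[x] = q.[phi x].
Proof.
move=> h Rx; have RX n : R (x ^+ n) /\ phi (x ^+ n) = phi x ^+ n.
  elim: n => [|n [IH1 IH2]]; first by rewrite !expr0 phi1.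
  by rewrite !exprS phiM // IH2; split=> //; apply: (subringM hR).
pose m := maxn (size p) (size q).
rewrite (horner_coef_wide (n := m)) ?leq_maxl // (horner_coef_wide (n := m)) ?leq_maxr //.
have Rm i : R (p`_i * x ^+ i) by apply: (subringM hR); [case: (h i) | case: (RX i)].
split; first by apply: (zsub_sum zR).
rewrite red_sum //; apply: eq_bigr => i _; have [Rp <-] := h i.
by have [RXi <-] := RX i; rewrite phiM.
Qed.

End ReductionOfPolynomials.

(** Induction on the support: evaluating at [y x] with [chi j y != chi i0 y] and subtracting
    [chi i0 y] times the relation removes [i0] but keeps [j]. *)
Lemma dedekind_independence (K : pzSemiRingType) (E : fieldType) (R : K -> Prop) (I : finType)
    (chi : I -> K -> E) (a : I -> E) :
  R 1 -> (forall x y, R x -> R y -> R (x * y)) -> (forall i, chi i 1 = 1) ->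
  (forall i x y, R x -> R y -> chi i (x * y) = chi i x * chi i y) ->
  (forall i j, i != j -> exists x, R x /\ chi i x != chi j x) ->
  (forall x, R x -> \sum_i a i * chi i x = 0) -> forall i, a i = 0.
Proof.
move=> R1 RM chi1 chiM sep rel.
have [n] := ubnP #|[pred i | a i != 0]|; elim: n a rel => // n IH a rel le i0.
apply: contrapT => /eqP a0.
case: (EM (exists j, (j != i0) && (a j != 0))) => [[j /andP[ji aj]]|no].
  have [y [Ry hy]] := sep j i0 ji.
  have b0 : forall i, a i * (chi i y - chi i0 y) = 0.
    apply: IH.
      move=> x Rx; have := rel _ (RM _ _ Ry Rx).
      rewrite (eq_bigr (fun i => a i * (chi i y - chi i0 y) * chi i x + chi i0 y * (a i * chi i x))).
        by rewrite big_split /= -mulr_sumr rel // mulr0 addr0.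
      by move=> i _; rewrite chiM //; ring.
    rewrite ltnS in le; apply: leq_trans le; apply: proper_card.
    apply/properP; split.
      by apply/subsetP => i; rewrite !inE mulf_eq0 negb_or => /andP[].
    by exists i0; rewrite !inE ?a0 // subrr mulr0 eqxx.
  have /eqP := b0 j; rewrite mulf_eq0 (negPf aj) subr_eq0 /= => h.
  by rewrite h in hy.
have := rel 1 R1; rewrite (bigD1 i0) //= chi1 mulr1 big1 ?addr0; first by move/eqP; rewrite (negPf a0).
move=> j ji; have [->|aj] := eqVneq (a j) 0; first by rewrite mul0r.
by case: no; exists j; rewrite ji.
Qed.

Section Semilocal.
Variables (F : fieldType) (L : splittingFieldType F) (V : F -> Prop).
Hypotheses (hV : valuation_domain V) (hG : galois 1%VS (fullv : {subfield L})).
Notation S := (@intclos F L V).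
Notation gal := (gal_of (fullv : {subfield L})).
Let ringS : subring *%R 1 S := intclos_subring L hV.
Let zS := subring_zsub ringS.
Let S1 : S 1 := subring1 ringS.
Let SM : forall x y, S x -> S y -> S (x * y) := subringM ringS.

Variables (r : nat) (Ms : 'I_r -> L -> Prop).
Hypotheses (hMs : forall i, maxS V (Ms i))
  (dMs : forall i j, i != j -> ~ (forall x, Ms i x <-> Ms j x))
  (cMs : forall M, maxS V M -> exists i, forall x, M x <-> Ms i x).

(** Working modulo squares lets the Chinese remainder theorem prescribe elements of [M] outside
    [M^2]. *)
Lemma crt_idempotents : exists e : 'I_r -> L, forall i,
  [/\ S (e i), ideal_sq (Ms i) (1 - e i) & forall j, j != i -> ideal_sq (Ms j) (e i)].
Proof.
have sep i j : exists u, i != j -> [/\ S u, ideal_sq (Ms i) u & ideal_sq (Ms j) (1 - u)].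
  have [->|ij] := eqVneq i j; first by exists 0.
  have [x [Mx nMx]] := maxS_neq hV (hMs i) (hMs j) (dMs ij).
  have Sx := maxS_sub (hMs i) Mx.
  have [t [St Mt]] := maxS_inv hV (hMs j) Sx nMx.
  pose u := t * x; have Mu : Ms i u := maxSM (hMs i) St Mx.
  have Su : S u := maxS_sub (hMs i) Mu.
  have Sn := subringXn ringS.
  (* [3 u^2 - 2 u^3] is divisible by [u^2], and [1] minus it is [(1 + 2 u) (1 - u)^2]. *)
  exists ((3%:R - 2%:R * u) * (u * u)) => _; split.
  - by apply: SM; [apply: (zsubB zS) => //; apply: SM | apply: SM].
  - apply: ideal_sqMl => //; first by apply: (zsubB zS) => //; apply: SM.
    exact: ideal_sqM.
  - rewrite (_ : 1 - _ = (1 + 2%:R * u) * ((1 - u) * (1 - u))); last by ring.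
    apply: ideal_sqMl => //; first by apply: (zsubD zS) => //; apply: SM.
    exact: ideal_sqM.
have [B hB] := choice (fun ij : 'I_r * 'I_r => sep ij.1 ij.2).
exists (fun i => \prod_(j | j != i) B (j, i)) => i; split.
- by apply: (subring_prod ringS) => j ji; case: (hB (j, i) ji).
- suff [] : S (\prod_(j | j != i) B (j, i)) /\ ideal_sq (Ms i) (1 - \prod_(j | j != i) B (j, i)) by [].
  apply: (big_ind (fun x => S x /\ ideal_sq (Ms i) (1 - x))).
  + split=> //; rewrite subrr; exists 0%N, (fun=> 0), (fun=> 0); rewrite big_ord0.
    by split=> // -[].
  + move=> x y [Sx hx] [Sy hy]; split; first exact: SM.
    rewrite (_ : 1 - x * y = (1 - x) + x * (1 - y)); last by ring.
    by apply: ideal_sqD => //; apply: ideal_sqMl.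
  + by move=> j ji; case: (hB (j, i) ji).
- move=> j ji; rewrite (bigD1 j) //= mulrC; apply: ideal_sqMl => //.
    by apply: (subring_prod ringS) => k /andP[ki _]; case: (hB (k, i) ki).
  by case: (hB (j, i) ji).
Qed.

Lemma crt (a : 'I_r -> L) : (forall i, S (a i)) ->
  exists x, S x /\ forall i, ideal_sq (Ms i) (x - a i).
Proof.
move=> Sa; have [e he] := crt_idempotents.
have Se i : S (e i) by case: (he i).
exists (\sum_i a i * e i); split.
  by apply: (zsub_sum zS) => i _; apply: SM.
move=> i; rewrite (bigD1 i) //=.
rewrite (_ : _ - _ = \sum_(j | j != i) a j * e j + (- a i) * (1 - e i)); last by ring.
apply: ideal_sqD; last by apply: ideal_sqMl => //; [apply: (zsubN zS) | case: (he i)].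
apply: big_ind.
- by exists 0%N, (fun=> 0), (fun=> 0); rewrite big_ord0; split=> // -[].
- by move=> x y; apply: ideal_sqD.
- by move=> j ji; apply: ideal_sqMl => //; case: (he j) => _ _; apply; rewrite eq_sym.
Qed.

Lemma maxS_prod M (I : finType) (x : I -> L) : maxS V M -> (forall i, S (x i)) ->
  M (\prod_i x i) -> exists i, M (x i).
Proof.
move=> hM Sx; suff: S (\prod_i x i) /\ (M (\prod_i x i) -> exists i, M (x i)) by case.
apply: (big_ind (fun y => S y /\ (M y -> exists i, M (x i)))).
- by split=> // /(maxS1 hM).
- by move=> y z [Sy hy] [Sz hz]; split; [apply: SM | move=> /(maxS_prime hV hM Sy Sz)[]].
- by move=> i _; split=> // Mi; exists i.
Qed.

(** Take [x] in [Ms j] and congruent to [1] at the other ideals. Its norm lies in [Ms j] and in [F],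
    hence in [J(V)] and in [Ms i]; so some conjugate [s x] is in [Ms i], and [Ms j] is the only one
    of the ideals that contains [x]. *)
Lemma maxS_transitive i j : exists s : gal, forall x, Ms j x <-> Ms i (s x).
Proof.
have S0 : S 0 := zsub0 zS.
have [x [Sx hx]] := crt (a := fun k => if k == j then 0 else 1) (fun k => if k == j as b return S (if b then 0 else 1) then S0 else S1).
have Mj : Ms j x by have := ideal_sqS (hMs j) (hx j); rewrite eqxx subr0.
have [p [mp e /(_ Sx) pV]] := gal_charpoly hV hG x.
have Ms_norm : Ms j (\prod_(s : gal) s x).
  rewrite (bigD1 1%g) //= gal1x; apply: maxSMr => //.
  by apply: (subring_prod ringS) => s _; apply: intclos_gal.
have [b eb] : exists b, \prod_(s : gal) s x = b%:A.
  apply: gal_fixed => // t; rewrite rmorph_prod [RHS](reindex_inj (mulIg t)) /=.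
  by apply: eq_bigr => s _; rewrite galMx.
have : Ms i (\prod_(s : gal) s x).
  by rewrite eb; apply: (maxS_JV hV hG) => //; apply: (maxS_alg hV (hMs j)); rewrite -eb.
case/maxS_prod => // [s|s Mis]; first exact: intclos_gal.
have [k hk] := cMs (maxS_gal hV s (hMs i)).
exists s; move=> y; rewrite hk.
have [<-//|kj] := eqVneq k j.
have Mkx : Ms k x by apply/hk.
have := ideal_sqS (hMs k) (hx k); rewrite (negPf kj) => h.
case: (maxS1 (hMs k)); rewrite -[1](subKr x).
exact: (zsubB (maxS_zsub (hMs k))).
Qed.

End Semilocal.

Lemma inj_mx_leq (E : fieldType) d n (A : 'M[E]_(d, n)) :
  (forall u : 'rV_d, u *m A = 0 -> u = 0) -> (d <= n)%N.
Proof.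
move=> inj; have : row_free A.
  rewrite -kermx_eq0; apply/eqP/row_matrixP=> i; rewrite row0; apply: inj.
  by rewrite -row_mul mulmx_ker row0.
by rewrite /row_free => /eqP <-; apply: rank_leq_col.
Qed.

Section LocalRing.
Variables (F : fieldType) (L : splittingFieldType F) (V : F -> Prop).
Hypothesis hV : valuation_domain V.
Notation S := (@intclos F L V).
Let ringS : subring *%R 1 S := intclos_subring L hV.
Let zS := subring_zsub ringS.
Variable M : L -> Prop.
Hypothesis hM : maxS V M.
Let zM := maxS_zsub hM.

Lemma loc_locS x : loc V M x <-> locS V M x.
Proof.
have n0 t : ~ M t -> t != 0 by apply: contra_notN => /eqP ->; apply: (zsub0 zM).
split; first by move=> [s [t [Ss St nt ->]]]; exists t; rewrite mulrC divfK ?n0.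
by move=> [t [St nt Stx]]; exists (t * x), t; rewrite mulrAC divff ?mul1r ?n0.
Qed.

Lemma JSM_P x : JSM V M x <-> exists t, [/\ S t, ~ M t & M (t * x)].
Proof.
pose N x := exists t, [/\ S t, ~ M t & M (t * x)].
have NS y : N y -> locS V M y.
  by move=> [t [St nt Mt]]; exists t; split=> //; apply: (maxS_sub hM).
have ringL : subring *%R 1 (loc V M).
  split.
  - by apply/loc_locS/(locS_int hV hM)/(zsub0 zS).
  - by apply/loc_locS/(locS_int hV hM)/(subring1 ringS).
  - move=> y z /loc_locS hy /loc_locS hz; apply/loc_locS; apply: (locSD hV hM) => //.
    case: hz => t [St nt Stz]; exists t; split=> //; rewrite mulrN; exact: (zsubN zS).
  - by move=> y z /loc_locS hy /loc_locS hz; apply/loc_locS; apply: (locSM hV hM).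
apply: (@local_ring_jacobson _ _ ringL N).
- split.
  + by move=> y /NS h; apply/loc_locS.
  + by exists 1; rewrite mul1r; split; [apply: subring1 ringS | apply: (maxS1 hM) | apply: (zsub0 zM)].
  + move=> y z [t [St nt Mt]] [u [Su nu Mu]]; exists (t * u); split.
    * exact: (subringM ringS).
    * by move=> /(maxS_prime hV hM St Su) [].
    * rewrite mulrBr; apply: (zsubB zM); first by rewrite mulrAC; apply: (maxSMr hM).
      by rewrite -mulrA; apply: (maxSM hM).
  + move=> y z /loc_locS [t [St nt Sty]] [u [Su nu Mu]]; exists (t * u); split.
    * exact: (subringM ringS).
    * by move=> /(maxS_prime hV hM St Su) [].
    * by rewrite mulrACA; apply: (maxSM hM).
- by move=> [t [_ nt]]; rewrite mulr1.
- move=> y /loc_locS [t [St nt Sty]] nN.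
  have nty : ~ M (t * y) by move=> h; apply: nN; exists t.
  have ty0 : t * y != 0 by apply: contra_notN nty => /eqP ->; apply: (zsub0 zM).
  exists (t / (t * y)); split; first by exists t, (t * y).
  by rewrite mulrAC divff.
Qed.

Lemma JSM_int x : S x -> JSM V M x -> M x.
Proof. by move=> Sx /JSM_P [t [St nt /(maxS_prime hV hM St Sx)[]]]. Qed.

(** [S] maps onto the residue field of its localization: a local element with denominator [t] is
    multiplied by [r t], where [r t] is congruent to [1]. *)
Lemma res_deg_int n : res_deg V M n -> exists ys : 'I_n -> L,
    [/\ (forall i, S (ys i)),
        (forall cs : 'I_n -> F, (forall i, V (cs i)) ->
           M (\sum_(i < n) in_alg L (cs i) * ys i) -> forall i, JV V (cs i))
      & (forall y, S y -> exists cs : 'I_n -> F,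
           (forall i, V (cs i)) /\ M (y - \sum_(i < n) in_alg L (cs i) * ys i))].
Proof.
move=> [ys [ly free gen]].
have ex i : exists z, S z /\ JSM V M (ys i - z).
  have /loc_locS [t [St nt Sty]] := ly i.
  have [r [Sr Mr]] := maxS_inv hV hM St nt.
  exists (r * (t * ys i)); split; first exact: (subringM ringS).
  apply/JSM_P; exists t; split=> //.
  rewrite (_ : t * _ = (t * ys i) * (1 - r * t)); last by ring.
  by apply: (maxSM hM).
have [zs hz] := choice ex.
have Jsum (cs : 'I_n -> F) : (forall i, V (cs i)) ->
    JSM V M (\sum_(i < n) in_alg L (cs i) * ys i - \sum_(i < n) in_alg L (cs i) * zs i).
  have hJ : left_ideal *%R (loc V M) (JSM V M).
    split.
    - by move=> y [].
    - by apply/JSM_P; exists 1; rewrite mul1r; split; [apply: subring1 ringS | apply: (maxS1 hM) | apply: (zsub0 zM)].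
    - move=> y z /JSM_P [t [St nt Mt]] /JSM_P [u [Su nu Mu]]; apply/JSM_P; exists (t * u); split.
      + exact: (subringM ringS).
      + by move=> /(maxS_prime hV hM St Su) [].
      + rewrite mulrBr; apply: (zsubB zM); first by rewrite mulrAC; apply: (maxSMr hM).
        by rewrite -mulrA; apply: (maxSM hM).
    - move=> y z /loc_locS [t [St nt Sty]] /JSM_P [u [Su nu Mu]]; apply/JSM_P; exists (t * u); split.
      + exact: (subringM ringS).
      + by move=> /(maxS_prime hV hM St Su) [].
      + by rewrite mulrACA; apply: (maxSM hM).
  move=> Vcs; rewrite -sumrB; apply: (zsub_sum (left_ideal_zsub hJ)) => i _.
  rewrite -mulrBr; case: hJ => _ _ _; apply; last by case: (hz i).
  by apply/loc_locS/(locS_int hV hM)/(intclos_alg L hV).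
have Szs (cs : 'I_n -> F) : (forall i, V (cs i)) -> S (\sum_(i < n) in_alg L (cs i) * zs i).
  move=> Vcs; apply: (zsub_sum zS) => i _; apply: (subringM ringS); last by case: (hz i).
  exact: (intclos_alg L hV).
exists zs; split.
- by move=> i; case: (hz i).
- move=> cs Vcs Msum; apply: free => //.
  have /JSM_P [t [St nt Mt]] := Jsum cs Vcs; apply/JSM_P; exists t; split=> //.
  move: Mt; rewrite mulrBr => Mt; rewrite -[X in M X](subrK (t * \sum_(i < n) in_alg L (cs i) * zs i)).
  by apply: (zsubD zM) => //; apply: (maxSM hM).
- move=> y Sy; have [|cs [Vcs Jy]] := gen y; first by apply/loc_locS/(locS_int hV hM).
  exists cs; split=> //; apply: JSM_int; first by apply: (zsubB zS) => //; apply: Szs.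
  have /JSM_P [t [St nt Mt]] := Jsum cs Vcs; have /JSM_P [u [Su nu Mu]] := Jy.
  apply/JSM_P; exists (t * u); split.
  + exact: (subringM ringS).
  + by move=> /(maxS_prime hV hM St Su) [].
  + set A := \sum_(i < n) _ * ys i in Mt Mu; set B := \sum_(i < n) _ in Mt *.
    rewrite (_ : t * u * _ = t * (u * (y - A)) + u * (t * (A - B))); last by ring.
    by apply: (zsubD zM); apply: (maxSM hM).
Qed.
End LocalRing.

(** * Decomposition and inertia groups, and an element of trace one *)

Section TameTrace.
Variables (F : fieldType) (L : splittingFieldType F) (V : F -> Prop).
Hypotheses (hV : valuation_domain V) (hG : galois 1%VS (fullv : {subfield L})).
Notation S := (@intclos F L V).
Notation gal := (gal_of (fullv : {subfield L})).
Let ringV : subring *%R 1 V. Proof. by case: hV. Qed.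
Let ringS : subring *%R 1 S := intclos_subring L hV.
Let zS := subring_zsub ringS.
Let S1 : S 1 := subring1 ringS.
Let SM : forall x y, S x -> S y -> S (x * y) := subringM ringS.

Variables (r : nat) (Ms : 'I_r -> L -> Prop).
Hypotheses (hMs : forall i, maxS V (Ms i))
  (dMs : forall i j, i != j -> ~ (forall x, Ms i x <-> Ms j x))
  (cMs : forall M, maxS V M -> exists i, forall x, M x <-> Ms i x).
Variable i0 : 'I_r.
Let M := Ms i0.
Let hM : maxS V M := hMs i0.
Let zM := maxS_zsub hM.

Variables (E : fieldType) (phi : L -> E).
Hypotheses (phi1 : phi 1 = 1)
  (phiB : forall x y, S x -> S y -> phi (x - y) = phi x - phi y)
  (phiM : forall x y, S x -> S y -> phi (x * y) = phi x * phi y)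
  (phi0 : forall x, S x -> (phi x = 0 <-> M x))
  (phi_surj : forall e, exists x, S x /\ phi x = e).

Let phi_sum := red_sum ringS phiB.

Lemma phi_eq x y : S x -> S y -> (phi x = phi y <-> M (x - y)).
Proof.
move=> Sx Sy; rewrite -phi0 ?phiB //; last exact: (zsubB zS).
by split=> [->|/eqP]; [rewrite subrr | rewrite subr_eq0 => /eqP].
Qed.

Definition decomposition := [set s : gal | `[< forall x, M x <-> M (s x) >]].
Definition inertia := [set s in decomposition | `[< forall x, S x -> M (s x - x) >]].
Local Notation D := decomposition.
Local Notation I := inertia.

Implicit Types (s t : gal).

Lemma decompositionP s : reflect (forall x, M x <-> M (s x)) (s \in D).
Proof. by rewrite inE; apply: asboolP. Qed.

Lemma inertiaP s : reflect (s \in D /\ forall x, S x -> M (s x - x)) (s \in I).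
Proof. by apply: (iffP setIdP) => -[h /asboolP]. Qed.

Lemma decomposition_group_set : group_set D.
Proof.
apply/group_setP; split; first by apply/decompositionP => x; rewrite gal1x.
move=> s t /decompositionP hs /decompositionP ht; apply/decompositionP => x.
by rewrite galMx hs ht.
Qed.
Canonical decomposition_group := Group decomposition_group_set.

Lemma inertia_group_set : group_set I.
Proof.
apply/group_setP; split.
  apply/inertiaP; split; first exact: (group1 decomposition_group).
  by move=> x _; rewrite gal1x subrr; apply: (zsub0 zM).
move=> s t /inertiaP [Ds hs] /inertiaP [Dt ht]; apply/inertiaP; split.
  exact: groupM.
move=> x Sx; rewrite galMx.
have -> : t (s x) - x = (t (s x) - s x) + (s x - x) by ring.
by apply: (zsubD zM); [apply: ht; apply: intclos_gal | apply: hs].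
Qed.
Canonical inertia_group := Group inertia_group_set.

Lemma inertia_sub : I \subset D.
Proof. by apply/subsetP => s /inertiaP []. Qed.

(** The action on the [r] maximal ideals is transitive, and its fibres are left cosets of the
    decomposition group. *)
Lemma card_decomposition : #|{: gal}| = (#|D| * r)%N.
Proof.
have [g hg'] := choice (fun s : gal => cMs (maxS_gal hV s hM)).
have hg s x : M (s x) <-> Ms (g s) x := hg' s x.
have [t ht] := choice (fun j => maxS_transitive hV hG hMs dMs cMs i0 j).
have gt s j : (g s == j) = (s \in t j *: D)%g.
  rewrite mem_lcoset; apply/eqP/decompositionP => [gs x|h].
    rewrite galMx hg gs ht galVKx; exact: iff_refl.
  apply/eqP; apply: contrapT => /negP; move/dMs; apply => x.
  rewrite -hg ht; have := h (t j x); rewrite galMx galKx.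
  by move=> e; split=> /e.
rewrite -[LHS]sum1_card (partition_big g xpredT) //=.
rewrite (eq_bigr (fun=> #|D|)); last first.
  move=> j _; rewrite sum1_card -(card_lcoset D (t j)); apply: eq_card => s.
  exact: (gt s j).
by rewrite sum_nat_const card_ord mulnC.
Qed.

Lemma inertia_coset s t : s \in D -> t \in D ->
  (forall x, S x -> phi (s x) = phi (t x)) <-> (s * t^-1)%g \in I.
Proof.
move=> Ds Dt; have Dtv : (t^-1)%g \in D by rewrite groupV.
have Sg u x : S x -> S ((u : gal) x) by apply: intclos_gal.
split=> [h|/inertiaP [_ h] x Sx].
  apply/inertiaP; split; first exact: groupM.
  move=> x Sx; rewrite galMx.
  have -> : (t^-1)%g (s x) - x = (t^-1)%g (s x - t x).
    by rewrite rmorphB /= galKx.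
  by apply: (iffLR (decompositionP _ Dtv _)); apply/(phi_eq (Sg s _ Sx) (Sg t _ Sx)); apply: h.
apply/(phi_eq (Sg s _ Sx) (Sg t _ Sx)).
have := h x Sx; rewrite galMx => /(iffLR (decompositionP _ Dt _)).
by rewrite rmorphB /= galVKx.
Qed.

Local Notation d := #|rcosets I D|.
(** By [inertia_coset], the right cosets of inertia in the decomposition group correspond to the
    distinct residue characters [x |-> phi (s x)]. *)
Definition coset_rep (k : 'I_d) : gal := repr (enum_val k : {set gal}).
Local Notation sig := coset_rep.

Lemma coset_repP (k : 'I_d) : sig k \in D /\ enum_val k = (I :* sig k)%g.
Proof.
have /rcosetsP [s Ds e] := enum_valP k; rewrite /sig e.
have h := mem_repr_rcoset (inertia_group : {group gal}) s; split; last exact: esym (rcoset_repr _ _).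
case/rcosetP: h => u /inertiaP [Du _] ->; exact: groupM.
Qed.

Lemma coset_rep_ex s : exists k : 'I_d, s \in D -> (s * (sig k)^-1)%g \in I.
Proof.
case: (boolP (s \in D)) => [Ds|nD]; last first.
  have h : (I : {set gal}) \in rcosets I D.
    by apply/rcosetsP; exists 1%g; rewrite ?mulg1 // (group1 decomposition_group).
  by exists (enum_rank_in h (I : {set gal})).
have h : (I :* s)%g \in rcosets I D by apply/rcosetsP; exists s.
exists (enum_rank_in h (I :* s)%g) => _.
have [_] := coset_repP (enum_rank_in h (I :* s)%g); rewrite enum_rankK_in // => e.
by rewrite -mem_rcoset -e; apply: rcoset_refl.
Qed.

Lemma coset_rep_inj k l : (sig k * (sig l)^-1)%g \in I -> k = l.
Proof.
rewrite -mem_rcoset => h; apply: enum_val_inj.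
have [_ ->] := coset_repP k; have [_ ->] := coset_repP l.
exact: (rcoset_eqP h).
Qed.

Lemma sum_decomposition x : S x ->
  \sum_(s in D) phi (s x) = (\sum_k phi (sig k x)) *+ #|I|.
Proof.
move=> Sx; have [kap hk] := choice coset_rep_ex.
rewrite (partition_big kap xpredT) //= -sumrMnl; apply: eq_bigr => k _.
have [Dk ek] := coset_repP k.
rewrite (eq_bigr (fun=> phi (sig k x))); last first.
  move=> s /andP[Ds /eqP e]; have := hk s Ds; rewrite e => h.
  exact: (iffRL (inertia_coset Ds Dk) h x Sx).
rewrite sumr_const -(card_rcoset I (sig k)); congr (_ *+ _); apply: eq_card => s.
rewrite mem_rcoset -[LHS]/((s \in D) && (kap s == k)); apply/idP/idP.
  by move=> /andP[Ds /eqP <-]; apply: hk.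
move=> h; have Ds : s \in D.
  by have := subsetP inertia_sub _ h; rewrite groupMr // groupV.
rewrite Ds /=; apply/eqP; apply: coset_rep_inj.
have -> : (sig (kap s) * (sig k)^-1)%g = ((s * (sig (kap s))^-1)^-1 * (s * (sig k)^-1))%g.
  by rewrite invMg invgK -!mulgA mulKg.
by apply: groupM => //; rewrite groupV; apply: hk.
Qed.

Lemma sum_reps_invariant t x : t \in D -> S x ->
  \sum_k phi ((sig k * t)%g x) = \sum_k phi (sig k x).
Proof.
move=> Dt Sx; have [kap hk] := choice coset_rep_ex.
pose p k := kap (sig k * t)%g.
have Dk k : sig k \in D by case: (coset_repP k).
have Dkt k : (sig k * t)%g \in D by apply: groupM.
have pinj : injective p.
  move=> k l e; apply: coset_rep_inj.
  have hk1 := hk _ (Dkt k); have hl := hk _ (Dkt l).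
  have e' : kap (sig k * t)%g = kap (sig l * t)%g := e.
  rewrite e' in hk1.
  have -> : (sig k * (sig l)^-1 = (sig k * t * (sig (kap (sig l * t)))^-1) *
      (sig l * t * (sig (kap (sig l * t)))^-1)^-1)%g.
    by rewrite !invMg invgK !mulgA mulgKV mulgK.
  by apply: groupM; rewrite ?groupV.
rewrite [RHS](reindex_inj pinj) /=; apply: eq_bigr => k _.
exact: (iffRL (inertia_coset (Dkt k) (Dk (p k))) (hk _ (Dkt k)) x Sx).
Qed.

Lemma reps_independent (a : 'I_d -> E) :
  (forall x, S x -> \sum_k a k * phi (sig k x) = 0) -> forall k, a k = 0.
Proof.
apply: (dedekind_independence (R := S) (chi := fun k x => phi (sig k x))) => //.
- by move=> k; rewrite rmorph1.
- by move=> k x y Sx Sy; rewrite rmorphM phiM //; apply: intclos_gal.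
- move=> k l kl; apply: contrapT => no.
  have Dk j : sig j \in D by case: (coset_repP j).
  move/eqP: kl; apply; apply: coset_rep_inj; apply: (iffLR (inertia_coset (Dk k) (Dk l))) => x Sx.
  by apply/eqP; apply: contrapT => /negP h; apply: no; exists x.
Qed.

Variables (E0 : fieldType) (psi : F -> E0).
Hypotheses (psi1 : psi 1 = 1)
  (psiB : forall x y, V x -> V y -> psi (x - y) = psi x - psi y)
  (psiM : forall x y, V x -> V y -> psi (x * y) = psi x * psi y)
  (psi0 : forall x, V x -> (psi x = 0 <-> JV V x))
  (psi_surj : forall e, exists x, V x /\ psi x = e).

Lemma residue_map : exists iota : {rmorphism E0 -> E}, forall a, V a -> iota (psi a) = phi a%:A.
Proof.
have [a ha] := choice psi_surj.
have Va e : V (a e) by case: (ha e).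
have wd x y : V x -> V y -> psi x = psi y -> phi x%:A = phi y%:A.
  move=> Vx Vy /eqP; rewrite -subr_eq0 -psiB // => /eqP/psi0 J.
  apply/(phi_eq (intclos_alg L hV Vx) (intclos_alg L hV Vy)).
  by rewrite -scalerBl; apply: (maxS_JV hV hG hM); apply: J; apply: (zsubB (subring_zsub ringV)).
pose io e := phi (a e)%:A.
have ii x : V x -> io (psi x) = phi x%:A.
  by move=> Vx; apply: wd => //; case: (ha (psi x)).
have iB : zmod_morphism io.
  move=> e e'; have [Vx <-] := ha e; have [Vy <-] := ha e'.
  rewrite -psiB // !ii //; last exact: (zsubB (subring_zsub ringV)).
  by rewrite scalerBl phiB //; apply: intclos_alg.
have iM : monoid_morphism io.
  split; first by rewrite -psi1 ii ?scale1r //; apply: (subring1 ringV).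
  move=> e e'; have [Vx <-] := ha e; have [Vy <-] := ha e'.
  rewrite -psiM // !ii //; last exact: (subringM ringV).
  by rewrite -phiM; [rewrite -scalerAl mul1r scalerA | apply: intclos_alg | apply: intclos_alg].
pose iota : {rmorphism E0 -> E} := HB.pack io (GRing.isZmodMorphism.Build E0 E io iB)
  (GRing.isMonoidMorphism.Build E0 E io iM).
by exists iota.
Qed.

(** An element [z] congruent at every maximal ideal to the matching conjugate of [y] has all its
    conjugates reducing to [phi y], so its characteristic polynomial reduces to a power of
    [X - phi y]. The gcd with a separable polynomial vanishing at [phi y] is linear, and gcds do not
    change when the residue field of [V] is extended. *)
Lemma residue_fixed y : res_separable V M -> S y -> (forall s, s \in D -> phi (s y) = phi y) ->
  exists a, V a /\ phi y = phi a%:A.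
Proof.
move=> sep Sy fy; have [iota hi] := residue_map.
have [t ht] := choice (fun j => maxS_transitive hV hG hMs dMs cMs i0 j).
have Sg s x : S x -> S (s x) by apply: intclos_gal.
have [z [Sz hz]] := crt hV hMs dMs (fun j => Sg (t j)^-1%g y Sy).
have phiz s : phi (s z) = phi y.
  have [j hj'] := cMs (maxS_gal hV s hM).
  have hj x : M (s x) <-> Ms j x := hj' x.
  have Dts : ((t j)^-1 * s)%g \in D.
    by apply/decompositionP => x; rewrite galMx hj ht galVKx; exact: iff_refl.
  rewrite -(fy _ Dts) galMx; apply/(phi_eq (Sg _ _ Sz) (Sg _ _ (Sg _ _ Sy))).
  by rewrite -rmorphB; apply/hj; apply: (ideal_sqS (hMs j)).
have [N [mN eN /(_ Sz) VN]] := gal_charpoly hV hG z.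
have [N0 rN0] := red_poly_ex ringV psiB VN.
have iotaE p q p0 : red_poly V psi p p0 -> red_poly S phi (map_poly (in_alg L) p) q ->
    map_poly iota p0 = q.
  move=> h h'; apply/polyP => i; have [Vp e] := h i; have [_ e'] := h' i.
  by rewrite coef_map /= -e hi // -e' coef_map.
have iN : map_poly iota N0 = ('X - (phi y)%:P) ^+ #|{: gal}|.
  apply: (iotaE _ _ _ rN0); rewrite eN -prodr_const.
  apply: (big_ind2 (red_poly S phi)).
  - by have := red_polyC ringS phiB S1; rewrite phi1 !polyC1.
  - by move=> p q p' q'; apply: red_polyM.
  - move=> s _; rewrite -(phiz s); apply: (red_polyB ringS phiB).
      exact: (red_polyX ringS phi1 phiB).
    by apply: (red_polyC ringS phiB); apply: Sg.
have Ly : loc V M y by apply/loc_locS => //; apply: locS_int.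
have [p [a [b [Vp Va Vb py J]]]] := sep y Ly.
have [p0 rp] := red_poly_ex ringV psiB Vp.
have [a0 ra] := red_poly_ex ringV psiB Va.
have [b0 rb] := red_poly_ex ringV psiB Vb.
have bez : a0 * p0 + b0 * p0^`() = 1.
  apply/eqP; rewrite -subr_eq0; apply/eqP/polyP => i; rewrite coef0.
  have h : red_poly V psi (a * p + b * p^`() - 1) (a0 * p0 + b0 * p0^`() - 1).
    apply: (red_polyB ringV psiB).
      apply: (red_polyD ringV psiB); apply: (red_polyM ringV psiB psiM) => //.
      exact: (red_poly_deriv ringV psiB).
    by have := red_polyC ringV psiB (subring1 ringV); rewrite psi1 !polyC1.
  have [Vc <-] := h i; exact/psi0.
have rootp : root (map_poly iota p0) (phi y).
  have SP i : S (map_poly (in_alg L) p)`_i by rewrite coef_map; apply: intclos_alg.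
  have [q rq] := red_poly_ex ringS phiB SP.
  have [Spy e] := red_poly_horner ringS phi1 phiB phiM rq Sy.
  rewrite (iotaE _ _ _ rp rq); apply/rootP; rewrite -e; apply/(phi0 Spy).
  exact: (JSM_int hV hM).
(* The Bezout relation with the derivative survives reduction, so [phi y] is a simple root. *)
have simple : ~~ (('X - (phi y)%:P) ^+ 2 %| map_poly iota p0).
  apply/negP => /dvdpP [q e].
  have := congr1 (fun Q : {poly E} => Q.[phi y]) (congr1 (map_poly iota) bez).
  rewrite rmorphD !rmorphM /= rmorph1 -deriv_map e expr2 !derivM derivXsubC !hornerE.
  by rewrite /= ?subrr ?add0r ?subrr !(mulr0, addr0) => /esym/eqP; rewrite oner_eq0.
pose g := gcdp p0 N0.
have gE : map_poly iota g %= 'X - (phi y)%:P.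
  rewrite gcdp_map iN.
  have /dvdp_exp_XsubCP [k _ gk] := dvdp_gcdr (map_poly iota p0) (('X - (phi y)%:P) ^+ #|{: gal}|).
  apply: (eqp_trans gk); case: k gk => [|[|k]] gk.
  - have : 'X - (phi y)%:P %| gcdp (map_poly iota p0) (('X - (phi y)%:P) ^+ #|{: gal}|).
      rewrite dvdp_gcd dvdp_XsubCl rootp /= dvdp_exp //.
      by apply/card_gt0P; exists 1%g.
    by rewrite (eqp_dvdr _ gk) expr0 dvdp1 size_XsubC.
  - by rewrite expr1 eqpxx.
  - case/negP: simple; apply: dvdp_trans (dvdp_gcdl _ (('X - (phi y)%:P) ^+ #|{: gal}|)).
    by rewrite (eqp_dvdr _ gk) dvdp_exp2l.
have szg : size g = 2 by rewrite -(size_map_poly iota) (eqp_size gE) size_XsubC.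
have : root (map_poly iota g) (phi y) by rewrite (eqp_root gE) root_XsubC.
rewrite /root (horner_coef_wide (n := 2)) ?size_map_poly ?szg //.
rewrite !big_ord_recl big_ord0 /= !coef_map expr0 mulr1 addr0 expr1 /bump /= addn0 => /eqP e.
have g1 : g`_1 != 0 by have := lead_coef_eq0 g; rewrite lead_coefE szg /= => ->; rewrite -size_poly_eq0 szg.
have e' : phi y = iota (- g`_0 / g`_1).
  rewrite fmorph_div rmorphN /= -(addr0 (- _)) -e addKr mulrAC divff ?mul1r //.
  by rewrite fmorph_eq0.
have [c [Vc ec]] := psi_surj (- g`_0 / g`_1).
by exists c; split=> //; rewrite e' -ec hi.
Qed.

Lemma card_reps : #|D| = (d * #|I|)%N.
Proof. by rewrite -(Lagrange inertia_sub) mulnC. Qed.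

(** Both inequalities come from the matrix of the [phi (sig k (ys j))]: its rows are independent by
    independence of characters, its columns by Artin's argument, where separability enters through
    [residue_fixed]. *)
Lemma card_reps_res_deg n : res_deg V M n -> res_separable V M -> d = n.
Proof.
move=> hn sep; have [ys [Sy free gen]] := res_deg_int hV hM hn.
have Sg s x : S x -> S (s x) by apply: intclos_gal.
have Dk k : sig k \in D by case: (coset_repP k).
have VS a : V a -> S (in_alg L a) by apply: intclos_alg.
have phiz x : S x -> M x -> phi x = 0 by move=> Sx Mx; apply/phi0.
apply/eqP; rewrite eqn_leq; apply/andP; split.
  apply: (@inj_mx_leq E d n (\matrix_(k, j) phi (sig k (ys j)))) => u uA.
  apply/rowP => k; rewrite mxE; move: k; apply: reps_independent => x Sx.
  have [cs [Vcs Mx]] := gen x Sx.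
  have Sc j : S (in_alg L (cs j) * ys j) by apply: SM => //; apply: VS.
  have e k : phi (sig k x) = \sum_j phi (in_alg L (cs j)) * phi (sig k (ys j)).
    rewrite (_ : sig k x = sig k (\sum_j in_alg L (cs j) * ys j) +
        sig k (x - \sum_j in_alg L (cs j) * ys j)); last by rewrite -rmorphD addrC subrK.
    have Ss : S (\sum_j in_alg L (cs j) * ys j) by apply: (zsub_sum zS).
    rewrite (redD ringS phiB); [|exact: Sg|by apply: Sg; apply: (zsubB zS)].
    rewrite [X in _ + X]phiz ?addr0; last first.
    - exact: (iffLR (decompositionP _ (Dk k) _)).
    - by apply: Sg; apply: (zsubB zS).
    rewrite rmorph_sum phi_sum; last by move=> j _; apply: Sg.
    apply: eq_bigr => j _; rewrite rmorphM /= rmorph_alg phiM //; first exact: VS.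
    exact: Sg.
  under eq_bigr => k _ do rewrite e mulr_sumr.
  rewrite exchange_big big1 //= => j _.
  have := congr1 (fun w : 'rV_n => phi (in_alg L (cs j)) * w 0 j) uA; rewrite !mxE mulr0 mulr_sumr => h; rewrite -[RHS]h.
  by apply: eq_bigr => k _; rewrite mxE mulrCA.
apply: (@inj_mx_leq E n d (\matrix_(j, k) phi (sig k (ys j)))) => u uA.
apply/rowP => j0; rewrite mxE; apply: contrapT => /eqP u0.
have [w hw] := choice (fun j => phi_surj (u 0 j)).
have Sw j : S (w j) by case: (hw j).
have ew j : phi (w j) = u 0 j by case: (hw j).
(* Artin: multiplying by [c] and summing the relations over the coset representatives
   makes the coefficients invariant, hence residues of elements of [V] *)
have relD s : s \in D -> \sum_j phi (w j) * phi (s (ys j)) = 0.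
  move=> Ds; have [k hk] := coset_rep_ex s.
  have := congr1 (fun v : 'rV_d => v 0 k) uA; rewrite !mxE => h; rewrite -[RHS]h.
  apply: eq_bigr => j _; rewrite mxE ew; congr (_ * _).
  exact: (iffRL (inertia_coset Ds (Dk k)) (hk Ds)).
have Swy s : S (\sum_j w j * s (ys j)).
  by apply: (zsub_sum zS) => j _; apply: SM => //; apply: Sg.
have relM s : s \in D -> M (\sum_j w j * s (ys j)).
  move=> Ds; apply/(phi0 (Swy s)); rewrite phi_sum; last by move=> j _; apply: SM => //; apply: Sg.
  rewrite -[RHS](relD s Ds); apply: eq_bigr => j _; rewrite phiM //; exact: Sg.
have relT k : \sum_j phi (sig k (w j)) * phi (ys j) = 0.
  have DV : ((sig k)^-1)%g \in D by rewrite groupV.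
  have := iffLR (decompositionP _ (Dk k) _) (relM _ DV).
  move/(iffRL (phi0 (Sg _ _ (Swy _)))); rewrite rmorph_sum phi_sum.
    move=> e; rewrite -[RHS]e; apply: eq_bigr => j _.
    by rewrite rmorphM /= galVKx phiM //; apply: Sg.
  by move=> j _; rewrite rmorphM /= galVKx; apply: SM => //; apply: Sg.
have nMw : ~ M (w j0) by move/(phiz _ (Sw j0)); rewrite ew; apply/eqP.
(* As [v w_j0] is congruent to [1], every [c] has the same residue as [c v w_j0]; so [T0] makes the
   sum of the characters vanish, against their independence. *)
have [v [Sv Mv]] := maxS_inv hV hM (Sw j0) nMw.
have T0 c : S c -> \sum_k phi (sig k (c * v * w j0)) = 0.
  move=> Sc.
  have inv j : exists a, V a /\ \sum_k phi (sig k (c * v * w j)) = phi (in_alg L a).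
    have Sz k : S (sig k (c * v * w j)) by apply: Sg; apply: SM => //; apply: SM.
    have Sz' : S (\sum_k sig k (c * v * w j)) by apply: (zsub_sum zS).
    rewrite -phi_sum //; apply: residue_fixed => // s Ds.
    rewrite rmorph_sum !phi_sum //; last by move=> k _; apply: Sg.
    rewrite -(sum_reps_invariant Ds) //; last by apply: SM => //; apply: SM.
    by apply: eq_bigr => k _; rewrite galMx.
  have [a ha] := choice inv.
  have Va j : V (a j) by case: (ha j).
  have J := free a Va.
  have -> : \sum_k phi (sig k (c * v * w j0)) = phi (in_alg L (a j0)) by case: (ha j0).
  apply: phiz; first exact: VS.
  apply: (maxS_JV hV hG hM); apply: J.
  have Sc' j : S (in_alg L (a j) * ys j) by apply: SM => //; apply: VS.
  apply/phi0; first exact: (zsub_sum zS).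
  rewrite phi_sum //.
  rewrite (eq_bigr (fun j => \sum_k phi (sig k (c * v)) * (phi (sig k (w j)) * phi (ys j)))).
    by rewrite exchange_big big1 //= => k _; rewrite -mulr_sumr relT mulr0.
  move=> j _; rewrite phiM //; last exact: VS.
  case: (ha j) => _ <-; rewrite mulr_suml; apply: eq_bigr => k _.
  rewrite rmorphM phiM; [by rewrite mulrA | by apply: Sg; apply: SM | exact: Sg].
have d0 : (0 < d)%N by rewrite card_gt0; apply/set0Pn; exists (I : {set gal}); apply/rcosetsP; exists 1%g; rewrite ?mulg1 ?group1.
have /eqP : (1 : E) = 0; last by rewrite oner_eq0.
apply: (reps_independent (a := fun=> 1) _ (Ordinal d0)) => x Sx.
rewrite -[RHS](T0 x Sx); apply: eq_bigr => k _; rewrite mul1r.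
apply/phi_eq; [exact: Sg|by apply: Sg; apply: SM => //; apply: SM|].
rewrite -rmorphB; apply: (iffLR (decompositionP _ (Dk k) _)).
rewrite (_ : x - _ = x * (1 - v * w j0)); last by ring.
exact: (maxSM hM).
Qed.

(** Comparing [e n r] with the order of the Galois group identifies [e] with the order of inertia.
    For an element of all the other maximal ideals only the decomposition group contributes to the
    trace modulo [M], which is [e] times a sum of distinct characters. Tameness makes [e] nonzero in
    the residue field, so some trace is a unit of [V]. *)
Lemma tame_trace e n : res_deg V M n -> res_separable V M -> (\dim {:L} = e * n * r)%N ->
  (forall p, prime p -> JV V p%:R -> ~~ (p %| e)%N) ->
  exists c, [/\ S c, forall j, j != i0 -> Ms j c & \sum_(s : gal) s c = 1].
Proof.
move=> hn sep dimL tame.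
have Sg s x : S x -> S (s x) by apply: intclos_gal.
have d0 : (0 < d)%N by rewrite card_gt0; apply/set0Pn; exists (I : {set gal}); apply/rcosetsP; exists 1%g; rewrite ?mulg1 ?group1.
have r0 : (0 < r)%N by case: (r) i0 => [[]|].
have eI : #|I| = e.
  have := card_decomposition; rewrite card_gal // dimL card_reps (card_reps_res_deg hn sep).
  rewrite (card_reps_res_deg hn sep) in d0.
  by move/eqP; rewrite eqn_pmul2r // mulnC eqn_pmul2l // => /eqP.
have e_neq0 : e%:R != 0 :> E.
  apply/eqP => e0; have egt0 : (0 < e)%N by rewrite -eI cardG_gt0.
  have : \prod_(f <- prime_decomp e) (f.1 ^ f.2)%:R = 0 :> E.
    by rewrite -natr_prod -prod_prime_decomp.
  move/eqP; rewrite prodf_seq_eq0 => /hasP [[p k] /mem_prime_decomp [pp k0 pk]] /=.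
  rewrite natrX expf_eq0 => /andP[_ /eqP p0].
  have Sp : S p%:R by apply: (subringXn ringS).
  have Jp : JV V p%:R.
    apply: (maxS_alg hV hM); rewrite -in_algE rmorph_nat; apply/(phi0 Sp).
    rewrite -p0; elim: (p) => [|q IH]; first exact: (red0 ringS phiB).
    rewrite -addn1 !natrD (redD ringS phiB) ?IH ?phi1 //; exact: (subringXn ringS).
  by have := tame p pp Jp; rewrite (dvdn_trans _ pk) // dvdn_exp.
have [c [Sc hc]] : exists c, S c /\ \sum_k phi (sig k c) <> 0.
  apply: contrapT => no.
  have /eqP : (1 : E) = 0; last by rewrite oner_eq0.
apply: (reps_independent (a := fun=> 1) _ (Ordinal d0)) => x Sx.
  apply: contrapT => h; apply: no; exists x; split=> // h'; apply: h; rewrite -[RHS]h'.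
  by apply: eq_bigr => k _; rewrite mul1r.
have [f hf] := crt_idempotents hV hMs dMs.
have [Sf f1 f2] := hf i0.
pose c' := c * f i0; have Sc' : S c' by apply: SM.
have Mc' j : j != i0 -> Ms j c'.
  by move=> ji; apply: (maxSM (hMs j)) => //; apply: (ideal_sqS (hMs j)); apply: f2.
have tr : phi (\sum_(s : gal) s c') = (\sum_k phi (sig k c)) * e%:R.
  rewrite phi_sum; last by move=> s _; apply: Sg.
  rewrite (bigID (mem D)) /= [X in _ + X]big1 ?addr0; last first.
    move=> s nD; apply/(phi0 (Sg _ _ Sc')).
    have [j hj'] := cMs (maxS_gal hV s hM); have hj x : M (s x) <-> Ms j x := hj' x.
    apply/hj; apply: Mc'; apply: contraNneq nD => ji; apply/decompositionP => x.
    by rewrite hj ji.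
  rewrite sum_decomposition // eI [RHS]mulr_natr; congr (_ *+ _); apply: eq_bigr => k _.
  have Dk : sig k \in D by case: (coset_repP k).
  apply/phi_eq; [exact: Sg | exact: Sg |]; rewrite -rmorphB.
  apply: (iffLR (decompositionP _ Dk _)).
  rewrite (_ : _ - _ = (- c) * (1 - f i0)); last by rewrite /c'; ring.
  by apply: (maxSM hM); [apply: (zsubN zS) | apply: (ideal_sqS hM)].
have Str : S (\sum_(s : gal) s c') by apply: (zsub_sum zS) => s _; apply: Sg.
have [a ea] : exists a, \sum_(s : gal) s c' = a%:A.
  apply: gal_fixed => // t; rewrite rmorph_sum [RHS](reindex_inj (mulIg t)) /=.
  by apply: eq_bigr => s _; rewrite galMx.
have Va : V a by apply: (algV_intclos (L := L) hV); rewrite -ea.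
have nJa : ~ JV V a.
  move/(maxS_JV hV hG hM); rewrite -ea => /(iffRL (phi0 Str)); rewrite tr => /eqP.
  by rewrite mulf_eq0 (negPf e_neq0) orbF => /eqP.
have [a0 Vi] := JV_unit hV Va nJa.
exists (a^-1%:A * c'); split.
- by apply: SM => //; apply: intclos_alg.
- by move=> j ji; apply: (maxSM (hMs j)); [apply: intclos_alg | apply: Mc'].
- under eq_bigr => s _ do rewrite rmorphM /= rmorph_alg.
  by rewrite -mulr_sumr ea -scalerAl mul1r scalerA mulVf // scale1r.
Qed.

End TameTrace.

(** * The trace form, powers of the radical of [S], and uniformizers *)

Section Spectrum.
Variables (F : fieldType) (L : splittingFieldType F) (V : F -> Prop).
Hypotheses (hV : valuation_domain V) (hG : galois 1%VS (fullv : {subfield L})).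
Notation S := (@intclos F L V).
Notation gal := (gal_of (fullv : {subfield L})).

Definition spectrum r (Ms : 'I_r -> L -> Prop) :=
  [/\ forall i, maxS V (Ms i), forall i j, i != j -> ~ (forall x, Ms i x <-> Ms j x)
    & forall M, maxS V M -> exists i, M = Ms i].

Definition trace_units r (Ms : 'I_r -> L -> Prop) :=
  forall i, exists c, [/\ S c, forall j, j != i -> Ms j c & \sum_(s : gal) s c = 1].

Lemma nmax_spectrum r : nmax L V r -> exists Ms : 'I_r -> L -> Prop, spectrum Ms.
Proof.
move=> [Ms [h1 h2 h3]]; exists Ms; split=> // M /h3 [i hi]; exists i.
by apply/funext => x; apply/propext.
Qed.

Lemma tame_trace_units : tame_defectless L V ->
  exists r (Ms : 'I_r -> L -> Prop), spectrum Ms /\ trace_units Ms.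
Proof.
move=> tame; have [M0 hM0] := exists_maxS L hV.
have [_ [_ [r [[_ _ hr _] _]]]] := tame M0 hM0.
have [Ms [hMs dMs cMs]] := nmax_spectrum hr; exists r, Ms; split=> // i.
have [e [n [r' [[_ hn hr' dimL] [tp sep]]]]] := tame _ (hMs i).
have [Ns [hNs dNs cNs]] := nmax_spectrum hr'.
have [k ek] := cNs _ (hMs i).
have [E [phi [phi1 phiB phiM phi0 phi_surj]]] := residue_field (intclos_subring L hV) (hMs i).
have [E0 [psi [psi1 psiB psiM psi0 psi_surj]]] := residue_field (proj1 hV) (JV_max hV).
have cNs' M : maxS V M -> exists j, forall x, M x <-> Ns j x.
  by case/cNs => j ->; exists j.
rewrite ek in hn sep phi0.
have [c [Sc Nc trc]] := tame_trace hV hG hNs dNs cNs' phi1 phiB phiM phi0 phi_surj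
  psi1 psiB psiM psi0 psi_surj hn sep dimL tp.
exists c; split=> // j ji; have [l el] := cNs _ (hMs j); rewrite el.
apply: Nc; apply: contraNneq ji => lk; apply/eqP; apply: contrapT => /eqP /dMs; apply => x.
by rewrite el ek lk.
Qed.

Variables (r : nat) (Ms : 'I_r -> L -> Prop).
Hypotheses (hs : spectrum Ms) (htr : trace_units Ms).
Variable pi : F.
Hypotheses (hpi : forall x, JV V x <-> exists v, V v /\ x = v * pi).

Let ringV : subring *%R 1 V. Proof. by case: hV. Qed.
Let ringS : subring *%R 1 S := intclos_subring L hV.
Let zS := subring_zsub ringS.
Let S1 : S 1 := subring1 ringS.
Let SM : forall x y, S x -> S y -> S (x * y) := subringM ringS.
Let hMs : forall i, maxS V (Ms i). Proof. by case: hs. Qed.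
Let dMs : forall i j, i != j -> ~ (forall x, Ms i x <-> Ms j x). Proof. by case: hs. Qed.
Let cMs : forall M, maxS V M -> exists i, M = Ms i. Proof. by case: hs. Qed.
Let Sg (s : gal) x : S x -> S (s x). Proof. exact: intclos_gal. Qed.

Lemma separate i : exists e, [/\ S e, ~ Ms i e & forall j, j != i -> Ms j e].
Proof.
have [e he] := crt_idempotents hV hMs dMs; have [Se e1 e2] := he i.
exists (e i); split=> //; last by move=> j ji; apply: (ideal_sqS (hMs j)); apply: e2.
move=> Me; apply: (maxS1 (hMs i)); rewrite -[1](subrK (e i)).
by apply: (zsubD (maxS_zsub (hMs i))) => //; apply: (ideal_sqS (hMs i)).
Qed.

Lemma trace_F (x : L) : exists a, \sum_(s : gal) s x = a%:A.
Proof.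
apply: gal_fixed => // t; rewrite rmorph_sum [RHS](reindex_inj (mulIg t)) /=.
by apply: eq_bigr => s _; rewrite galMx.
Qed.

Lemma spectrum_gal M (s : gal) x : maxS V M -> (forall i, Ms i x) -> M (s x).
Proof. by move=> hM hx; have [i ei] := cMs (maxS_gal hV s hM); have := hx i; rewrite -ei. Qed.

(** Nondegeneracy of the trace form. If [y^-1] were local at [Ms i], some [S]-multiple of [y] would
    be congruent at every maximal ideal to the element [c] of trace [1]; as conjugation permutes
    these ideals, its trace would be congruent to [1]. *)
Lemma trace_small (y : L) :
  (forall s, S s -> exists a, JV V a /\ \sum_(t : gal) t (y * s) = a%:A) ->
  forall i, Ms i y.
Proof.
move=> h.
have [->|y0] := eqVneq y 0; first by move=> i; apply: (zsub0 (maxS_zsub (hMs i))).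
have noinv i : ~ locS V (Ms i) y^-1.
  move=> [t [St nt Sty]]; have [u [Su Mu]] := maxS_inv hV (hMs i) St nt.
  have [c [Sc Mc trc]] := htr i.
  have [a [Ja ea]] := h (t * y^-1 * (u * c)) (SM Sty (SM Su Sc)).
  have Mz j : Ms j (c - t * u * c).
    rewrite (_ : _ - _ = c * (1 - u * t)); last by ring.
    have Sut : S (1 - u * t) by apply: (zsubB zS) => //; apply: SM.
    have [->|ji] := eqVneq j i; first exact: (maxSM (hMs i)).
    by apply: (maxSMr (hMs j)) => //; apply: Mc.
  have e : \sum_(s : gal) s (c - t * u * c) = (1 - a)%:A.
    rewrite scalerBl scale1r -ea -trc -sumrB; apply: eq_bigr => s _.
    rewrite rmorphB; congr (_ - s _).
    by field.
  have J1 : JV V (1 - a).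
    apply: (maxS_alg hV (hMs i)); rewrite -e; apply: (zsub_sum (maxS_zsub (hMs i))) => s _.
    exact: spectrum_gal.
  apply: (JV_not1 hV); rewrite -(subrK a 1).
  exact: (zsubD (left_ideal_zsub (JV_left_ideal hV))).
have loc i : exists t, [/\ S t, ~ Ms i t & Ms i (t * y)].
  case: (locS_total hV hG (hMs i) y0) => [[t [St nt Sty]]|/noinv] //.
  exists t; split=> //; apply: contrapT => n; apply: (noinv i).
  by exists (t * y); split=> //; rewrite mulfK.
have Sy : S y.
  apply: (intclos_loc hV) => M /cMs [i ->]; have [t [St nt Mt]] := loc i.
  by exists t; split=> //; apply: (maxS_sub (hMs i)).
move=> i; have [t [St nt Mt]] := loc i.
by case: (maxS_prime hV (hMs i) St Sy Mt).
Qed.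

(** All conjugates of [t] lie in [J(S)], so the characteristic polynomial of [t] is a power of the
    variable modulo [J(V) = pi V]. *)
Lemma radical_power t : S t -> (forall i, Ms i t) ->
  exists s, S s /\ t ^+ #|{: gal}| = pi%:A * s.
Proof.
move=> St Jt; have [p [mp ep /(_ St) Vp]] := gal_charpoly hV hG t.
set N := #|_|.
have szp : size p = N.+1.
  by rewrite -(size_map_poly (in_alg L)) ep size_prod_XsubC /N cardT enumT [index_enum _]unlock.
have coefJ j : j != N -> forall i, Ms i (p`_j)%:A.
  pose good (Q : {poly L}) := exists n, forall j, S Q`_j /\ (j != n -> forall i, Ms i Q`_j).
  have : good (\prod_(s : gal) ('X - (s t)%:P)).
    apply: big_ind.
    - exists 0%N => k; rewrite coef1; case: eqP => // _; split; first exact: (zsub0 zS).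
      by move=> _ i; apply: (zsub0 (maxS_zsub (hMs i))).
    - move=> Q Q' [n hn] [n' hn']; exists (n + n')%N => k; rewrite coefM; split.
        by apply: (zsub_sum zS) => l _; apply: SM; [case: (hn l) | case: (hn' (k - l)%N)].
      move=> kn i; apply: (zsub_sum (maxS_zsub (hMs i))) => l _.
      have [S1' J1] := hn l; have [S2 J2] := hn' (k - l)%N.
      have [ln|ln] := eqVneq (l : nat) n.
        apply: (maxSM (hMs i)) => //; apply: J2; apply: contraNneq kn => e.
        by rewrite -e -ln subnKC // -ltnS.
      by apply: (maxSMr (hMs i)) => //; apply: J1.
    - move=> s _; exists 1%N => k; rewrite coefB coefX coefC; split.
        apply: (zsubB zS); first by case: eqP => // _; apply: (zsub0 zS).
        by case: eqP => _; [apply: Sg | apply: (zsub0 zS)].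
      move=> k1 i; rewrite (negPf k1) sub0r; apply: (zsubN (maxS_zsub (hMs i))).
      by case: eqP => _; [apply: spectrum_gal | apply: (zsub0 (maxS_zsub (hMs i)))].
  rewrite -ep => -[n hn] jN i.
  have nN : n = N.
    apply/eqP; apply: contrapT => /negP nN; have [_ /(_ _ i)] := hn N.
    rewrite eq_sym => /(_ nN); rewrite coef_map /= (_ : p`_N = 1) ?scale1r; first exact: maxS1.
    by rewrite -(monicP mp) lead_coefE szp.
  have [_ /(_ _ i)] := hn j; rewrite nN => /(_ jN); by rewrite coef_map.
have [i0 _] : exists i0 : 'I_r, True by have [M /cMs [i _]] := exists_maxS L hV; exists i.
have J j : exists v, j != N -> V v /\ p`_j = v * pi.
  have [->|jN] := eqVneq j N; first by exists 0.
  have /hpi [v hv] : JV V p`_j by apply: (maxS_alg hV (hMs i0)); apply: coefJ.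
  by exists v.
have [v hv] := choice J.
have : root (map_poly (in_alg L) p) t.
  rewrite ep; apply/rootP; rewrite horner_prod; apply/eqP.
  by rewrite prodf_seq_eq0; apply/hasP; exists 1%g; rewrite ?mem_index_enum //= gal1x !hornerE subrr.
move/rootP; rewrite (horner_coef_wide (n := N.+1)) ?size_map_poly ?szp // big_ord_recr /=.
rewrite coef_map /= (_ : p`_N = 1) ?scale1r ?mul1r; last by rewrite -(monicP mp) lead_coefE szp.
move=> e; exists (- \sum_(j < N) (v j)%:A * t ^+ j); split.
  apply: (zsubN zS); apply: (zsub_sum zS) => j _; apply: SM; last exact: (subringX ringS).
  by apply: intclos_alg => //; case: (hv j); rewrite ?ltn_eqF.
apply/eqP; rewrite mulrN -addr_eq0 addrC -[X in _ == X]e; apply/eqP; congr (_ + _).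
rewrite mulr_sumr; apply: eq_bigr => j _.
have [|_ ej] := hv j; first by rewrite ltn_eqF.
by rewrite coef_map ej -!in_algE /= -scalerA; rewrite -[in RHS](mulr_algl (v j)); ring.
Qed.

Hypothesis pi0 : pi != 0.

Lemma piA_neq0 : pi%:A != 0 :> L.
Proof. by rewrite scaler_eq0 oner_eq0 orbF. Qed.

Lemma Jpi : JV V pi.
Proof. by apply/hpi; exists 1; rewrite mul1r; split=> //; apply: (subring1 ringV). Qed.

(** If [M = M^2], write [t] in [M] as a sum of products: the factor [u] of least value has its
    square dividing [t] locally. Iterating from [pi] gives [t] in [M] such that [t^(2^N)] divides
    [pi] locally, whereas [N]-th powers of elements of [J(S)] are divisible by [pi]. This is absurd
    because [2^N > N]. *)
Lemma maxS_neq_sq i : exists t, Ms i t /\ ~ ideal_sq (Ms i) t.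
Proof.
apply: contrapT => no; have hM := hMs i; have zM := maxS_zsub hM.
have sq t : Ms i t -> ideal_sq (Ms i) t.
  by move=> Mt; apply: contrapT => n; apply: no; exists t.
have root2 t : Ms i t -> t != 0 -> exists u, [/\ Ms i u, u != 0 & locS V (Ms i) (t / u ^+ 2)].
  move=> Mt t0; have [n [a [b [hab e]]]] := sq t Mt.
  pose c (j : 'I_(n + n)) := match split j with inl k => a k | inr k => b k end.
  have Mc j : Ms i (c j) by rewrite /c; case: split => k; case: (hab k).
  have [|||||j [j0 hj]] := @valuation_least _ (locS V (Ms i)) _ _ _ _ _ c.
  - exact: (locS_int hV hM (zsub0 zS)).
  - exact: (locS_int hV hM).
  - by move=> x y; apply: (locSM hV hM).
  - by move=> x; apply: (locS_total hV hG hM).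
  - apply: contrapT => no'; move/eqP: t0; apply; rewrite e big1 // => k _.
    have [->|ck] := eqVneq (a k) 0; first by rewrite mul0r.
    by case: no'; exists (unsplit (inl k)); rewrite /c unsplitK.
  exists (c j); split=> //; rewrite e mulr_suml.
  apply: big_ind; first exact: (locS_int hV hM (zsub0 zS)).
    by move=> x y; apply: (locSD hV hM).
  move=> k _; have ha := hj (unsplit (inl k)); have hb := hj (unsplit (inr k)).
  rewrite /c !unsplitK -/(c j) in ha hb.
  by rewrite expr2 invfM mulrACA; apply: (locSM hV hM).
have pow k : exists t, [/\ Ms i t, t != 0 & locS V (Ms i) (pi%:A / t ^+ (2 ^ k))].
  elim: k => [|k [t [Mt t0 lt]]].
    exists pi%:A; split; [exact: (maxS_JV hV hG hM Jpi)|exact: piA_neq0|].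
    by rewrite expr1 divff ?piA_neq0 //; apply: (locS_int hV hM).
  have [u [Mu u0 lu]] := root2 t Mt t0; exists u; split=> //.
  have -> : pi%:A / u ^+ (2 ^ k.+1) = pi%:A / t ^+ (2 ^ k) * (t / u ^+ 2) ^+ (2 ^ k).
    rewrite expr_div_n -exprM -expnS; have := expf_neq0 (2 ^ k) t0; have := expf_neq0 (2 ^ k.+1) u0.
    by move=> h1 h2; field; rewrite h1.
  apply: (locSM hV hM) => //; elim: (2 ^ k)%N => [|m IH].
    by rewrite expr0; apply: (locS_int hV hM).
  by rewrite exprS; apply: (locSM hV hM).
set N := #|{: gal}|; have [t [Mt t0 [s [Ss ns Ssq]]]] := pow N.
(* [e] moves [t] into the other maximal ideals without changing its value at [Ms i], so that
   [radical_power] applies to [t e]. *)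
have [e [Se ne Me]] := separate i.
have St := maxS_sub hM Mt.
have [w [Sw ew]] : exists s, S s /\ (t * e) ^+ N = pi%:A * s.
  apply: radical_power; first exact: SM.
  by move=> j; have [->|ji] := eqVneq j i; [apply: (maxSMr hM) | apply: (maxSM (hMs j)) => //; apply: Me].
have lt : (N < 2 ^ N)%N by apply: ltn_expl.
have key : s * e ^+ N = t ^+ (2 ^ N - N).-1 * (s * (pi%:A / t ^+ (2 ^ N)) * w) * t.
  have tN : t ^+ N != 0 by apply: expf_neq0.
  have e1 : e ^+ N = pi%:A * w / t ^+ N by rewrite -ew exprMn mulrAC divff // mul1r.
  have e2 : t ^+ (2 ^ N) = t ^+ (2 ^ N - N).-1 * t * t ^+ N.
    by rewrite -exprSr prednK ?subn_gt0 // -exprD subnK // ltnW.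
  rewrite e1 e2; have t1 : t ^+ (2 ^ N - N).-1 != 0 by apply: expf_neq0.
  move: (t ^+ N) (t ^+ (2 ^ N - N).-1) tN t1 {e1 e2} => A B hA hB.
  by field; rewrite hA hB t0.
have : Ms i (s * e ^+ N).
  rewrite key; apply: (maxSM hM) => //; apply: SM; first exact: (subringX ringS).
  exact: SM.
case/(maxS_prime hV hM Ss (subringX ringS _ Se)) => //.
elim: (N) => [|m IH]; first by rewrite expr0 => /(maxS1 hM).
by rewrite exprS => /(maxS_prime hV hM Se (subringX ringS _ Se)) [].
Qed.

(** [X] will be either a single ideal or the set of ideals that do not contain [f s s^-1]; in the
    second case [t] generates the ideal of coefficients of [J] at [s], by [uniformizer_div]. *)
Lemma uniformizer (X : 'I_r -> Prop) : exists t, S t /\ forall i,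
  (X i -> Ms i t /\ ~ ideal_sq (Ms i) t) /\ (~ X i -> ~ Ms i t).
Proof.
have [u hu] := choice maxS_neq_sq.
have Su i : S (u i) by case: (hu i) => /(maxS_sub (hMs i)).
have [|t [St ht]] := crt hV hMs dMs (a := fun i => if pselect (X i) then u i else 1).
  by move=> i; case: (pselect (X i)) => h /=; [apply: Su | apply: S1].
exists t; split=> // i; split=> h; have := ht i; case: pselect => // {}h hsq.
  have [Mu nu] := hu i; split.
    rewrite -[t](subrK (u i)); apply: (zsubD (maxS_zsub (hMs i))) => //.
    exact: (ideal_sqS (hMs i)).
  move=> nt; apply: nu; rewrite -[u i](subKr t); apply: ideal_sqD => //.
  by rewrite -mulN1r; apply: (ideal_sqMl (hMs i)) => //; apply: (zsubN zS).
move=> Mt; apply: (maxS1 (hMs i)); rewrite -[1](subKr t).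
by apply: (zsubB (maxS_zsub (hMs i))) => //; apply: (ideal_sqS (hMs i)).
Qed.

Lemma uniformizer_div (X : 'I_r -> Prop) t z :
  (S t /\ forall i, (X i -> Ms i t /\ ~ ideal_sq (Ms i) t) /\ (~ X i -> ~ Ms i t)) ->
  S z -> (forall i, X i -> Ms i z) -> S (z / t).
Proof.
move=> [St ht] Sz hz; apply: (intclos_loc hV) => M /cMs [i ->].
have [h1 h2] := ht i; case: (EM (X i)) => [Xi|nX].
  by apply: (locS_div hV hG) => //; [apply: hz | case: (h1 Xi)].
by apply: locS_divU => //; apply: h2.
Qed.

Lemma uniformizer_neq0 (X : 'I_r -> Prop) t :
  (S t /\ forall i, (X i -> Ms i t /\ ~ ideal_sq (Ms i) t) /\ (~ X i -> ~ Ms i t)) -> t != 0.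
Proof.
move=> [St ht]; have [i _] : exists i0 : 'I_r, True by have [M /cMs [i _]] := exists_maxS L hV; exists i.
apply/eqP => t0; have [h1 h2] := ht i; case: (EM (X i)) => [/h1 [_]|/h2]; rewrite t0; apply.
  by exists 0%N, (fun=> 0), (fun=> 0); rewrite big_ord0; split=> // -[].
exact: (zsub0 (maxS_zsub (hMs i))).
Qed.

End Spectrum.

(** * The crossed product and its radical *)

Lemma cpB (F : fieldType) (L : splittingFieldType F) (a b : cpT L) u : (a - b) u = a u - b u.
Proof. by rewrite !ffunE. Qed.

Section CrossedProduct.
Variables (F : fieldType) (L : splittingFieldType F) (V : F -> Prop).
Hypotheses (hV : valuation_domain V) (hG : galois 1%VS (fullv : {subfield L})).
Notation S := (@intclos F L V).
Notation gal := (gal_of (fullv : {subfield L})).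
Variable f : gal -> gal -> L.
Hypothesis hf : normalized_cocycle V f.

Implicit Types (s t u v : gal) (a b : cpT L).

Lemma cocycle_int s t : S (f s t). Proof. by case: hf => /(_ s t) []. Qed.
Lemma cocycle_neq0 s t : f s t != 0. Proof. by case: hf => /(_ s t) []. Qed.
Lemma cocycle1l s : f 1%g s = 1. Proof. by case: hf => _ _ /(_ s) []. Qed.
Lemma cocycle1r s : f s 1%g = 1. Proof. by case: hf => _ _ /(_ s) []. Qed.
Lemma cocycleE s u v : s (f u v) * f s (v * u)%g = f s u * f (u * s)%g v.
Proof. by case: hf => _ /(_ s u v). Qed.

Lemma cocycle_inv s t : f s t * f (t * s)%g (t^-1)%g = s (f t (t^-1)%g).
Proof. by rewrite -cocycleE mulVg cocycle1r mulr1. Qed.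

Lemma cocycle_inv2 s t : s (f (s^-1)%g t) * f s (t * s^-1)%g = f s (s^-1)%g.
Proof. by rewrite cocycleE mulVg cocycle1l mulr1. Qed.

Lemma cocycle_inv3 s u :
  f s u * f (u * s)%g ((u * s)^-1)%g = s (f u ((u * s)^-1)%g) * f s (s^-1)%g.
Proof. by rewrite -cocycleE invMg mulgKV. Qed.

Lemma cocycle_swap s : s (f (s^-1)%g s) = f s (s^-1)%g.
Proof. by have := cocycle_inv2 s s; rewrite mulgV cocycle1r mulr1. Qed.

Definition mono s (x : L) : cpT L := [ffun u => if u == s then x else 0].

Lemma cpmulE a b u : cpmul f a b u = \sum_s a s * s (b (u * s^-1)%g) * f s (u * s^-1)%g.
Proof. by rewrite ffunE. Qed.

Lemma mono_mulE s x b u : cpmul f (mono s x) b u = x * s (b (u * s^-1)%g) * f s (u * s^-1)%g.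
Proof.
rewrite cpmulE (bigD1 s) //= ffunE eqxx big1 ?addr0 // => t ts.
by rewrite ffunE (negPf ts) !mul0r.
Qed.

Lemma mul_monoE a t y u :
  cpmul f a (mono t y) u = a (t^-1 * u)%g * (t^-1 * u)%g y * f (t^-1 * u)%g t.
Proof.
rewrite cpmulE (bigD1 (t^-1 * u)%g) //= ffunE invMg invgK mulKVg eqxx big1 ?addr0 // => s ts.
rewrite ffunE; case: eqP => [e|_]; last by rewrite rmorph0 mulr0 mul0r.
by case/eqP: ts; rewrite -e invMg invgK mulgKV.
Qed.

Lemma emb_mulE x b u : cpmul f (cpemb x) b u = x * b u.
Proof. by rewrite mono_mulE gal1x invg1 mulg1 cocycle1l mulr1. Qed.

Lemma mul_embE a y u : cpmul f a (cpemb y) u = a u * u y.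
Proof. by rewrite mul_monoE invg1 mul1g cocycle1r mulr1. Qed.

Lemma mono_mono s x t y : cpmul f (mono s x) (mono t y) = mono (t * s)%g (x * s y * f s t).
Proof.
apply/ffunP=> u; rewrite mono_mulE !ffunE.
case: (eqVneq u (t * s)%g) => [->|ne]; first by rewrite mulgK eqxx.
case: eqP => [e|_]; last by rewrite rmorph0 mulr0 mul0r.
by case/eqP: ne; rewrite -e mulgKV.
Qed.

Lemma cpmulA : associative (cpmul f).
Proof.
move=> a b c; apply/ffunP=> u; rewrite !cpmulE.
under [RHS]eq_bigr => t _ do rewrite cpmulE !mulr_suml.
rewrite exchange_big /=; apply: eq_bigr => s _.
rewrite cpmulE rmorph_sum mulr_sumr mulr_suml (reindex_inj (mulIg s^-1)%g) /=.
apply: eq_bigr => t _; rewrite !rmorphM /= -!galMx mulgKV.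
have -> : (u * s^-1 * (t * s^-1)^-1 = u * t^-1)%g by rewrite invMg invgK mulgA mulgKV.
have := cocycleE s (t * s^-1)%g (u * t^-1)%g; rewrite mulgKV mulgA mulgKV => e.
transitivity (a s * s (b (t * s^-1)%g) * t (c (u * t^-1)%g) * (s (f (t * s^-1)%g (u * t^-1)%g) * f s (u * s^-1)%g)).
  by ring.
by rewrite e; ring.
Qed.

Lemma cpmul1l : left_id (cpone L) (cpmul f).
Proof. by move=> a; apply/ffunP=> u; rewrite emb_mulE mul1r. Qed.

Lemma cpmul1r : right_id (cpone L) (cpmul f).
Proof. by move=> a; apply/ffunP=> u; rewrite mul_embE rmorph1 mulr1. Qed.

Lemma cpmulDl : left_distributive (cpmul f) +%R.
Proof.
move=> a b c; apply/ffunP=> u; rewrite [RHS]ffunE !cpmulE -big_split; apply: eq_bigr => s _.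
by rewrite ffunE !mulrDl.
Qed.

Lemma cpmulDr : right_distributive (cpmul f) +%R.
Proof.
move=> a b c; apply/ffunP=> u; rewrite [RHS]ffunE !cpmulE -big_split; apply: eq_bigr => s _.
by rewrite ffunE rmorphD mulrDr mulrDl.
Qed.

(** The multiplication depends on [f], so the ring is packed for each cocycle rather than attached
    to [cpT L]. *)
Definition cpRing : pzRingType := HB.pack (cpT L) (GRing.Zmodule.class {ffun gal -> L})
  (GRing.Zmodule_isPzRing.Build (cpT L) cpmulA cpmul1l cpmul1r cpmulDl cpmulDr).

Let ringS : subring *%R 1 S := intclos_subring L hV.
Let zS := subring_zsub ringS.
Let S0 : S 0 := zsub0 zS.
Let S1 : S 1 := subring1 ringS.
Let SM : forall x y, S x -> S y -> S (x * y) := subringM ringS.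
Let Sg s x : S x -> S (s x). Proof. exact: intclos_gal. Qed.

Local Notation R := (@Af F L V).

Lemma Af_subring : @subring (cpT L) (cpmul f) (cpone L) R.
Proof.
split.
- by move=> s; rewrite ffunE.
- by move=> s; rewrite ffunE; case: eqP.
- by move=> a b Ra Rb s; rewrite !ffunE; apply: (zsubB zS).
- move=> a b Ra Rb s; rewrite cpmulE; apply: (zsub_sum zS) => t _.
  by apply: SM; [apply: SM => //; apply: Sg | apply: cocycle_int].
Qed.

Lemma Af_mono s x : S x -> R (mono s x).
Proof. by move=> Sx u; rewrite ffunE; case: eqP. Qed.

Lemma Af_emb x : S x -> R (cpemb x).
Proof. exact: Af_mono. Qed.

Lemma mono_sum a : a = \sum_s mono s (a s).
Proof.
apply/ffunP=> u; rewrite sum_ffunE (bigD1 u) //= ffunE eqxx big1 ?addr0 // => s su.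
by rewrite ffunE eq_sym (negPf su).
Qed.

Section AtMaximalIdeal.
Variables (M : L -> Prop) (hM : maxS V M).
(* [f s _] divides [f s s^-1]. *)
Lemma cocycle_divl s v : M (f s v) -> M (f s (s^-1)%g).
Proof.
move=> Mf; rewrite -(cocycle_inv2 s (v * s)%g) mulgK; apply: (maxSM hM) => //.
by apply: Sg; apply: cocycle_int.
Qed.

(** Call [s] trivial at [M] when [f s s^-1] is outside [M]. In a product [x_s x_u] the second factor
    is read at the ideal [x |-> M (s x)]. This lemma and the next say that, if [f s u] is outside
    [M] and the product is trivial at [M], both factors are trivial; [cocycle_trivialM] composes
    trivial elements. *)
Lemma cocycle_trivial_r s u : ~ M (f (u * s)%g ((u * s)^-1)%g) -> ~ M (f s u) ->
  ~ M (s (f u (u^-1)%g)).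
Proof.
move=> n1 n2; rewrite -cocycle_inv => /(maxS_prime hV hM) [] //; try exact: cocycle_int.
by move/cocycle_divl.
Qed.

Lemma cocycle_trivial_l s u : ~ M (f (u * s)%g ((u * s)^-1)%g) -> ~ M (f s u) ->
  ~ M (f s (s^-1)%g).
Proof.
move=> n1 n2 Mf.
have : M (f s u * f (u * s)%g ((u * s)^-1)%g).
  by rewrite cocycle_inv3; apply: (maxSM hM) => //; apply: Sg; apply: cocycle_int.
by case/(maxS_prime hV hM) => //; apply: cocycle_int.
Qed.

Lemma cocycle_trivialM s u : ~ M (f s (s^-1)%g) -> ~ M (s (f u (u^-1)%g)) ->
  ~ M (f (u * s)%g ((u * s)^-1)%g).
Proof.
move=> n1 n2 Mf.
have : M (f s u * f (u * s)%g ((u * s)^-1)%g).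
  by apply: (maxSM hM) => //; apply: cocycle_int.
rewrite cocycle_inv3; case/(maxS_prime hV hM) => //; try by [apply: cocycle_int | apply: Sg; apply: cocycle_int].
move=> h; apply: n2; rewrite -(cocycle_inv2 u ((u * s)^-1 * u)%g) mulgK rmorphM.
by apply: (maxSM hM) => //; do 2?apply: Sg; apply: cocycle_int.
Qed.

End AtMaximalIdeal.

Definition radical_ideal a := forall s, S (a s) /\
  forall M, maxS V M -> ~ M (f s (s^-1)%g) -> M (a s).
Local Notation J := radical_ideal.

Lemma radical_idealMl a b : R a -> J b -> J (cpmul f a b).
Proof.
move=> Ra Jb u; have Sb s : S (b s) by case: (Jb s).
have St s : S (a s * s (b (u * s^-1)%g) * f s (u * s^-1)%g).
  by apply: SM; [apply: SM => //; apply: Sg | apply: cocycle_int].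
rewrite cpmulE; split; first exact: (zsub_sum zS).
move=> M hM nt; apply: (zsub_sum (maxS_zsub hM)) => s _.
case: (EM (M (f s (u * s^-1)%g))) => [Mf|nf].
  by apply: (maxSM hM) => //; apply: SM => //; apply: Sg.
apply: (maxSMr hM); first exact: cocycle_int.
apply: (maxSM hM) => //; have [_ h] := Jb (u * s^-1)%g.
apply: (h _ (maxS_gal hV s hM)); apply: (cocycle_trivial_r hM) => //.
by rewrite mulgKV.
Qed.

Lemma radical_idealMr a b : J a -> R b -> J (cpmul f a b).
Proof.
move=> Ja Rb u; have Sa s : S (a s) by case: (Ja s).
have St s : S (a s * s (b (u * s^-1)%g) * f s (u * s^-1)%g).
  by apply: SM; [apply: SM => //; apply: Sg | apply: cocycle_int].
rewrite cpmulE; split; first exact: (zsub_sum zS).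
move=> M hM nt; apply: (zsub_sum (maxS_zsub hM)) => s _.
case: (EM (M (f s (u * s^-1)%g))) => [Mf|nf].
  by apply: (maxSM hM) => //; apply: SM => //; apply: Sg.
apply: (maxSMr hM); first exact: cocycle_int.
apply: (maxSMr hM); first exact: Sg.
have [_ h] := Ja s; apply: h => //; apply: (cocycle_trivial_l hM (u := (u * s^-1)%g)) => //.
by rewrite mulgKV.
Qed.

Lemma radical_ideal_left : @left_ideal (cpT L) (cpmul f) R J.
Proof.
split.
- by move=> a Ja s; case: (Ja s).
- by move=> s; rewrite ffunE; split=> // M hM _; apply: (zsub0 (maxS_zsub hM)).
- move=> a b Ja Jb s; have [Sa ha] := Ja s; have [Sb hb] := Jb s; rewrite !ffunE.
  split; first exact: (zsubB zS).
  by move=> M hM nt; apply: (zsubB (maxS_zsub hM)); [apply: ha | apply: hb].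
- exact: radical_idealMl.
Qed.

Lemma radical_ideal_small a : (forall s M, maxS V M -> M (a s)) -> J a.
Proof.
by move=> h s; split=> [|M hM _]; [have [M hM] := exists_maxS L hV; apply: (maxS_sub hM (h s M hM)) | apply: h].
Qed.

End CrossedProduct.

(** * Semisimplicity of the crossed product modulo [J] *)

Section SemisimpleQuotient.
Variables (F : fieldType) (L : splittingFieldType F) (V : F -> Prop).
Hypotheses (hV : valuation_domain V) (hG : galois 1%VS (fullv : {subfield L})).
Notation S := (@intclos F L V).
Notation gal := (gal_of (fullv : {subfield L})).
Variables (r : nat) (Ms : 'I_r -> L -> Prop).
Hypotheses (hs : spectrum V Ms) (htr : trace_units V Ms).

Let ringS : subring *%R 1 S := intclos_subring L hV.
Let zS := subring_zsub ringS.
Let S0 : S 0 := zsub0 zS.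
Let S1 : S 1 := subring1 ringS.
Let SM : forall x y, S x -> S y -> S (x * y) := subringM ringS.
Let Sg (s : gal) x : S x -> S (s x). Proof. exact: intclos_gal. Qed.
Let hMs : forall i, maxS V (Ms i). Proof. by case: hs. Qed.
Let zM i := maxS_zsub (hMs i).
Let dMs : forall i j, i != j -> ~ (forall x, Ms i x <-> Ms j x). Proof. by case: hs. Qed.
Let cMs : forall M, maxS V M -> exists i, M = Ms i. Proof. by case: hs. Qed.

Definition jacS (x : L) := S x /\ forall i, Ms i x.

Lemma jacS_left_ideal : left_ideal *%R S jacS.
Proof.
split.
- by move=> x [].
- by split=> // i; apply: (zsub0 (zM i)).
- by move=> x y [Sx hx] [Sy hy]; split; [apply: (zsubB zS) | move=> i; apply: (zsubB (zM i))].
- by move=> x y Sx [Sy hy]; split; [apply: SM | move=> i; apply: (maxSM (hMs i))].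
Qed.

Lemma intclos_semisimple : semisimple_mod S jacS.
Proof.
move=> I hI; have zI := left_ideal_zsub hI; have [sI _ _ mI] := hI.
have ex i : exists t, I t /\ ((exists2 x, I x & ~ Ms i x) -> Ms i (1 - t)).
  case: (EM (exists2 x, I x & ~ Ms i x)) => [[x Ix nMx]|no]; last first.
    by exists 0; split=> //; apply: (zsub0 zI).
  have [y [Sy My]] := maxS_inv hV (hMs i) (sI _ Ix) nMx.
  by exists (y * x); split=> //; apply: mI.
have [t ht] := choice ex.
have [e he] := crt_idempotents hV hMs dMs.
exists (\sum_i e i * t i); split.
  by apply: (zsub_sum zI) => i _; apply: mI; [case: (he i) | case: (ht i)].
move=> x Ix; have Sx := sI _ Ix.
have St i : S (t i) by apply: sI; case: (ht i).
have Se i : S (e i) by case: (he i).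
split; first by apply: (zsubB zS) => //; apply: SM => //; apply: (zsub_sum zS) => i _; apply: SM.
move=> i; case: (EM (Ms i x)) => [Mx|nMx].
  apply: (zsubB (zM i)) => //; apply: (maxSMr (hMs i)) => //.
  by apply: (zsub_sum zS) => j _; apply: SM.
rewrite -{1}[x]mulr1 -mulrBr; apply: (maxSM (hMs i)) => //.
rewrite (bigD1 i) //= (_ : 1 - _ = (1 - t i) + t i * (1 - e i) - \sum_(j | j != i) e j * t j); last by ring.
apply: (zsubB (zM i)).
  apply: (zsubD (zM i)); first by case: (ht i) => _; apply; exists x.
  by apply: (maxSM (hMs i)) => //; apply: (ideal_sqS (hMs i)); case: (he i).
apply: (zsub_sum (zM i)) => j ji; apply: (maxSMr (hMs i)) => //.
by apply: (ideal_sqS (hMs i)); case: (he j) => _ _; apply; rewrite eq_sym.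
Qed.

(** The linear half of a Maschke argument: over [S] and modulo [J(S)], the map
    [a |-> \sum_w a_w k_w] retracts [A_f] onto [T]. *)
Lemma linear_retraction (T : cpT L -> Prop) : zsub T ->
  (forall a s, T a -> S (a s)) -> (forall x a, S x -> T a -> T [ffun s => x * a s]) ->
  exists k : gal -> cpT L, (forall w, T (k w)) /\
    forall a, T a -> forall u i, Ms i (a u - \sum_w a w * k w u).
Proof.
move=> zT ST mT; pose n := #|{: gal}|.
pose row (a : cpT L) : 'rV[L]_n := \row_i a (enum_val i).
pose K (x : 'rV[L]_n) := exists a, T a /\ x = row a.
have [||k [Kk hk]] := semisimple_mod_rows jacS_left_ideal (K := K) intclos_semisimple.
- split; [split|].
  + by exists 0; split; [apply: (zsub0 zT) | apply/rowP=> i; rewrite !mxE ffunE].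
  + move=> _ _ [a [Ta ->]] [b [Tb ->]]; exists (a - b); split; first exact: (zsubB zT).
    by apply/rowP=> i; rewrite !mxE !ffunE.
  + move=> x _ Sx [a [Ta ->]]; exists [ffun s => x * a s]; split; first exact: mT.
    by apply/rowP=> i; rewrite !mxE ffunE.
- by move=> _ i [a [Ta ->]]; rewrite mxE; apply: ST.
have [l hl] := choice Kk.
exists (fun w => l (enum_rank w)); split; first by move=> w; case: (hl (enum_rank w)).
move=> a Ta u i; have [_ /(_ i)] := hk (row a) (ex_intro _ a (conj Ta erefl)) (enum_rank u).
rewrite !mxE enum_rankK (reindex_onto enum_rank enum_val) /=; last by move=> j _; rewrite enum_valK.
rewrite (eq_bigl xpredT) => [|w]; last by rewrite enum_rankK eqxx.
congr (Ms i (_ - _)); apply: eq_bigr => w _; rewrite mxE enum_rankK.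
by case: (hl (enum_rank w)) => _ /rowP/(_ (enum_rank u)); rewrite !mxE enum_rankK => ->.
Qed.

(** Transitivity of the trace: sum an element of trace [1] for the whole group over representatives
    of the left cosets of [H]. *)
Lemma trace_one_subgroup (H : {group gal}) : exists c, S c /\ \sum_(s in H) s c = 1.
Proof.
have [i0 _] : exists i0 : 'I_r, True by have [M /cMs [i _]] := exists_maxS L hV; exists i.
have [c [Sc _ trc]] := htr i0.
exists (\sum_(C in lcosets H [set: gal]) repr C c); split.
  by apply: (zsub_sum zS) => C _; apply: Sg.
under eq_bigr => s _ do rewrite rmorph_sum.
rewrite exchange_big /= -trc.
rewrite (partition_big (fun g => g *: H)%g (fun C => C \in lcosets H [set: gal])) /=; last first.
  by move=> g _; apply/lcosetsP; exists g; rewrite ?inE.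
apply: eq_bigr => C /lcosetsP [g _ ->].
rewrite [RHS](eq_bigl (fun s => s \in repr (g *: H)%g *: H)%g); last first.
  move=> s; have /lcoset_eqP -> : repr (g *: H)%g \in (g *: H)%g by apply: mem_repr (lcoset_refl H g).
  by apply/eqP/idP => [<-|/lcoset_eqP]; first exact: lcoset_refl.
rewrite [RHS](reindex_inj (mulgI (repr (g *: H)%g))) /=; apply: eq_big => [s|s _].
  by rewrite mem_lcoset mulKg.
by rewrite galMx.
Qed.

Variable f : gal -> gal -> L.
Hypothesis hf : normalized_cocycle V f.
Let Sf s t : S (f s t) := cocycle_int hf s t.

Definition trivial_at i (s : gal) := ~ Ms i (f s (s^-1)%g).

Let trivial_comp i j (s u : gal) : (forall x, Ms j x <-> Ms i (s x)) ->
  trivial_at i s -> trivial_at j u -> trivial_at i (u * s)%g.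
Proof. by move=> e ti tj; apply: (cocycle_trivialM hV hf (hMs i) ti); move/e. Qed.

Let trivial_inv i j (s : gal) : (forall x, Ms j x <-> Ms i (s x)) ->
  trivial_at i s -> trivial_at j (s^-1)%g.
Proof. by move=> e ti /e; rewrite invgK (cocycle_swap hf). Qed.

Let linked i j := exists s : gal, trivial_at i s /\ forall x, Ms j x <-> Ms i (s x).

Let linked_sym i j : linked i j -> linked j i.
Proof.
move=> [s [ti e]]; exists (s^-1)%g; split; first exact: trivial_inv e ti.
by move=> x; rewrite e galVKx.
Qed.

Let linked_trans i j k : linked i j -> linked j k -> linked i k.
Proof.
move=> [s [ti e]] [u [tj e']]; exists (u * s)%g; split; first exact: trivial_comp ti tj.
by move=> x; rewrite e' e galMx.
Qed.

Let trivial1 i : trivial_at i 1%g.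
Proof. by rewrite /trivial_at (cocycle1l hf); apply: (maxS1 (hMs i)). Qed.

Let linked_refl i : linked i i.
Proof. by exists 1%g; split=> // x; rewrite gal1x. Qed.

(* The pairs [(s, M)] with [f s s^-1] outside [M] form a groupoid on the maximal ideals:
   [c] is concentrated on one representative of each connected component. *)
Lemma groupoid_trace : exists c, S c /\
  forall i, Ms i (\sum_(s : gal | `[< trivial_at i s >]) s c - 1).
Proof.
(* A canonical representative of the component of [i]; the default is never reached, as [i] is
   linked to itself. *)
pose rep i := odflt i [pick j | `[< linked i j >]].
have repP i : linked i (rep i).
  by rewrite /rep; case: pickP => [j /asboolP //|]; rewrite /= => _; apply: linked_refl.
have rep_eq i j : linked i j -> rep i = rep j.
  move=> lij; rewrite /rep (eq_pick (Q := fun k => `[< linked j k >])); last first.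
    move=> k /=; apply/asboolP/asboolP => h; last exact: linked_trans lij h.
    exact: linked_trans (linked_sym lij) h.
  by case: pickP => // /(_ j) /asboolP; case; apply: linked_refl.
pose H j := [set s : gal | `[< trivial_at j s /\ forall x, Ms j x <-> Ms j (s x) >]].
have Hgroup j : group_set (H j).
  apply/group_setP; split; first by rewrite inE; apply/asboolP; split=> // x; rewrite gal1x.
  move=> s t; rewrite !inE => /asboolP [ts es] /asboolP [tt et]; apply/asboolP.
  by split; [apply: trivial_comp et tt ts | move=> x; rewrite galMx -et].
have [d hd] := choice (fun j => trace_one_subgroup (Group (Hgroup j))).
(* At a representative [j], [c] reduces to an element of trace [1] for the vertex group [H j],
   elsewhere to [0]; the automorphisms trivial at [i] with target [j] form the coset [H j tau]. *)
have [|c [Sc hc]] := crt hV hMs dMs (a := fun j => if rep j == j then d j else 0).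
  by move=> j; case: eqP => // _; case: (hd j).
exists c; split=> // i; set j := rep i.
have [tau [ttau etau]] := repP i.
have rj : rep j = j by rewrite /j -(rep_eq i (rep i)) //; apply: repP.
have [g hg] := choice (fun s : gal => cMs (maxS_gal hV s (hMs i))).
have hg' s x : Ms (g s) x <-> Ms i (s x) by rewrite -hg.
pose a k := if rep k == k then d k else 0.
have Sa k : S (a k) by rewrite /a; case: eqP => // _; case: (hd k).
have e : \sum_(s : gal | `[< trivial_at i s >]) s (a (g s)) = 1.
  rewrite (bigID (fun s => g s == j)) /= [X in _ + X]big1 ?addr0; last first.
    move=> s /andP[/asboolP ts gsj]; rewrite /a ifN ?rmorph0 //.
    have l : linked i (g s) by exists s; split=> // x; apply: hg'.
    by rewrite -(rep_eq _ _ l) eq_sym.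
  rewrite -(rmorph1 tau) -(proj2 (hd j)) rmorph_sum (reindex_inj (mulIg tau)) /=.
  apply: eq_big => [s|s].
    rewrite inE; apply/andP/asboolP.
      move=> [/asboolP t1 /eqP e1].
      have es x : Ms j x <-> Ms j (s x) by rewrite -{1}e1 hg' galMx etau.
      split=> //; have -> : s = ((s * tau) * tau^-1)%g by rewrite mulgK.
      apply: (trivial_comp (i := j) (j := i)) => //; last exact: trivial_inv etau ttau.
      by move=> x; rewrite etau galVKx.
    move=> [t1 e1]; split; first by apply/asboolP; apply: trivial_comp etau ttau t1.
    apply/eqP; apply: contrapT => /eqP /dMs; apply=> x.
    by rewrite hg' galMx -etau -e1.
  by move=> /andP[_ /eqP ->]; rewrite galMx /a rj eqxx.
rewrite -e -sumrB; apply: (zsub_sum (zM i)) => s _.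
by rewrite -rmorphB; apply/hg'; apply: (ideal_sqS (hMs _)); apply: hc.
Qed.

Lemma local_inverses : exists h : gal -> L, forall s,
  S (h s) /\ forall i, trivial_at i s -> Ms i (h s * f s (s^-1)%g - 1).
Proof.
suff exh s : exists x, S x /\ forall i, trivial_at i s -> Ms i (x * f s (s^-1)%g - 1).
  by have [h hh] := choice exh; exists h.
have ex i : exists y, S y /\ (trivial_at i s -> Ms i (1 - y * f s (s^-1)%g)).
  case: (EM (trivial_at i s)) => [ti|nt]; last by exists 0; split.
  by have [y [Sy My]] := maxS_inv hV (hMs i) (Sf _ _) ti; exists y.
have [y hy] := choice ex.
have [|x [Sx hx]] := crt hV hMs dMs (a := y); first by move=> i; case: (hy i).
exists x; split=> // i ti; have [_ /(_ ti) My] := hy i.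
rewrite (_ : _ - 1 = (x - y i) * f s (s^-1)%g - (1 - y i * f s (s^-1)%g)); last by ring.
apply: (zsubB (zM i)) => //; apply: (maxSMr (hMs i)) => //.
exact: (ideal_sqS (hMs i)).
Qed.

Local Notation R := (@Af F L V).
Local Notation J := (radical_ideal V f).

Lemma radical_ideal_spectrum (a : cpT L) : (forall s, S (a s)) ->
  (forall i s, trivial_at i s -> Ms i (a s)) -> J a.
Proof. by move=> Sa h s; split=> // M /cMs [i ->]; apply: h. Qed.

Section Idempotent.
Variables (k : gal -> cpT L) (h : gal -> L) (c : L).
Hypotheses (Sk : forall w u, S (k w u))
  (k_nt : forall i w u, Ms i (f w (w^-1)%g) -> trivial_at i u -> Ms i (k w u))
  (hh : forall s, S (h s) /\ forall i, trivial_at i s -> Ms i (h s * f s (s^-1)%g - 1))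
  (Sc : S c).

Let e : cpT L := \sum_(s : gal) cpmul f (mono s (h s * s c)) (k (s^-1)%g).
Let ret (a : cpT L) : cpT L := [ffun u => \sum_w a w * k w u].
Let Phi (a : cpT L) : cpT L :=
  \sum_(s : gal) cpmul f (mono s (h s * s c)) (ret (cpmul f (mono (s^-1)%g 1) a)).

Let eE a u : cpmul f a e u = \sum_(t : gal) \sum_(s : gal)
  a t * s c * t (h (s * t^-1)%g) * f t (s * t^-1)%g * s (k (t * s^-1)%g (u * s^-1)%g) * f s (u * s^-1)%g.
Proof.
rewrite cpmulE; apply: eq_bigr => t _.
rewrite sum_ffunE rmorph_sum mulr_sumr mulr_suml (reindex_inj (mulIg t^-1)%g) /=.
apply: eq_bigr => s _; rewrite mono_mulE.
have -> : (u * t^-1 * (s * t^-1)^-1 = u * s^-1)%g by rewrite invMg invgK mulgA mulgKV.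
have -> : ((s * t^-1)^-1 = t * s^-1)%g by rewrite invMg invgK.
rewrite !rmorphM /= -!galMx mulgKV.
have := cocycleE hf t (s * t^-1)%g (u * s^-1)%g; rewrite mulgKV mulgA mulgKV => e0.
transitivity (a t * s c * t (h (s * t^-1)%g) * s (k (t * s^-1)%g (u * s^-1)%g) *
  (t (f (s * t^-1)%g (u * s^-1)%g) * f t (u * t^-1)%g)); first by ring.
by rewrite e0; ring.
Qed.

Let PhiE a u : Phi a u = \sum_(t : gal) \sum_(s : gal)
  a t * s c * h s * s (f (s^-1)%g t) * s (k (t * s^-1)%g (u * s^-1)%g) * f s (u * s^-1)%g.
Proof.
rewrite sum_ffunE exchange_big; apply: eq_bigr => s _.
rewrite mono_mulE ffunE rmorph_sum mulr_sumr mulr_suml (reindex_inj (mulIg s^-1)%g) /=.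
apply: eq_bigr => t _; rewrite mono_mulE mul1r invgK mulgKV !rmorphM /= galVKx.
by ring.
Qed.

(** [Phi] averages the retraction [ret] over the groupoid, and [e] is [Phi] of the unit; so the
    lemma says that [Phi] is left linear modulo [J]. The coefficients differ by multiples of
    [t (h q) f(t, q) - h s s(f(s^-1, t))] with [q = s * t^-1]. When multiplied by [f s w] both terms
    become congruent to [1] where [s], [t] and [w] are trivial; [k_nt] handles the case of [w] not
    trivial. *)
Lemma idempotent_Phi a : R a -> J (cpmul f a e - Phi a).
Proof.
move=> Ra.
have dE u : (cpmul f a e - Phi a) u = \sum_(t : gal) \sum_(s : gal) a t * s c *
    (t (h (s * t^-1)%g) * f t (s * t^-1)%g - h s * s (f (s^-1)%g t)) *
    (s (k (t * s^-1)%g (u * s^-1)%g) * f s (u * s^-1)%g).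
  rewrite cpB eE PhiE -sumrB; apply: eq_bigr => t _.
  by rewrite -sumrB; apply: eq_bigr => s _; ring.
have Sh s : S (h s) by case: (hh s).
have Sd (t s : gal) : S (t (h (s * t^-1)%g) * f t (s * t^-1)%g - h s * s (f (s^-1)%g t)).
  by apply: (zsubB zS); apply: SM => //; apply: Sg.
apply: radical_ideal_spectrum => [u|i u tu]; rewrite dE.
  apply: (zsub_sum zS) => t _; apply: (zsub_sum zS) => s _.
  apply: SM; first by apply: SM => //; apply: SM => //; apply: Sg.
  by apply: SM => //; apply: Sg.
apply: (zsub_sum (zM i)) => t _; apply: (zsub_sum (zM i)) => s _.
set v := (u * s^-1)%g; have uE : u = (v * s)%g by rewrite /v mulgKV.
case: (EM (Ms i (f s v))) => [Mf|nf].
  apply: (maxSM (hMs i)); first by apply: SM => //; apply: SM => //; apply: Sg.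
  by apply: (maxSM (hMs i)) => //; apply: Sg.
rewrite uE in tu.
have ts := cocycle_trivial_l hV hf (hMs i) tu nf.
have tv := cocycle_trivial_r hV hf (hMs i) tu nf.
set w := (t * s^-1)%g.
case: (EM (Ms i (s (f w (w^-1)%g)))) => [Mw|nw].
  apply: (maxSM (hMs i)); first by apply: SM => //; apply: SM => //; apply: Sg.
  apply: (maxSMr (hMs i)) => //; have [j ej] := cMs (maxS_gal hV s (hMs i)).
  have ej' x : Ms j x <-> Ms i (s x) by rewrite -ej.
  by apply/ej'; apply: k_nt; [apply/ej' | move=> /ej'].
apply: (maxSMr (hMs i)); first by apply: SM => //; apply: Sg.
apply: (maxSM (hMs i)); first by apply: SM => //; apply: Sg.
have tE : t = (w * s)%g by rewrite /w mulgKV.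
have tt : trivial_at i t by rewrite /trivial_at tE; apply: (cocycle_trivialM hV hf (hMs i)).
set A := f s w; set q := (s * t^-1)%g.
have nA : ~ Ms i A.
  move=> MA; have : Ms i (f s w * f (w * s)%g (w^-1)%g) by apply: (maxSMr (hMs i)).
  by rewrite (cocycle_inv hf).
have wV : (w^-1 = q)%g by rewrite /w /q invMg invgK.
have e1 : s (f (s^-1)%g t) * A = f s (s^-1)%g by exact: (cocycle_inv2 hf).
have e2 : t (f q (q^-1)%g) = f t q * A.
  by rewrite -(cocycle_inv hf) /A /q mulgKV invMg invgK.
have tq : ~ Ms i (t (f q (q^-1)%g)).
  rewrite e2 => /(maxS_prime hV (hMs i) (Sf t q) (Sf s w)) [] //.
  by move=> h1; apply: tt; apply: (cocycle_divl hf (hMs i) h1).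
have [j ej] := cMs (maxS_gal hV t (hMs i)).
have ej' x : Ms j x <-> Ms i (t x) by rewrite -ej.
have h1 : Ms i (h s * f s (s^-1)%g - 1) by case: (hh s) => _; apply.
have h2 : Ms i (t (h q) * t (f q (q^-1)%g) - 1).
  rewrite -rmorphM -(rmorph1 t) -rmorphB; apply/ej'.
  by case: (hh q) => _; apply; move=> /ej'.
have : Ms i (A * (t (h q) * f t q - h s * s (f (s^-1)%g t))).
  rewrite (_ : A * _ = (t (h q) * (f t q * A) - 1) - (h s * (s (f (s^-1)%g t) * A) - 1)); last by ring.
  by rewrite e1 -e2; apply: (zsubB (zM i)).
by case/(maxS_prime hV (hMs i) (Sf s w) (Sd t s)).
Qed.
End Idempotent.

(** Maschke: the averaged retraction is right multiplication by [e] modulo [J], and is congruent to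
    the identity on [T]. *)
Lemma Af_semisimple : @semisimple_mod (cpRing hf) R J.
Proof.
move=> I hI.
have ringR : @subring (cpRing hf) *%R 1 R := Af_subring hV hf.
have hJ : @left_ideal (cpRing hf) *%R R J := radical_ideal_left hV hf.
have hT := @left_idealD (cpRing hf) R ringR I J hI hJ.
(* [J] is added to [I] so that the retraction respects it, which is [k_nt]; the element [e] found in
   [T] is corrected by an element of [J] at the end. *)
set T := (fun x => _) in hT.
have zT : @zsub (cpT L) T := left_ideal_zsub hT.
have TR a : T a -> R a by case: hT => + _ _ _; apply.
have mT a b : R a -> T b -> T (cpmul f a b) by case: hT => _ _ _; apply.
have JT a : J a -> T a.
  by exists 0, a; rewrite add0r; split=> //; case: hI.
have mT' x a : S x -> T a -> T [ffun s => x * a s].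
  move=> Sx Ta; rewrite (_ : [ffun s => _] = cpmul f (cpemb x) a); first exact: mT (Af_emb hV Sx) Ta.
  by apply/ffunP=> s; rewrite (emb_mulE hf) // ffunE.
have [k [Tk hk]] := linear_retraction zT (fun a s Ta => TR a Ta s) mT'.
have [h hh] := local_inverses.
have [c [Sc hc]] := groupoid_trace.
have Sk w u : S (k w u) by apply: TR.
have Sh s : S (h s) by case: (hh s).
have k_nt i w u : Ms i (f w (w^-1)%g) -> trivial_at i u -> Ms i (k w u).
  (* [y x_w] lies in [J], hence in [T], and is fixed by the retraction modulo [J(S)]; its
     coefficient at [u] being zero, [y k_w(u)] lies in [Ms i]. *)
  move=> Mw tu; have [y [Sy ny hy]] := separate hV hs i.
  have Jm : J (mono w y).
    move=> s; rewrite ffunE; case: eqP => [->|_]; last first.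
      by split=> // M hM _; apply: (zsub0 (maxS_zsub hM)).
    split=> // M /cMs [j ->] nj; apply: hy; apply/eqP => ji; apply: nj; rewrite ji.
    exact: Mw.
  have := hk _ (JT _ Jm) u i.
  rewrite (bigD1 w) //= ffunE [X in _ - (_ + X)]big1 ?addr0; last first.
    by move=> v vw; rewrite ffunE (negPf vw) mul0r.
  rewrite ffunE eqxx; case: (eqVneq u w) => [e|_]; first by case: tu; rewrite e.
  rewrite sub0r => /(zsubN (zM i)); rewrite opprK.
  by case/(maxS_prime hV (hMs i)).
pose e := \sum_(s : gal) cpmul f (mono s (h s * s c)) (k (s^-1)%g).
pose Phi (a : cpT L) : cpT L := \sum_(s : gal) cpmul f (mono s (h s * s c))
   [ffun u => \sum_w cpmul f (mono (s^-1)%g 1) a w * k w u].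
have Rm s : R (mono s (h s * s c)) by apply: (Af_mono hV); apply: SM => //; apply: Sg.
have zJ : @zsub (cpT L) J := left_ideal_zsub hJ.
have Te : T e by apply: (zsub_sum zT) => s _; apply: mT.
have key a : T a -> J (a - cpmul f a e).
  move=> Ta; have Ra := TR _ Ta.
  have -> : a - cpmul f a e = (a - Phi a) - (cpmul f a e - Phi a) by rewrite opprB addrA subrK.
  apply: (zsubB zJ); last exact: (idempotent_Phi Sk k_nt hh Sc Ra).
  have Tz s : T (cpmul f (mono (s^-1)%g 1) a) by apply: mT => //; apply: (Af_mono hV).
  (* On [T] the retraction is the identity modulo [J(S)], so [Phi a] is congruent to [d a]. By the
     choice of [h], [d] is congruent at [Ms i] to the sum of the [s c] over the [s] trivial there,
     that is to [1]. *)
  pose d := \sum_(s : gal) h s * s c * f s (s^-1)%g.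
  have Sd : S d by apply: (zsub_sum zS) => s _; apply: SM => //; apply: SM => //; apply: Sg.
  have -> : a - Phi a = cpmul f (cpemb (1 - d)) a + \sum_(s : gal) cpmul f (mono s (h s * s c))
      (cpmul f (mono (s^-1)%g 1) a - [ffun u => \sum_w cpmul f (mono (s^-1)%g 1) a w * k w u]).
    have -> : \sum_(s : gal) cpmul f (mono s (h s * s c)) (cpmul f (mono (s^-1)%g 1) a -
        [ffun u => \sum_w cpmul f (mono (s^-1)%g 1) a w * k w u]) = cpmul f (cpemb d) a - Phi a.
      rewrite /Phi -sumrN.
      have -> : cpmul f (cpemb d) a = \sum_(s : gal) cpmul f (mono s (h s * s c)) (cpmul f (mono (s^-1)%g 1) a).
        apply/ffunP=> u; rewrite (emb_mulE hf) // sum_ffunE mulr_suml; apply: eq_bigr => s _.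
        by rewrite (cpmulA hf) mono_mono mulVg rmorph1 mulr1 (emb_mulE hf).
      rewrite -big_split /=; apply: eq_bigr => s _.
      exact: (@mulrBr (cpRing hf)).
    apply/ffunP=> u; rewrite cpB [in RHS]ffunE cpB !(emb_mulE hf) //; ring.
  apply: (zsubD zJ).
    apply: (radical_ideal_small hV) => u M /cMs [i ->]; rewrite (emb_mulE hf) //.
    apply: (maxSMr (hMs i)) => //; rewrite (_ : 1 - d = - (d - 1)); last by ring.
    apply: (zsubN (zM i)).
    rewrite (_ : d - 1 = (d - \sum_(s : gal | `[< trivial_at i s >]) s c) +
      (\sum_(s : gal | `[< trivial_at i s >]) s c - 1)); last by ring.
    apply: (zsubD (zM i)) => //.
    rewrite /d (bigID (fun s => `[< trivial_at i s >])) /= addrAC -sumrB.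
    apply: (zsubD (zM i)); apply: (zsub_sum (zM i)) => s.
      move=> /asboolP ts; rewrite (_ : _ - _ = s c * (h s * f s (s^-1)%g - 1)); last by ring.
      by apply: (maxSM (hMs i)); [apply: Sg | case: (hh s) => _; apply].
    move=> /asboolP ts; apply: (maxSM (hMs i)); first by apply: SM => //; apply: Sg.
    exact: contrapT.
  apply: (zsub_sum zJ) => s _; case: hJ => _ _ _; apply; first exact: Rm.
  by apply: (radical_ideal_small hV) => u M /cMs [i ->]; rewrite cpB [X in _ - X]ffunE; apply: hk.
case: (Te) => y [z [Iy Jz e_yz]]; exists y; split=> // x Ix.
have Rx : R x by case: hI => + _ _ _; apply.
have Tx : T x by exists x, 0; rewrite addr0; split=> //; apply: (zsub0 zJ).
have -> : x - (x : cpRing hf) * y = (x - cpmul f x e) + cpmul f x z.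
  have -> : cpmul f x e = cpmul f x y + cpmul f x z.
    by rewrite e_yz; exact: (@mulrDr (cpRing hf)).
  by rewrite opprD addrA subrK.
apply: (zsubD zJ); first exact: key.
by case: hJ => _ _ _; apply.
Qed.

End SemisimpleQuotient.

(** * The Jacobson radical of [A_f] *)

Section JacobsonRadical.
Variables (F : fieldType) (L : splittingFieldType F) (V : F -> Prop).
Hypotheses (hV : valuation_domain V) (hG : galois 1%VS (fullv : {subfield L})).
Notation S := (@intclos F L V).
Notation gal := (gal_of (fullv : {subfield L})).
Variables (r : nat) (Ms : 'I_r -> L -> Prop).
Hypotheses (hs : spectrum V Ms) (htr : trace_units V Ms).

Let ringS : subring *%R 1 S := intclos_subring L hV.
Let zS := subring_zsub ringS.
Let S0 : S 0 := zsub0 zS.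
Let S1 : S 1 := subring1 ringS.
Let SM : forall x y, S x -> S y -> S (x * y) := subringM ringS.
Let Sg (s : gal) x : S x -> S (s x). Proof. exact: intclos_gal. Qed.
Let hMs : forall i, maxS V (Ms i). Proof. by case: hs. Qed.
Let zM i := maxS_zsub (hMs i).
Let cMs : forall M, maxS V M -> exists i, M = Ms i. Proof. by case: hs. Qed.

Lemma intclos_unit u : S u -> (forall i, ~ Ms i u) -> exists v, S v /\ v * u = 1.
Proof.
move=> Su nu; pose I x := exists v, S v /\ x = v * u.
suff [v [Sv e]] : I 1 by exists v.
apply: (ideal_full hV); first exact: (left_ideal_principal ringS Su).
by move=> M /cMs [i ->]; exists u; split; [exists 1; rewrite mul1r | apply: nu].
Qed.

Lemma jacS_quasi_regular x : jacS V Ms x -> exists u, S u /\ u * (1 - x) = 1.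
Proof.
move=> [Sx Jx]; apply: intclos_unit; first exact: (zsubB zS).
move=> i M1; apply: (maxS1 (hMs i)); rewrite -(subrK x 1).
exact: (zsubD (zM i)).
Qed.

Variable f : gal -> gal -> L.
Hypothesis hf : normalized_cocycle V f.
Let Sf s t : S (f s t) := cocycle_int hf s t.
Local Notation R := (@Af F L V).
Local Notation J := (radical_ideal V f).
Let ringR : @subring (cpRing hf) *%R 1 R := Af_subring hV hf.
Let zR : @zsub (cpRing hf) R := subring_zsub ringR.
Let hJ : @left_ideal (cpRing hf) *%R R J := radical_ideal_left hV hf.
(** The preorder of [Gr(f^M)] on the group itself; [t * s^-1] is the usual [s^-1 t]. *)
Definition graph_le (M : L -> Prop) (s t : gal) := ~ M (f s (t * s^-1)%g).

Lemma graph_le_trans M s t u : maxS V M -> graph_le M s t -> graph_le M t u -> graph_le M s u.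
Proof.
move=> hM st tu Msu.
have := cocycleE hf s (t * s^-1)%g (u * t^-1)%g; rewrite mulgA !mulgKV => e.
have : M (f s (t * s^-1)%g * f t (u * t^-1)%g).
  by rewrite -e; apply: (maxSM hM) => //; apply: Sg.
by case/(maxS_prime hV hM (Sf _ _) (Sf _ _)).
Qed.

Lemma graph_le_refl M s : maxS V M -> graph_le M s s.
Proof. by move=> hM; rewrite /graph_le mulgV (cocycle1r hf); apply: (maxS1 hM). Qed.

(** A numerical height, strictly increasing by [graph_rank_lt], which spares the partial order on
    classes. *)
Definition graph_rank i (s : gal) := #|[set t : gal | `[< graph_le (Ms i) t s >]]|.

Lemma graph_rank_lt i s t : graph_le (Ms i) s t -> ~ graph_le (Ms i) t s ->
  (graph_rank i s < graph_rank i t)%N.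
Proof.
move=> st nts; apply: proper_card; apply/properP; split.
  apply/subsetP => u; rewrite !inE => /asboolP us; apply/asboolP.
  exact: graph_le_trans us st.
exists t; rewrite inE; first by apply/asboolP; apply: graph_le_refl.
exact/asboolP.
Qed.

(* Multiplication by [J] climbs strictly in each graph [Gr(f^M)], hence [J] is nilpotent
   modulo [J(S) A_f]. *)
Definition graph_filtration n (a : cpT L) :=
  R a /\ forall i s, (graph_rank i s < n)%N -> Ms i (a s).

Lemma graph_filtration_mul n a b :
  graph_filtration n a -> J b -> graph_filtration n.+1 (cpmul f a b).
Proof.
move=> [Ra ha] Jb; have Rb : R b by case: hJ => + _ _ _; apply.
split; first by apply: (subringM ringR).
move=> i u; rewrite ltnS => rk; rewrite cpmulE; apply: (zsub_sum (zM i)) => s _.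
set v := (u * s^-1)%g; have uE : (v * s)%g = u by rewrite /v mulgKV.
case: (EM (Ms i (a s))) => [Ma|na].
  by apply: (maxSMr (hMs i)) => //; apply: (maxSMr (hMs i)) => //; apply: Sg.
have rs : (n <= graph_rank i s)%N by rewrite leqNgt; apply/negP => /ha.
case: (EM (Ms i (f s v))) => [Mf|nf]; first by apply: (maxSM (hMs i)) => //; apply: SM => //; apply: Sg.
case: (EM (Ms i (s (f v (v^-1)%g)))) => [Mv|nv]; last first.
  apply: (maxSMr (hMs i)) => //; apply: (maxSM (hMs i)) => //.
  by have [_ hb] := Jb v; apply: (hb _ (maxS_gal hV s (hMs i))).
have su : graph_le (Ms i) s u by [].
have nus : ~ graph_le (Ms i) u s.
  apply; move: Mv; rewrite -(cocycle_inv hf) uE.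
  have -> : (v^-1 = s * u^-1)%g by rewrite /v invMg invgK.
  by case/(maxS_prime hV (hMs i) (Sf _ _) (Sf _ _)).
by have := leq_trans (graph_rank_lt su nus) (leq_trans rk rs); rewrite ltnn.
Qed.

Let quasi_regular_small (y : cpRing hf) : (forall s i, Ms i ((y : cpT L) s)) ->
  exists u : cpRing hf, R u /\ u * (1 - y) = 1.
Proof.
move=> hy.
have Ry : R y by move=> s; have [M /cMs [i _]] := exists_maxS L hV; apply: (maxS_sub (hMs i)).
(* Nakayama over [S]: the lattice [A_f (1 - y)] contains each [x_s] up to [x_s y], whose
   coefficients are in [J(S)]; so it contains every [x_s], in particular [1]. *)
pose Q (z : {ffun gal -> L^o}) := exists v : cpRing hf, R v /\ z = v * (1 - y).
have zQ : zsub Q.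
  split; first by exists 0; rewrite mul0r; split=> //; apply: (zsub0 zR).
  by move=> _ _ [v [Rv ->]] [w [Rw ->]]; exists (v - w); rewrite mulrBl; split=> //; apply: (zsubB zR).
have embE (x : L) (a : cpT L) : x *: (a : {ffun gal -> L^o}) = cpmul f (cpemb x) a.
  by apply/ffunP=> s; rewrite ffunE (emb_mulE hf).
have mQ (x : L) z : S x -> Q z -> Q (x *: z).
  move=> Sx [v [Rv ->]]; exists (cpmul f (cpemb x) v); split.
    by apply: (subringM ringR) => //; apply: (Af_emb hV).
  by rewrite embE; exact: (cpmulA hf).
have Qk : forall i : 'I_#|{: gal}|, Q (mono (enum_val i) 1).
  apply: (nakayama (R := S) (J := jacS V Ms) ringS (jacS_left_ideal hV hs) jacS_quasi_regular zQ mQ) => i.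
  set s := enum_val i.
  exists (cpmul f (mono s 1) ((1 : cpRing hf) - y)), (fun j => cpmul f (mono s 1) y (enum_val j)); split.
  - by exists (mono s 1); split=> //; apply: (Af_mono hV).
  - move=> j; rewrite mono_mulE; split; first by apply: SM => //; apply: SM => //; apply: Sg; apply: Ry.
    move=> l; apply: (maxSMr (hMs l)) => //; apply: (maxSM (hMs l)) => //.
    by apply: (spectrum_gal hV hs).
  - have -> : cpmul f (mono s 1) ((1 : cpRing hf) - y) = mono s 1 - cpmul f (mono s 1) y.
      rewrite -[X in _ = X - _](@mulr1 (cpRing hf)); exact: (@mulrBr (cpRing hf)).
    rewrite -[LHS](subrK (cpmul f (mono s 1) y)); congr (_ + _).
    rewrite [LHS]mono_sum -(big_enum_val (fun t => cpmul f (mono s 1) y t *: (mono t 1 : {ffun gal -> L^o}))).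
    apply: eq_big => [t|t _]; first by rewrite inE.
    move: (cpmul _ _ _ t) => z; apply/ffunP=> u; rewrite !ffunE /GRing.scale /=.
    by case: eqP; rewrite ?mulr1 ?mulr0.
have [v [Rv e]] := Qk (enum_rank 1%g); exists v; split=> //.
by rewrite -e enum_rankK.
Qed.

Lemma radical_quasi_regular (j : cpRing hf) : J j -> exists u : cpRing hf, R u /\ u * (1 - j) = 1.
Proof.
move=> Jj; have Rj : R j by case: hJ => + _ _ _; apply.
have fil n : graph_filtration n (j ^+ n : cpRing hf).
  elim: n => [|n IH]; first by rewrite expr0; split=> //; apply: (subring1 ringR).
  by rewrite exprSr; apply: graph_filtration_mul.
have geo n : exists v : cpRing hf, R v /\ v * (1 - j) = 1 - j ^+ n.
  elim: n => [|n [v [Rv e]]]; first by exists 0; rewrite mul0r expr0 subrr; split=> //; apply: (zsub0 zR).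
  exists (v + j ^+ n); split; first by apply: (zsubD zR) => //; case: (fil n).
  by rewrite mulrDl e mulrBr mulr1 -exprSr addrA subrK.
(* Ranks are at most the order of the group, so one power more has all its coefficients in [J(S)]; a
   geometric series does the rest. *)
have [|w [Rw ew]] := @quasi_regular_small (j ^+ #|{: gal}|.+1).
  move=> s i; have [_] := fil #|{: gal}|.+1; apply; rewrite ltnS.
  exact: max_card.
have [v [Rv ev]] := geo #|{: gal}|.+1.
exists (w * v); split; first by apply: (subringM ringR).
by rewrite -mulrA ev.
Qed.

(** For the inclusion in [J], let [e] be a right identity modulo [J] of the Jacobson radical:
    [x (1 - e)] is in [J], and [1 - e] is invertible because [e] is in the radical. *)
Lemma jacobsonE : JAf V f = J.
Proof.
apply/funext => x; apply/propext; rewrite /JAf; split; last first.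
  apply: (@quasi_regular_jacobson (cpRing hf) R ringR J hJ); exact: radical_quasi_regular.
move=> jx.
have hjac : @left_ideal (cpRing hf) *%R R (@jacobson (cpRing hf) *%R R) := jacobson_left_ideal ringR.
have [sj _ _ mj] := hjac.
have [e [je he]] := Af_semisimple hV hs htr hjac.
have [u [Ru ue]] := jacobson_quasi_regular ringR je.
(* The left inverse [u = 1 + u e] of [1 - e] is itself left invertible, hence a two-sided
   inverse. *)
have [w [Rw wu]] : exists w : cpRing hf, R w /\ w * u = 1.
  have [w [Rw ew]] := jacobson_quasi_regular ringR (mj _ _ (zsubN zR Ru) je).
  exists w; split=> //; rewrite -[RHS]ew mulNr opprK; congr (_ * _).
  by apply/eqP; rewrite -subr_eq; apply/eqP; rewrite -[RHS]ue mulrBr mulr1.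
have e1u : (1 - e) * u = 1 :> cpRing hf.
  have -> : 1 - e = w by rewrite -[LHS]mul1r -[X in X * _]wu -mulrA ue mulr1.
  exact: wu.
have ex : (x : cpRing hf) - (x : cpRing hf) * e = (x : cpRing hf) * (1 - e) by rewrite mulrBr mulr1.
have -> : x = ((x : cpRing hf) - (x : cpRing hf) * e) * u by rewrite ex -mulrA e1u mulr1.
by apply: (radical_idealMr hV hf); [apply: he | exact: Ru].
Qed.

End JacobsonRadical.

(** * Syzygies over the Pruefer domain [S] and over [A_f] *)

Section Syzygies.
Variables (F : fieldType) (L : splittingFieldType F) (V : F -> Prop).
Hypotheses (hV : valuation_domain V) (hG : galois 1%VS (fullv : {subfield L})).
Notation S := (@intclos F L V).
Notation gal := (gal_of (fullv : {subfield L})).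

Let ringV : subring *%R 1 V. Proof. by case: hV. Qed.
Let ringS : subring *%R 1 S := intclos_subring L hV.
Let zS := subring_zsub ringS.
Let S0 : S 0 := zsub0 zS.
Let S1 : S 1 := subring1 ringS.
Let SM : forall x y, S x -> S y -> S (x * y) := subringM ringS.
Let Sg (s : gal) x : S x -> S (s x). Proof. exact: intclos_gal. Qed.

Let int_mx m n (a : 'M[L]_(m, n)) := forall i j, S (a i j).

Let int_mulmx m n p (a : 'M[L]_(m, n)) (b : 'M[L]_(n, p)) : int_mx a -> int_mx b -> int_mx (a *m b).
Proof. by move=> Sa Sb i j; rewrite mxE; apply: (zsub_sum zS) => k _; apply: SM. Qed.

(* [S] is a Pruefer domain: the fractional ideal generated by the entries of [a] is invertible. *)
Lemma fractional_invertible n (a : 'cV[L]_n) : a != 0 ->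
  exists b : 'rV[L]_n, int_mx (a *m b) /\ b *m a = 1%:M.
Proof.
move=> a0; pose I x := exists b : 'rV[L]_n, int_mx (a *m b) /\ (b *m a) 0 0 = x.
have hI : left_ideal *%R S I.
  split.
  - move=> _ [b [h <-]]; rewrite mxE; apply: (zsub_sum zS) => i _; have := h i i.
    by rewrite mxE big_ord1 mulrC.
  - by exists 0; rewrite mul0mx mulmx0 mxE; split=> // i j; rewrite mxE.
  - move=> _ _ [b [h <-]] [c [h' <-]]; exists (b - c); rewrite mulmxBl mulmxBr !mxE; split=> // i j.
    by rewrite mxE [X in _ + X]mxE; apply: (zsubB zS).
  - move=> s _ Ss [b [h <-]]; exists (s *: b); rewrite -scalemxAl -scalemxAr [in RHS]mxE; split.
      by move=> i j; rewrite mxE; apply: SM.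
    by rewrite !mxE.
suff [b [h e]] : I 1.
  by exists b; split=> //; apply/matrixP=> i j; rewrite !ord1 e mxE eqxx.
apply: (ideal_full hV hI) => M hM.
have zM := maxS_zsub hM.
have [|||||j [j0 hj]] := @valuation_least _ (locS V M) _ _ _ _ _ (fun i => a i 0).
- exact: (locS_int hV hM S0).
- exact: (locS_int hV hM S1).
- by move=> x y; apply: (locSM hV hM).
- by move=> x; apply: (locS_total hV hG hM).
- apply: contrapT => no; move/eqP: a0; apply; apply/colP => i; rewrite mxE.
  by apply/eqP; apply: contrapT => /negP ai; apply: no; exists i.
have [t ht] := choice hj.
pose s := \prod_i t i.
have St i : S (t i) by case: (ht i).
have Ss : S s by apply: (subring_prod ringS).
have ns : ~ M s.
  by case/(maxS_prod hV hM St) => i; case: (ht i).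
exists s; split=> //; exists (\row_i (if i == j then s / a j 0 else 0)); split.
  move=> i k; rewrite mxE big_ord1 mxE; case: eqP => _; last by rewrite mulr0.
  rewrite /s (bigD1 i) //= mulrCA mulrAC mulrC; rewrite mulrA mulrAC.
  rewrite (_ : _ * _ = (t i * (a i 0 / a j 0)) * \prod_(l | l != i) t l); last by ring.
  apply: SM; first by case: (ht i).
  by apply: (subring_prod ringS).
rewrite mxE (bigD1 j) //= mxE eqxx divfK // big1 ?addr0 // => i ij.
by rewrite mxE (negPf ij) mul0r.
Qed.

(** When [b a = 1] and [a b] is integral, [1 - a b] is an integral projector onto the relations of
    [a]. *)
Lemma syzygies1 n (a : 'cV[L]_n) : exists k : 'M[L]_n,
  [/\ int_mx k, k *m a = 0 & forall x : 'rV[L]_n, x *m a = 0 -> x = x *m k].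
Proof.
have [->|/fractional_invertible [b [Sab ba]]] := eqVneq a 0.
  exists 1%:M; rewrite mulmx0; split=> // [i j|x _]; last by rewrite mulmx1.
  by rewrite mxE; case: eqP.
exists (1%:M - a *m b); split.
- by move=> i j; rewrite mxE [X in _ + X]mxE mxE; apply: (zsubB zS) => //; case: eqP.
- by rewrite mulmxBl mul1mx -mulmxA ba mulmx1 subrr.
- by move=> x xa; rewrite mulmxBr mulmx1 mulmxA xa mul0mx subr0.
Qed.

(** Coherence of [S], one column at a time: the relations of the first column are the image of an
    integral projector, which is substituted in the remaining columns. *)
Lemma syzygies q n (a : 'M[L]_(n, q)) : exists m (k : 'M[L]_(m, n)),
  [/\ int_mx k, k *m a = 0 &
   forall x : 'rV[L]_n, int_mx x -> x *m a = 0 -> exists c : 'rV[L]_m, int_mx c /\ x = c *m k].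
Proof.
elim: q n a => [|q IH] n a.
  exists n, 1%:M; split.
  - by move=> i j; rewrite mxE; case: eqP.
  - by apply/matrixP=> i [].
  - by move=> x Sx _; exists x; rewrite mulmx1.
rewrite -[q.+1]/(1 + q)%N in a *.
have [k1 [Sk1 k1a hk1]] := syzygies1 (lsubmx a).
have [m [k2 [Sk2 k2a hk2]]] := IH _ (k1 *m rsubmx a).
exists m, (k2 *m k1); split.
- exact: int_mulmx.
- by rewrite -[a]hsubmxK mul_mx_row -!mulmxA k1a mulmx0 k2a row_mx0.
- move=> x Sx; rewrite -[a]hsubmxK mul_mx_row => /eqP; rewrite row_mx_eq0 => /andP[/eqP xl /eqP xr].
  have ex := hk1 x xl.
  have [|c [Sc ec]] := hk2 x Sx; first by rewrite mulmxA -ex.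
  by exists c; rewrite mulmxA -ec.
Qed.

Lemma intclos_denominators (I : finType) (x : I -> L) :
  exists a, [/\ V a, a != 0 & forall i, S (a%:A * x i)].
Proof.
have [a ha] := choice (fun i => intclos_denom hV hG (x i)).
exists (\prod_i a i); split.
- by apply: (subring_prod ringV) => i _; case: (ha i).
- by apply/prodf_neq0 => i _; case: (ha i).
- move=> i; rewrite (bigD1 i) //= -[(_ * _)%:A]/(in_alg L _) rmorphM /= mulrAC.
  apply: SM; first by case: (ha i).
  by apply: (intclos_alg L hV); apply: (subring_prod ringV) => j _; case: (ha j).
Qed.

Variable f : gal -> gal -> L.
Hypothesis hf : normalized_cocycle V f.
Local Notation R := (@Af F L V).
Local Notation A := (cpRing hf).
Section Coordinates.
Variable n : nat.
Local Notation N := #|{: 'I_n * gal}|.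

Definition coords (x : 'rV[A]_n) : 'rV[L]_N :=
  \row_p (x 0 (enum_val p).1 : cpT L) (enum_val p).2.

Definition coord_basis (p : 'I_N) : 'rV[A]_n :=
  (mono (enum_val p).2 1 : A) *: delta_mx 0 (enum_val p).1.

Definition coord_comb m (c : 'rV[L]_m) (y : 'I_m -> 'rV[A]_n) : 'rV[A]_n :=
  \sum_l (cpemb (c 0 l) : A) *: y l.

Lemma coords_comb m (c : 'rV[L]_m) (y : 'I_m -> 'rV[A]_n) :
  coords (coord_comb c y) = c *m (\matrix_(l < m) coords (y l)).
Proof.
apply/rowP=> p; rewrite !mxE summxE sum_ffunE; apply: eq_bigr => l _.
by rewrite !mxE; exact: (emb_mulE hf).
Qed.

Lemma coords_inj x y : coords x = coords y -> x = y.
Proof.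
move=> e; apply/rowP=> i; apply/ffunP=> s.
by have /rowP/(_ (enum_rank (i, s))) := e; rewrite !mxE enum_rankK.
Qed.

Lemma coords0 : coords 0 = 0.
Proof. by apply/rowP=> p; rewrite !mxE ffunE. Qed.

Lemma coord_combE (x : 'rV[A]_n) : x = coord_comb (coords x) coord_basis.
Proof.
apply: coords_inj; rewrite coords_comb; apply/rowP=> p; rewrite [RHS]mxE (bigD1 p) //=.
rewrite big1 ?addr0 => [|q qp].
  rewrite !mxE !eqxx /= mulr1; case: (enum_val p) => i s /=.
  by rewrite ffunE eqxx mulr1.
rewrite !mxE /=; case: eqP => /= [e1|_].
  rewrite mulr1 ffunE; case: eqP => [e2|_]; last by rewrite mulr0.
  by case/eqP: qp; apply: enum_val_inj; rewrite [LHS]surjective_pairing [RHS]surjective_pairing -e1 -e2.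
by rewrite (@mulr0 A) ffunE mulr0.
Qed.

Lemma coord_comb_mul m k (c : 'rV[L]_m) (y : 'I_m -> 'rV[A]_n) (B : 'M[A]_(n, k)) :
  coord_comb c y *m B = \sum_l (cpemb (c 0 l) : A) *: (y l *m B).
Proof. by rewrite mulmx_suml; apply: eq_bigr => l _; rewrite scalemxAl. Qed.

End Coordinates.

Lemma coords_mul n k (x : 'rV[A]_n) (B : 'M[A]_(n, k)) :
  coords (x *m B) = coords x *m (\matrix_p coords (coord_basis p *m B)).
Proof. by rewrite {1}(coord_combE x) coord_comb_mul -coords_comb. Qed.

(** The syzygies form a module of relations over [S] in the coordinates; its generators over [S]
    also generate over [A_f]. *)
Lemma Af_syzygies n (g : 'cV[A]_n) : exists m (k : 'M[A]_(m, n)),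
  [/\ forall i j, R (k i j), k *m g = 0 & forall x : 'rV[A]_n, (forall i, R (x 0 i)) ->
     x *m g = 0 -> exists c : 'rV[A]_m, (forall i, R (c 0 i)) /\ x = c *m k].
Proof.
pose B := \matrix_p coords (coord_basis p *m g).
have [m [k [Sk kB hk]]] := syzygies B.
pose k' : 'M[A]_(m, n) := \matrix_(l, i) ([ffun s => k l (enum_rank (i, s))] : cpT L).
have ck l : coords (row l k') = row l k.
  apply/rowP=> p; rewrite !mxE [LHS]ffunE; case E: (enum_val p) => [i s] /=.
  by rewrite -E enum_valK.
exists m, k'; split.
- by move=> l i s; rewrite mxE ffunE.
- apply/row_matrixP=> l; rewrite row_mul; apply: coords_inj.
  by rewrite coords_mul ck -/B -row_mul kB !row0 coords0.
- move=> x Rx xg; have [||c [Sc ec]] := hk (coords x).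
  + by move=> i p; rewrite mxE; apply: Rx.
  + by rewrite -coords_mul xg coords0.
  exists (\row_l (cpemb (c 0 l) : A)); split; first by move=> l; rewrite mxE; apply: (Af_emb hV).
  apply: coords_inj.
  rewrite (_ : _ *m k' = coord_comb c (fun l => row l k')); last first.
    by rewrite mulmx_sum_row; apply: eq_bigr => l _; rewrite mxE.
  rewrite ec coords_comb; congr (_ *m _); apply/row_matrixP=> l.
  by rewrite rowK ck.
Qed.

Lemma Af_denominators n (u : 'rV[A]_n) :
  exists d d' : A, d' * d = 1 /\ forall i, R ((d *: u) 0 i).
Proof.
have [a [Va a0 ha]] := intclos_denominators (fun p : 'I_n * gal => (u 0 p.1 : cpT L) p.2).
exists (cpemb a%:A), (cpemb (a^-1)%:A); split.
  apply/ffunP=> s; rewrite (emb_mulE hf) !ffunE; case: eqP => _; last by rewrite mulr0.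
  by rewrite -[(a^-1)%:A]/(in_alg L _) -[a%:A]/(in_alg L _) -rmorphM /= mulVf // scale1r.
by move=> i s; rewrite mxE (emb_mulE hf); apply: (ha (i, s)).
Qed.

(** [U] is a finite dimensional [L]-space given by a predicate. [semisimple_mod_rows], over the
    field [L] and with zero radical, produces a matrix [B] spanning it; then ranks are compared. *)
Lemma cp_surjective_injective n (U : 'rV[A]_n -> Prop) (k : 'M[A]_n) : submod (fun=> True) U ->
  (forall u, U u -> U (u *m k)) -> (forall u, U u -> exists v, U v /\ v *m k = u) ->
  forall u, U u -> u *m k = 0 -> u = 0.
Proof.
move=> [zU mU] _ surj u Uu uk.
pose U' x := exists u, U u /\ coords u = x.
have coordsB (x y : 'rV[A]_n) : coords (x - y) = coords x - coords y.
  by apply/rowP=> p; rewrite !mxE cpB.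
have hU' : @submod L _ (fun=> True) U'.
  split; [split|].
  - by exists 0; rewrite coords0; split=> //; apply: (zsub0 zU).
  - by move=> _ _ [x [Ux <-]] [y [Uy <-]]; exists (x - y); rewrite coordsB; split=> //; apply: (zsubB zU).
  - move=> c _ _ [x [Ux <-]]; exists ((cpemb c : A) *: x); split; first exact: mU.
    by apply/rowP=> p; rewrite !mxE (emb_mulE hf).
have hJ : @left_ideal L *%R (fun=> True) (fun x => x = 0).
  by split=> // [x y -> ->|r x _ ->]; rewrite ?subrr ?mulr0.
have ssL : @semisimple_mod L (fun=> True) (fun x => x = 0).
  move=> I [_ I0 _ mI]; case: (EM (exists x, I x /\ x != 0)) => [[x [Ix x0]]|no].
    exists 1; split; first by rewrite -(mulVf x0); apply: mI.
    by move=> y _; rewrite mulr1 subrr.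
  exists 0; split=> // x Ix; rewrite mulr0 subr0; apply/eqP; apply: contrapT => /negP x0.
  by apply: no; exists x.
have [B [UB hB]] := semisimple_mod_rows hJ ssL hU' (fun _ _ _ => I).
have BE x : U' x -> x = x *m B.
  by move=> /hB h; apply/rowP=> j; apply/eqP; rewrite -subr_eq0; apply/eqP; have := h j; rewrite !mxE.
pose K := \matrix_p coords (coord_basis p *m k).
have sBK : (B <= B *m K)%MS.
  apply/row_subP=> i; have [w [Uw <-]] := UB i.
  have [v [Uv <-]] := surj w Uw.
  rewrite coords_mul -/K (BE (coords v)); last by exists v.
  by rewrite -mulmxA; apply: submxMl.
have r0 : \rank (B :&: kermx K)%MS = 0%N.
  apply/eqP; have e := mxrank_mul_ker B K; have h := mxrankS sBK.
  by rewrite -leqn0 -(leq_add2l (\rank (B *m K))) e addn0.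
have hu : (coords u <= B :&: kermx K)%MS.
  rewrite sub_capmx; apply/andP; split; first by rewrite (BE (coords u)) ?submxMl //; exists u.
  by apply/sub_kermxP; rewrite -coords_mul uk coords0.
move/eqP: r0; rewrite mxrank_eq0 => /eqP e0; move: hu; rewrite e0 submx0 => /eqP hu.
by apply: coords_inj; rewrite hu coords0.
Qed.

(** Right multiplication by [y] is surjective, hence injective, and it kills [y x - 1]. *)
Lemma cp_dedekind_finite (x y : A) : x * y = 1 -> y * x = 1.
Proof.
move=> xy.
have mE (a b : A) : ((a%:M : 'M[A]_1) *m (b%:M : 'M[A]_1)) = (a * b)%:M.
  by apply/matrixP=> i j; rewrite !ord1 !mxE big_ord1 !mxE.
pose U := fun _ : 'rV[A]_1 => True.
have e : ((y * x - 1)%:M : 'rV[A]_1) = 0.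
  apply: (@cp_surjective_injective 1 U y%:M) => //.
    move=> u _; exists (u *m (x%:M : 'M[A]_1)); split=> //.
    by rewrite -mulmxA mE xy mulmx1.
  by rewrite mE mulrBl mul1r -mulrA xy mulr1 subrr; apply/matrixP=> i j; rewrite !mxE; case: eqP.
have /matrixP/(_ 0 0) := e; rewrite !mxE /= => /eqP; rewrite subr_eq0 => /eqP ->.
by [].
Qed.

End Syzygies.

(** * Square-free cocycles *)

Section Criteria.
Variables (F : fieldType) (L : splittingFieldType F) (V : F -> Prop).
Hypotheses (hV : valuation_domain V) (hG : galois 1%VS (fullv : {subfield L})).
Notation S := (@intclos F L V).
Notation gal := (gal_of (fullv : {subfield L})).
Variables (r : nat) (Ms : 'I_r -> L -> Prop).
Hypothesis hs : spectrum V Ms.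

Let ringS : subring *%R 1 S := intclos_subring L hV.
Let zS := subring_zsub ringS.
Let SM : forall x y, S x -> S y -> S (x * y) := subringM ringS.
Let Sg (s : gal) x : S x -> S (s x). Proof. exact: intclos_gal. Qed.
Let hMs : forall i, maxS V (Ms i). Proof. by case: hs. Qed.
Let zM i := maxS_zsub (hMs i).
Let cMs : forall M, maxS V M -> exists i, M = Ms i. Proof. by case: hs. Qed.

Variable f : gal -> gal -> L.
Hypothesis hf : normalized_cocycle V f.
Let Sf s t : S (f s t) := cocycle_int hf s t.
Local Notation R := (@Af F L V).
Local Notation J := (radical_ideal V f).
Lemma ideal_sq_galV M (s : gal) x : ideal_sq M (s x) -> ideal_sq (fun y => M (s y)) x.
Proof.
move=> [n [a [b [h e]]]]; exists n, (fun k => (s^-1)%g (a k)), (fun k => (s^-1)%g (b k)).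
split=> [k|]; first by rewrite !galVKx.
by rewrite -[LHS](galKx s) e rmorph_sum; apply: eq_bigr => k _; rewrite rmorphM.
Qed.

Definition square_free := forall M, maxS V M -> forall s : gal, ~ ideal_sq M (f s (s^-1)%g).

(** [f s t] divides [s (f t t^-1)], so membership in [M^2] would reappear at a conjugate ideal. *)
Lemma square_free_all : square_free -> forall M, maxS V M -> forall s t, ~ ideal_sq M (f s t).
Proof.
move=> sf M hM s t h; apply: (sf _ (maxS_gal hV s hM) t).
by apply: ideal_sq_galV; rewrite -(cocycle_inv hf) mulrC; apply: (ideal_sqMl hM).
Qed.

(** [f(s, s^-1 t) f(t, t^-1 s)] is the image under [s] of [f(u, u^-1)] with [u = s^-1 t];
    incomparable elements would put it in [M^2]. *)
Lemma square_free_chain M : square_free -> maxS V M -> gr_chain f M.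
Proof.
move=> sf hM s t; apply: contrapT => /not_orP [/contrapT h1 /contrapT h2].
rewrite /gcomp in h1 h2; apply: (sf _ (maxS_gal hV s hM) (t * s^-1)%g).
have e := cocycle_inv hf s (t * s^-1)%g; rewrite mulgKV invMg invgK in e.
by apply: ideal_sq_galV; rewrite invMg invgK -e; apply: ideal_sqM.
Qed.

Variable pi : F.
Hypotheses (hpi : forall x, JV V x <-> exists v, V v /\ x = v * pi) (pi0 : pi != 0).

(* An element of [I_s] of least value at every maximal ideal. *)
Definition is_generator s z := S z /\ forall i,
  (trivial_at Ms f i s -> Ms i z /\ ~ ideal_sq (Ms i) z) /\ (~ trivial_at Ms f i s -> ~ Ms i z).

Lemma generator_exists s : exists z, is_generator s z.
Proof. exact: (uniformizer hV hG hs hpi pi0 (fun i => trivial_at Ms f i s)). Qed.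

(** At each maximal ideal [M] one of [z] and [f s s^-1] is a unit and the other is outside [M^2]. So
    their product is outside every [M^2], and dividing an element of [M] by it is local. *)
Lemma coefficient_int s c : square_free ->
  (forall z, is_generator s z -> forall i, Ms i (c * z * f s (s^-1)%g)) -> S c.
Proof.
move=> sf h; have [z [Sz hz]] := generator_exists s.
have := h z (conj Sz hz); set g := f s _ => {}h.
have Sg' : S g by apply: Sf.
apply: (intclos_loc hV) => M /cMs [i ->].
have nsq : ~ ideal_sq (Ms i) (z * g).
  case: (EM (Ms i g)) => [Mg|ng]; have [h1 h2] := hz i.
    have nz : ~ Ms i z by apply: h2 => /(_ Mg).
    by move/(ideal_sq_cancel hV (hMs i) Sz nz Sg'); apply: sf.
  case: (h1 ng) => _ nsq; rewrite mulrC => /(ideal_sq_cancel hV (hMs i) Sg' ng Sz).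
  exact: nsq.
have zg0 : z * g != 0.
  apply/eqP => zg0; apply: nsq; rewrite zg0; exists 0%N, (fun=> 0), (fun=> 0); rewrite big_ord0.
  by split=> // -[].
rewrite -(mulfK zg0 c); apply: (locS_div hV hG) => //; first by rewrite mulrA.
exact: SM.
Qed.

Lemma generator_mono s z : is_generator (s^-1)%g z -> J (mono (s^-1)%g z).
Proof.
move=> [Sz hz]; apply: (radical_ideal_spectrum hs) => [u|i u]; rewrite ffunE.
  by case: eqP => // _; apply: (zsub0 zS).
by case: eqP => [->|_ _]; [case: (hz i) => h _ /h [] | apply: (zsub0 (zM i))].
Qed.

Lemma generator_gal s z : is_generator s z -> is_generator (s^-1)%g ((s^-1)%g z).
Proof.
move=> [Sz hz]; split=> [|i]; first exact: Sg.
have [j ej] := cMs (maxS_gal hV (s^-1)%g (hMs i)).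
have ej' x : Ms j x <-> Ms i ((s^-1)%g x) by rewrite -ej.
have et : trivial_at Ms f j s <-> trivial_at Ms f i (s^-1)%g.
  by rewrite /trivial_at ej' -[in X in _ <-> X](cocycle_swap hf) !invgK.
have [h1 h2] := hz j; rewrite -et -ej'; split=> [/h1 [Mz nz]|/h2 //]; split=> // h.
by apply: nz; rewrite -ej; apply: ideal_sq_galV.
Qed.

(** The coefficient at [1] of the product of [x] by a generator of [J] supported at [s^-1] is
    [x_s z f(s, s^-1)]; it lies in [J(S)] because [1] is trivial at every maximal ideal. *)
Lemma square_free_Ol x : square_free -> Ol f J x -> R x.
Proof.
move=> sf hx s; apply: (coefficient_int (s := s) sf) => z /generator_gal gz i.
have := hx _ (generator_mono gz) 1%g; rewrite mul_monoE invgK mulg1 galVKx.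
by case=> _; apply; rewrite ?(cocycle1l hf); [apply: hMs | apply: maxS1; apply: hMs].
Qed.

(** The witness is [(e / t) x_s], where [t] is a uniformizer at [Ms i] alone and [e] lies in the
    other ideals: its pole at [Ms i] has to be compensated by [f s w] or by the coefficients of
    [J]. *)
Lemma Ol_square_free : (forall x, Ol f J x -> R x) -> square_free.
Proof.
move=> hO M /cMs [i ->] s0 h0; have hM := hMs i.
pose P s := `[< ideal_sq (Ms i) (f s (s^-1)%g) >].
have [s /asboolP hsq smax] : exists2 s, P s & forall t, P t -> (graph_rank Ms f i t <= graph_rank Ms f i s)%N.
  by case: (arg_maxnP (fun s => graph_rank Ms f i s) (asboolT h0 : P s0)) => s ? ?; exists s.
(* Membership of [f u u^-1] in the square is inherited upwards from [s]; by maximality of the rank,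
   every element above [s] is equivalent to [s]. *)
have up u : graph_le f (Ms i) s (u * s)%g ->
    ideal_sq (Ms i) (f (u * s)%g ((u * s)^-1)%g) /\ graph_le f (Ms i) (u * s)%g s.
  rewrite /graph_le mulgK => nf.
  have hu : ideal_sq (Ms i) (f (u * s)%g ((u * s)^-1)%g).
    apply: (ideal_sq_cancel hV hM (Sf s u) nf) => //.
    by rewrite (cocycle_inv3 hf); apply: (ideal_sqMl hM) => //; apply: Sg.
  split=> //; apply: contrapT => n; have := smax _ (asboolT hu).
  by rewrite leqNgt (graph_rank_lt hV hs hf) // /graph_le mulgK.
have [e [Se ne he]] := separate hV hs i.
have [t ut] := uniformizer hV hG hs hpi pi0 (fun j => j = i).
have t0 := uniformizer_neq0 hV hs ut; have [St ht] := ut.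
have [/(_ erefl) [Mt nsqt] _] := ht i.
suff Rq : R (mono s (e / t)).
  apply: ne; have := Rq s; rewrite ffunE eqxx => Sq.
  by rewrite -(divfK t0 e); apply: (maxSM hM).
apply: hO => j Jj; have Sj u : S (j u) by case: (Jj u).
have key u : S (e / t * s (j (u * s^-1)%g) * f s (u * s^-1)%g) /\
    forall k, trivial_at Ms f k u -> Ms k (e / t * s (j (u * s^-1)%g) * f s (u * s^-1)%g).
  set w := (u * s^-1)%g; have eu : u = (w * s)%g by rewrite /w mulgKV.
  pose g := e * s (j w) * f s w.
  have Sgg : S g by do 2?apply: SM => //; apply: Sg.
  have -> : e / t * s (j w) * f s w = g / t by rewrite /g; field.
  (* Either [f s w] is in [Ms i], or [u] is above [s], hence equivalent to it; then [w] is trivial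
     at the conjugate ideal, which contains the coefficient of [j]. *)
  have Mg : Ms i g.
    case: (EM (Ms i (f s w))) => [Mf|nf]; first by apply: (maxSM hM) => //; apply: SM => //; apply: Sg.
    apply: (maxSMr hM) => //; apply: (maxSM hM) => //.
    have [|hsqu us] := up w; first by rewrite /graph_le mulgK.
    have : ~ Ms i (s (f w (w^-1)%g)).
      rewrite -(cocycle_inv hf) => /(maxS_prime hV hM (Sf _ _) (Sf _ _)) [] //.
      by move: us; rewrite /graph_le invMg mulgA mulgV mul1g.
    by have [_ hj] := Jj w; exact: (hj _ (maxS_gal hV s hM)).
  have Sgt : S (g / t) by apply: (uniformizer_div hV hG hs ut) => // k ->.
  split=> // k tk; have [ki|ki] := eqVneq k i.
    (* When [u] is trivial at [Ms i], [f s w] inherits the square from [f s s^-1], so one factor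
       survives the division by [t]. *)
    rewrite ki in tk *; apply: contrapT => ngt; apply: nsqt.
    apply: (ideal_sq_cancel hV hM Sgt ngt St); rewrite divfK // /g.
    apply: (ideal_sqMl hM) => //; first by apply: SM => //; apply: Sg.
    have nu : ~ Ms i (f u (u^-1)%g) by [].
    apply: (ideal_sq_cancel hV hM (Sf u (u^-1)%g) nu) => //.
    rewrite mulrC eu (cocycle_inv3 hf); apply: (ideal_sqMl hM) => //; exact: Sg.
  have nt : ~ Ms k t by case: (ht k) => _; apply; apply/eqP.
  have : Ms k (g / t * t).
    by rewrite divfK //; apply: (maxSMr (hMs k)); [exact: Sf | apply: (maxSMr (hMs k)); [exact: Sg | exact: he]].
  by case/(maxS_prime hV (hMs k) Sgt St).
apply: (radical_ideal_spectrum hs) => [u|k u]; rewrite (mono_mulE f); by case: (key u) => ? h // /h.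
Qed.

End Criteria.

Lemma lgen_map (A : pzRingType) (R : A -> Prop) (hR : subring *%R 1 R) (I : eqType) (s : seq I)
    (g : I -> A) x : uniq s ->
  lgen *%R R [seq g i | i <- s] x <-> exists c : I -> A, (forall i, R (c i)) /\ x = \sum_(i <- s) c i * g i.
Proof.
have R0 : R 0 by case: hR.
elim: s x => [|i s IH] x /=.
  by move=> _; split=> [->|[c [_ ->]]]; [exists (fun=> 0)|]; rewrite big_nil.
case/andP=> nis us; split=> [[a [y [Ra /(IH _ us) [c [Rc ->]] ->]]]|[c [Rc ->]]].
  exists (fun j => if j == i then a else c j); split; first by move=> j; case: eqP.
  rewrite big_cons eqxx; congr (_ + _); apply: eq_big_seq => j js.
  by case: eqP => // e; rewrite -e js in nis.
rewrite big_cons; exists (c i), (\sum_(j <- s) c j * g j); split=> //.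
by apply/(IH _ us); exists c.
Qed.

(** * Invertibility and generators of [J], and left semiheredity *)

Section Invertibility.
Variables (F : fieldType) (L : splittingFieldType F) (V : F -> Prop).
Hypotheses (hV : valuation_domain V) (hG : galois 1%VS (fullv : {subfield L})).
Notation S := (@intclos F L V).
Notation gal := (gal_of (fullv : {subfield L})).
Variables (r : nat) (Ms : 'I_r -> L -> Prop).
Hypotheses (hs : spectrum V Ms) (htr : trace_units V Ms).

Let ringS : subring *%R 1 S := intclos_subring L hV.
Let zS := subring_zsub ringS.
Let SM : forall x y, S x -> S y -> S (x * y) := subringM ringS.
Let Sg (s : gal) x : S x -> S (s x). Proof. exact: intclos_gal. Qed.
Let hMs : forall i, maxS V (Ms i). Proof. by case: hs. Qed.
Let zM i := maxS_zsub (hMs i).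
Let cMs : forall M, maxS V M -> exists i, M = Ms i. Proof. by case: hs. Qed.

Variable f : gal -> gal -> L.
Hypothesis hf : normalized_cocycle V f.
Let Sf s t : S (f s t) := cocycle_int hf s t.
Local Notation R := (@Af F L V).
Local Notation J := (radical_ideal V f).
Local Notation A := (cpRing hf).
Let ringR : @subring A *%R 1 R := Af_subring hV hf.
Let hJ : @left_ideal A *%R R J := radical_ideal_left hV hf.
Let zJ : @zsub A J := left_ideal_zsub hJ.

Section NonTrivialValuation.
Variable pi : F.
Hypotheses (hpi : forall x, JV V x <-> exists v, V v /\ x = v * pi) (pi0 : pi != 0).

(* [J J'] with [J' = {x | x J <= R}]. *)
Let JJ' (x : A) := exists n (a : 'rV[A]_n) (b : 'cV[A]_n),
  [/\ forall i, J (a 0 i), forall i x, J x -> R (b i 0 * x) & a *m b = x%:M].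

Let JJ'1 (a b : A) : J a -> (forall x, J x -> R (b * x)) -> JJ' (a * b).
Proof.
move=> Ja Rb; exists 1%N, a%:M, b%:M; split.
- by move=> i; rewrite ord1 mxE.
- by move=> i x Jx; rewrite ord1 mxE; apply: Rb.
- by apply/matrixP=> i j; rewrite !ord1 !mxE big_ord1 !mxE.
Qed.

Lemma emb_mul s t : cpmul f (cpemb s) (cpemb t) = cpemb (s * t) :> cpT L.
Proof. by apply/ffunP=> u; rewrite (emb_mulE hf) !ffunE; case: eqP; rewrite ?mulr0. Qed.

(** The elements of [S] in [J J'] form an ideal, so it suffices to leave each [Ms i]; the factor
    [e], which lies in the other ideals, makes the problem local. *)
Lemma radical_invertible : square_free V f -> exists n (a : 'rV[A]_n) (b : 'cV[A]_n),
  [/\ forall i, J (a 0 i), forall i x, J x -> R (b i 0 * x) & a *m b = 1%:M].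
Proof.
move=> sf; have sfa := square_free_all hV hf sf.
pose I s := JJ' (cpemb s) /\ S s.
suff [] : I 1 by [].
apply: (ideal_full hV (I := I)).
  split.
  - by move=> x [].
  - split; last exact: (zsub0 zS).
    exists 0%N, 0, 0; split=> [[]|[]|] //; rewrite mul0mx; apply/matrixP=> i j; rewrite !ord1 !mxE /=.
    by apply/ffunP=> u; rewrite !ffunE; case: eqP.
  - move=> x y [[n [a [b [Ja Rb ab]]]] Sx] [[m [c [d [Jc Rd cd]]]] Sy]; split; last exact: (zsubB zS).
    exists (n + m)%N, (row_mx a (- c)), (col_mx b d); split.
    + by move=> i; rewrite mxE; case: split => k //; rewrite mxE; apply: (zsubN zJ).
    + by move=> i z Jz; rewrite mxE; case: split => k; [apply: Rb | apply: Rd].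
    + rewrite mul_row_col mulNmx ab cd; apply/matrixP=> i j; rewrite !ord1 !mxE /=.
      by apply/ffunP=> u; rewrite !ffunE; case: eqP => _ //; rewrite subrr.
  - move=> s x Ss [[n [a [b [Ja Rb ab]]]] Sx]; split; last exact: SM.
    exists n, ((cpemb s : A) *: a), b; split=> //.
    + by move=> i; rewrite mxE; apply: (radical_idealMl hV hf) => //; apply: (Af_emb hV).
    + rewrite -scalemxAl ab; apply/matrixP=> i j; rewrite !ord1 !mxE /=.
      exact: emb_mul.
move=> M /cMs [i ->]; have hM := hMs i.
have [e [Se ne he]] := separate hV hs i.
case: (EM (exists s : gal, Ms i (f s (s^-1)%g))) => [[s0 h0]|triv]; last first.
  (* If every element is trivial at [Ms i], all coefficients of [J] lie in [Ms i] and are divisible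
     by [t]. *)
  have [t ut] := uniformizer hV hG hs hpi pi0 (fun j => j = i).
  have t0 := uniformizer_neq0 hV hs ut; have [St ht] := ut.
  exists e; split=> //; split=> //.
  have -> : cpemb e = cpmul f (cpemb (t * e)) (cpemb t^-1).
    by rewrite emb_mul mulrAC divff // mul1r.
  apply: JJ'1.
    apply: (radical_ideal_small hV) => s N /cMs [k ->]; rewrite ffunE.
    case: eqP => _; last exact: (zsub0 (zM k)).
    have [->|ki] := eqVneq k i; last by apply: (maxSM (hMs k)) => //; apply: he.
    by apply: (maxSMr hM) => //; case: (ht i) => /(_ erefl) [].
  move=> x Jx u; rewrite (emb_mulE hf) mulrC; have [Sx hx] := Jx u.
  apply: (uniformizer_div hV hG hs ut) => // k ->; apply: (hx _ hM) => Mf.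
  by apply: triv; exists u.
have [s /asboolP Ms_s smin] : exists2 s, `[< Ms i (f s (s^-1)%g) >] &
    forall t, `[< Ms i (f t (t^-1)%g) >] -> (graph_rank Ms f i s <= graph_rank Ms f i t)%N.
  by case: (arg_minnP (fun s => graph_rank Ms f i s) (asboolT h0 : (fun t => `[< Ms i (f t (t^-1)%g) >]) s0)) => s ? ?; exists s.
(* As the graph is a chain, the least nontrivial [s] is below every nontrivial [w]. *)
have low w : Ms i (f w (w^-1)%g) -> ~ Ms i (f s (w * s^-1)%g).
  move=> Mw Mn; suff lt : (graph_rank Ms f i w < graph_rank Ms f i s)%N.
    by have := smin w (asboolT Mw); rewrite leqNgt lt.
  apply: (graph_rank_lt hV hs hf); first by case: (square_free_chain hV hf sf hM s w) => // /(_ Mn).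
  by move/(_ Mn).
exists (e * e); split; last by case/(maxS_prime hV hM Se Se).
split; last exact: SM.
have f0 : f s (s^-1)%g != 0 := cocycle_neq0 hf s (s^-1)%g.
have g0 : f (s^-1)%g s != 0 := cocycle_neq0 hf (s^-1)%g s.
(* [e x_s] is in [J], and [x_s^-1 e] carries [J] into [A_f]: the new coefficients are conjugates of
   [e x_w / g] with [g = f(s, s^-1 w)]. If [g] is in [Ms i], then [w] is trivial there and [x_w] is
   in [Ms i], which suffices as [g] is outside the square. *)
have -> : cpemb (e * e) = cpmul f (mono s e) (mono (s^-1)%g ((f (s^-1)%g s)^-1 * (s^-1)%g e)).
  rewrite mono_mono mulVg; congr mono; rewrite rmorphM /= galVKx -(cocycle_swap hf) fmorphV /=.
  by field; rewrite fmorph_eq0.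
apply: JJ'1.
  apply: (radical_ideal_spectrum hs) => [u|k u]; rewrite ffunE; case: eqP => [us|_] //.
  - exact: (zsub0 zS).
  - rewrite us => tk; by apply: he; apply: contra_notN tk => /eqP ->.
  - by move=> _; apply: (zsub0 (zM k)).
move=> x Jx u; rewrite (mono_mulE f) invgK; set w := (u * s)%g.
have [Sx hx] := Jx w; pose g := f s (w * s^-1)%g.
suff Sgq : S (e * x w / g).
  have g1 : g != 0 := cocycle_neq0 hf s (w * s^-1)%g.
  rewrite (_ : _ * _ = (s^-1)%g (e * x w / g)); first exact: Sg.
  rewrite !(rmorphM, fmorphV) /=.
  have e1 : f (s^-1)%g w * (s^-1)%g g = f (s^-1)%g s.
    by rewrite -[f (s^-1)%g w](galKx s) -rmorphM /= (cocycle_inv2 hf) -(cocycle_swap hf) galKx.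
  have g2 : (s^-1)%g g != 0 by rewrite fmorph_eq0.
  have g3 : f (s^-1)%g w != 0 := cocycle_neq0 hf (s^-1)%g w.
  by rewrite -e1; field; rewrite g2 g3.
apply: (intclos_loc hV) => N /cMs [k ->].
have [->|ki] := eqVneq k i; last first.
  by apply: (locS_div hV hG) => //; [apply: (maxSMr (hMs k)) => //; apply: he | apply: Sf | apply: sfa].
case: (EM (Ms i g)) => [Mg|ng]; last by apply: locS_divU => //; [apply: SM | apply: Sf].
apply: (locS_div hV hG) => //; [|apply: Sf|apply: sfa] => //.
apply: (maxSM hM) => //; apply: (hx _ hM) => Mw.
exact: (low w).
Qed.

(** The [z_s x_s] form a basis of [J] over [S], on the left and, after moving coefficients across by
    [s^-1], on the right. *)
Lemma radical_generators : exists gs : seq A,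
  (forall g, g \in gs -> J g) /\
  (forall x, J x <-> @lgen A *%R R gs x) /\ (forall x, J x <-> lgen (opmul (cpmul f)) R gs x).
Proof.
have [z hz] := choice (generator_exists hV hG hs f hpi pi0).
have z0 s : z s != 0 by apply: (uniformizer_neq0 hV hs (hz s)).
have Jm s : J (mono s (z s)).
  by have := @generator_mono _ _ _ hV _ _ hs f s^-1%g (z s); rewrite invgK; apply; apply: hz.
have q s x : J x -> S (x s / z s).
  move=> Jx; have [Sx hx] := Jx s.
  by apply: (uniformizer_div hV hG hs (hz s)) => // i ti; apply: hx.
exists [seq (mono s (z s) : A) | s <- enum {: gal}]; split; [|split] => [_ /mapP [s _ ->]|x|x].
- exact: Jm.
- have H := @lgen_map A R ringR _ _ (fun s => mono s (z s)) x (enum_uniq {: gal}).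
  split=> [Jx|/(iffLR H) [c [Rc ->]]].
    apply: (iffRL H); exists (fun s => cpemb (x s / z s)); split; first by move=> s; apply: (Af_emb hV); apply: q.
    rewrite big_enum /=; rewrite {1}[x]mono_sum; apply: eq_bigr => s _.
    apply/ffunP=> u; rewrite (emb_mulE hf) !ffunE; case: eqP => _; last by rewrite mulr0.
    by rewrite divfK.
  by apply: (zsub_sum zJ) => s _; apply: (radical_idealMl hV hf).
- have ringRo : @subring A^c *%R 1 R.
    by case: ringR => R0 R1 RB RM; split=> // a b Ra Rb; apply: RM.
  have H := @lgen_map A^c R ringRo _ _ (fun s => mono s (z s)) x (enum_uniq {: gal}).
  split=> [Jx|/(iffLR H) [c [Rc ->]]].
    apply: (iffRL H); exists (fun s : gal => cpemb ((s^-1 : gal)%g (x s / z s))); split.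
      by move=> s; apply: (Af_emb hV); apply: Sg; apply: q.
    rewrite big_enum /=; rewrite {1}[x]mono_sum; apply: eq_bigr => s _.
    apply/ffunP=> u; rewrite [RHS](mul_embE hf) !ffunE; case: eqP => [->|_]; last by rewrite mul0r.
    by rewrite galVKx mulrC divfK.
  by apply: (zsub_sum zJ) => s _; apply: (radical_idealMr hV hf).
Qed.

End NonTrivialValuation.

Section TrivialValuation.
Hypothesis J0 : forall a, JV V a -> a = 0.

Lemma trivial_valuation_full x : S x.
Proof.
have Vx a : V a.
  have [->|a0] := eqVneq a 0; first exact: (zsub0 (subring_zsub (proj1 hV))).
  apply: contrapT => na; have [//|Vi] := valuation_total hV a0.
  have : JV V a^-1 by apply/(JVP hV); rewrite invrK.
  by move/J0/eqP; rewrite invr_eq0 (negPf a0).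
by have [p [mp px]] := algebraic_monic hV hG x; exists p; split=> // i; apply: Vx.
Qed.

Lemma trivial_valuation_maxS (M : L -> Prop) x : maxS V M -> M x -> x = 0.
Proof.
move=> hM Mx; apply/eqP; apply: contrapT => /negP x0; apply: (maxS1 hM).
by rewrite -(mulVf x0); apply: (maxSM hM) => //; apply: trivial_valuation_full.
Qed.

Lemma trivial_valuation_radical x : J x -> x = 0.
Proof.
move=> Jx; apply/ffunP=> s; rewrite ffunE; have [M hM] := exists_maxS L hV.
apply: (trivial_valuation_maxS hM); have [_] := Jx s; apply=> // /(trivial_valuation_maxS hM) /eqP.
by rewrite (negPf (cocycle_neq0 hf _ _)).
Qed.

Lemma trivial_valuation_square_free : square_free V f.
Proof.
move=> M hM s /(ideal_sqS hM)/(trivial_valuation_maxS hM)/eqP.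
by rewrite (negPf (cocycle_neq0 hf _ _)).
Qed.
End TrivialValuation.

Hypothesis hprin : principal_JV V.

Lemma principal_cases :
  (forall a, JV V a -> a = 0) \/
  exists pi, pi != 0 /\ forall x, JV V x <-> exists v, V v /\ x = v * pi.
Proof.
have [pi [_ hpi]] := hprin; have [pi0|pi0] := eqVneq pi 0; last by right; exists pi.
by left=> a /hpi [v [_ ->]]; rewrite pi0 mulr0.
Qed.

Lemma square_free_left_semihereditary (gs : seq A) : square_free V f ->
  (forall g, g \in gs -> R g) -> @lprojective A *%R 1 R (@lgen A *%R R gs).
Proof.
move=> sf; apply: (lprojective_lgen ringR hJ).
- exact: (Af_semisimple hV hs htr).
- exact: (radical_quasi_regular hV hs).
- exact: (radical_idealMr hV hf).
- case: principal_cases => [J0|[pi [pi0 hpi]]]; first by left; exact: trivial_valuation_radical.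
  by right; apply: (radical_invertible hpi pi0 sf).
- move=> n u; exact: (Af_denominators hV hG).
- move=> n U k; exact: cp_surjective_injective.
- move=> n g _; exact: (Af_syzygies hV hG).
Qed.

End Invertibility.

(** * Orders and traces *)

Section CharacteristicPolynomials.

(** [X - A] divides [p(X) - p(A)] among matrices of polynomials; when [p(A) = 0], take
    determinants. *)
Lemma char_poly_dvd_horner (K : fieldType) n (A : 'M[K]_n.+1) (p : {poly K}) :
  horner_mx A p = 0 -> char_poly A %| p ^+ n.+1.
Proof.
pose C := map_mx (@polyC K) : 'M[K]_n.+1 -> 'M[{poly K}]_n.+1.
have [Q eQ] : exists Q : 'M[{poly K}]_n.+1, p%:M - C (horner_mx A p) = char_poly_mx A * Q.
  elim/poly_ind: p => [|p c [Q eQ]].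
    exists 0; rewrite (rmorph0 (horner_mx A)) mulr0; apply/matrixP=> i j; by rewrite !mxE mul0rn polyC0 subrr.
  exists (Q * 'X%:M + C (horner_mx A p)).
  rewrite mulrDr mulrA -eQ (rmorphD (horner_mx A)) (rmorphM (horner_mx A)) /= horner_mx_X horner_mx_C.
  have CM (a b : 'M[K]_n.+1) : C (a * b) = C a * C b by apply: map_mxM.
  have CD (a b : 'M[K]_n.+1) : C (a + b) = C a + C b by apply: map_mxD.
  have Cc : C c%:M = (c%:P)%:M by apply: map_scalar_mx.
  have -> : char_poly_mx A = 'X%:M - C A by [].
  have e : C A * C (horner_mx A p) = C (horner_mx A p) * C A.
    by rewrite -!CM; congr C; apply: comm_mx_horner.
  rewrite CD CM Cc raddfD /= scalar_mxM [(_ - C A) * _]mulrBl mulrBl e.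
  have -> : 'X%:M * C (horner_mx A p) = C (horner_mx A p) * 'X%:M by apply/esym/scalar_mxC.
  by rewrite opprD addrACA subrr addr0 addrA subrK.
move=> h; move: eQ; rewrite h [C 0](_ : _ = 0) ?subr0; last by apply/matrixP=> i j; rewrite !mxE.
by move/(congr1 determinant); rewrite det_scalar det_mulmx => ->; apply: dvdp_mulr.
Qed.

Lemma char_poly_sub (K : comNzRingType) (S : K -> Prop) n (A : 'M[K]_n) : subring *%R 1 S ->
  (forall i j, S (A i j)) -> forall k, S (char_poly A)`_k.
Proof.
move=> hS SA k; have [B [i [_ im]]] := subring_comNzRingType hS.
have [b hb] := choice (fun ij : 'I_n * 'I_n => proj1 (im _) (SA ij.1 ij.2)).
have -> : A = map_mx i (\matrix_(k, l) b (k, l)) by apply/matrixP=> u v; rewrite !mxE hb.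
by rewrite -map_char_poly coef_map; apply/im; eexists.
Qed.

End CharacteristicPolynomials.

(** * A Gauss lemma for polynomials reducing to a power of the variable *)

Section GaussLemma.
Variables (F : fieldType) (V : F -> Prop).
Hypothesis hV : valuation_domain V.
Let ringV : subring *%R 1 V. Proof. by case: hV. Qed.
Let zV := subring_zsub ringV.
Let VM : forall x y, V x -> V y -> V (x * y) := subringM ringV.
Let hJ : left_ideal *%R V (JV V) := JV_left_ideal hV.
Let zJ := left_ideal_zsub hJ.
Let JsV x : JV V x -> V x. Proof. by case: hJ => + _ _ _; apply. Qed.
Let JM x y : V x -> JV V y -> JV V (x * y). Proof. by case: hJ => _ _ _; apply. Qed.
Let JMr x y : V y -> JV V x -> JV V (x * y). Proof. by rewrite mulrC; apply: JM. Qed.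

Definition residual_monomial (p : {poly F}) :=
  p \is monic /\ forall k, (k < (size p).-1)%N -> JV V p`_k.

Lemma monic_size (p : {poly F}) : p \is monic -> size p = (size p).-1.+1.
Proof. by move=> /monic_neq0; rewrite -size_poly_eq0 => h; rewrite prednK // lt0n. Qed.

Lemma monic_lead (p : {poly F}) : p \is monic -> p`_(size p).-1 = 1.
Proof. by move=> /monicP. Qed.

Lemma residual_monomial_int p : residual_monomial p -> polyV V p.
Proof.
move=> [mp hp] k; have [/hp /JsV //|] := ltnP k (size p).-1; rewrite leq_eqVlt => /orP[/eqP <-|h].
  by rewrite monic_lead //; apply: (subring1 ringV).
by rewrite nth_default; [apply: (zsub0 zV) | rewrite (monic_size mp)].
Qed.

Lemma residual_monomialM p q : residual_monomial p -> residual_monomial q -> residual_monomial (p * q).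
Proof.
move=> hp hq; have [mp Jp] := hp; have [mq Jq] := hq; split; first by rewrite monicMl.
move=> k; rewrite size_monicM ?monic_neq0 // (monic_size mp) addSn /= => hk.
rewrite coefM; apply: (zsub_sum zJ) => i _.
case: (ltnP i (size p).-1) => hi; first by apply: JMr; [apply: residual_monomial_int | apply: Jp].
apply: JM; first exact: residual_monomial_int.
apply: Jq; rewrite -(ltn_add2l (size p).-1); apply: leq_ltn_trans (_ : k < _)%N; last first.
  by move: hk; rewrite {1}(monic_size mq) addnS.
have ik : (i <= k)%N by rewrite -ltnS.
by rewrite -(leq_add2r i) -addnA subnK // addnC leq_add2l.
Qed.

Lemma residual_monomialX p n : residual_monomial p -> residual_monomial (p ^+ n).
Proof.
move=> hp; elim: n => [|n IH]; last by rewrite exprS; apply: residual_monomialM.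
by rewrite expr0; split; [apply: monic1 | rewrite size_poly1].
Qed.

Let least_coef (p : {poly F}) : p \is monic -> exists i, [/\ (i <= (size p).-1)%N, p`_i != 0,
  forall k, V (p`_k / p`_i) & forall k, (k < i)%N -> JV V (p`_k / p`_i)].
Proof.
move=> mp.
pose P i := `[< p`_i != 0 /\ forall k, V (p`_k / p`_i) >].
have exP : exists i, P i.
  have [|j [j0 hj]] := valuation_least (zsub0 zV) (subring1 ringV) VM (valuation_total hV)
      (c := fun i : 'I_(size p).-1.+1 => p`_i).
    by exists ord_max; rewrite /= monic_lead // oner_neq0.
  exists j; apply/asboolP; split=> // k; case: (ltnP k (size p).-1.+1) => hk; first exact: (hj (Ordinal hk)).
  by rewrite nth_default; [rewrite mul0r; apply: (zsub0 zV) | rewrite (monic_size mp)].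
case: (ex_minnP exP) => i /asboolP [i0 hi] imin; exists i; split=> //.
  rewrite -ltnS -(monic_size mp) ltnNge; apply: contra_neqN i0 => h; exact: nth_default.
move=> k ki; apply: contrapT => nJ; have [u0 Vu] := JV_unit hV (hi k) nJ.
have k0 : p`_k != 0 by apply: contraNneq u0 => ->; rewrite mul0r.
suff : P k by move/imin; rewrite leqNgt ki.
apply/asboolP; split=> // l; rewrite (_ : _ / _ = p`_l / p`_i * (p`_k / p`_i)^-1); first exact: VM.
by field; rewrite i0 k0.
Qed.

(* The lowest coefficients of least value of [p] and [q] give one of [p * q]. *)
Lemma residual_monomial_factor p q : p \is monic -> q \is monic ->
  residual_monomial (p * q) -> residual_monomial p.
Proof.
move=> mp mq [_ hpq]; split=> //.
have [i [ip i0 Vi Ji]] := least_coef mp; have [j [jq j0 Vj Jj]] := least_coef mq.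
have Vpi : V (p`_i)^-1 by have := Vi (size p).-1; rewrite monic_lead // mul1r.
have Vqj : V (q`_j)^-1 by have := Vj (size q).-1; rewrite monic_lead // mul1r.
have e : JV V ((p`_i)^-1 * (q`_j)^-1 * (p * q)`_(i + j) - 1).
  have hi : (i < (i + j).+1)%N by rewrite ltnS leq_addr.
  rewrite coefM (bigD1 (Ordinal hi)) //= addKn mulrDr.
  rewrite (_ : _ * (p`_i * _) = 1); last by field; rewrite i0 j0.
  rewrite addrAC subrr add0r mulr_sumr; apply: (zsub_sum zJ) => k ki.
  rewrite [X in JV V X](_ : _ = p`_k / p`_i * (q`_(i + j - k) / q`_j)); last by field; rewrite i0 j0.
  have [lki|lik|eki] := ltngtP (nat_of_ord k) i.
  - by apply: JMr; [apply: Vj | apply: Ji].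
  - apply: JM; first exact: Vi.
    have kij : (k <= i + j)%N by rewrite -ltnS.
    by apply: Jj; rewrite -(ltn_add2l k) subnKC // ltn_add2r.
  - by case/eqP: ki; apply: val_inj.
have nJ : ~ JV V (p * q)`_(i + j).
  move=> h; apply: (JV_not1 hV); rewrite -[1](subKr ((p`_i)^-1 * (q`_j)^-1 * (p * q)`_(i + j))).
  by apply: (zsubB zJ) => //; apply: JM => //; apply: VM.
have ei : i = (size p).-1.
  apply/eqP; rewrite eqn_leq ip /= leqNgt; apply/negP => lt; apply: nJ; apply: hpq.
  rewrite size_monicM ?monic_neq0 // (monic_size mp) addSn /= (monic_size mq) addnS /=.
  by apply: leq_ltn_trans (_ : i + (size q).-1 < _)%N; rewrite ?leq_add2l ?ltn_add2r.
by move=> k; rewrite -ei => /Ji; rewrite ei monic_lead // divr1.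
Qed.

End GaussLemma.

Section RadicalOfOrder.
Variables (F : fieldType) (V : F -> Prop).
Hypotheses (hV : valuation_domain V) (hprin : principal_JV V).
Variables (A : nzRingType) (io : {rmorphism F -> A}).
Hypothesis io_central : forall a x, io a * x = x * io a.
Variable B : A -> Prop.
Hypotheses (ringB : subring *%R 1 B) (BV : forall a, V a -> B (io a)).

Let io_comm x : commr_rmorph io x. Proof. by move=> a; rewrite /GRing.comm io_central. Qed.

Definition central_eval x := horner_morph (io_comm x).
HB.instance Definition _ x := GRing.RMorphism.on (central_eval x).

Lemma central_evalC x a : central_eval x a%:P = io a. Proof. exact: horner_morphC. Qed.
Lemma central_evalX x : central_eval x 'X = x. Proof. exact: horner_morphX. Qed.

Hypothesis intB : forall b, B b -> exists p, [/\ p \is monic, polyV V p & central_eval b p = 0].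

(** Write an integral equation of [y] as [pi low(y) + y^k hi(y) = 0] with the constant term of [hi]
    a unit. As [y] is in the radical, [hi(y)] is left invertible in [B], so [y^k = pi c] with [c] in
    [B]; the integral equation of [c], rescaled by powers of [pi], is the required equation of
    [y]. *)
Lemma radical_residual_monomial y : jacobson *%R B y ->
  exists p, residual_monomial V p /\ central_eval y p = 0.
Proof.
move=> Jy; have ringV : subring *%R 1 V by case: hV.
have zV := subring_zsub ringV; have zB := subring_zsub ringB.
have [pi [Vpi hpi]] := hprin.
have hjB := jacobson_left_ideal ringB; have [_ _ _ jM] := hjB.
have By : B y by case: Jy.
have Bev q : polyV V q -> B (central_eval y q).
  move=> hq; rewrite -[q]coefK poly_def rmorph_sum; apply: (zsub_sum zB) => i _.
  rewrite -mul_polyC rmorphM rmorphXn /= central_evalC central_evalX.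
  by apply: (subringM ringB); [apply: BV | elim: (i : nat) => [|n IH]; rewrite ?expr0 ?exprS; [apply: (subring1 ringB) | apply: (subringM ringB)]].
have [p0 [mp0 Vp0 p0y]] := intB By.
(* The factor [X] makes the constant coefficient zero, so that the first unit coefficient has a
   positive index. *)
pose p := 'X * p0; have mp : p \is monic by rewrite monicMl ?monicX.
have Vp : polyV V p by case=> [|i]; rewrite coefXM //=; apply: (zsub0 zV).
have py : central_eval y p = 0 by rewrite rmorphM /= p0y mulr0.
have exk : exists k, `[< ~ JV V p`_k >].
  by exists (size p).-1; apply/asboolP; rewrite monic_lead //; apply: JV_not1.
case: (ex_minnP exk) => k /asboolP nk kmin.
have k0 : (0 < k)%N.
  by case: k nk {kmin} => // ; rewrite coefXM /= => /(_ (zsub0 (left_ideal_zsub (JV_left_ideal hV)))).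
have [pk0 Vpk] := JV_unit hV (Vp k) nk.
have lowP i : exists w, V w /\ ((i < k)%N -> p`_i = w * pi).
  case: (ltnP i k) => ik; last by exists 0; split=> //; apply: (zsub0 zV).
  have /hpi [w [Vw ->]] : JV V p`_i.
    by apply: contrapT => n; have := kmin i (asboolT n); rewrite leqNgt ik.
  by exists w.
have [v hv] := choice lowP.
pose low : {poly F} := \poly_(i < k) v i.
have elow : take_poly k p = pi%:P * low.
  apply/polyP=> i; rewrite coefCM coef_take_poly coef_poly; case: ltnP => ik; last by rewrite mulr0.
  by case: (hv i) => _ ->; rewrite // mulrC.
have Vlow : polyV V low by move=> i; rewrite coef_poly; case: ltnP => _; [case: (hv i) | apply: (zsub0 zV)].
pose hi := drop_poly k p.
have Vhi : polyV V hi by move=> i; rewrite coef_drop_poly.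
pose hi' := drop_poly 1 hi.
have Vhi' : polyV V hi' by move=> i; rewrite coef_drop_poly.
have ehi : hi = (p`_k)%:P + hi' * 'X.
  rewrite -{1}(poly_take_drop 1 hi) expr1; congr (_ + _); apply/polyP=> -[|i].
    by rewrite coef_take_poly coefC /= coef_drop_poly.
  by rewrite coef_take_poly coefC.
pose z := - (io (p`_k)^-1 * central_eval y hi') * y.
have Jz : jacobson *%R B z.
  by apply: jM => //; apply: (zsubN zB); apply: (subringM ringB); [apply: BV | apply: Bev].
have [u [Bu uz]] := jacobson_quasi_regular ringB Jz.
have ez : 1 - z = io (p`_k)^-1 * central_eval y hi.
  rewrite ehi rmorphD rmorphM /= central_evalC central_evalX mulrDr -rmorphM mulVf // rmorph1.
  by rewrite /z mulNr opprK mulrA.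
pose c := - (u * io (p`_k)^-1 * central_eval y low).
have Bc : B c.
  by apply: (zsubN zB); apply: (subringM ringB); [apply: (subringM ringB) => //; apply: BV | apply: Bev].
have yk : y ^+ k = io pi * c.
  have := py; rewrite -(poly_take_drop k p) elow rmorphD !rmorphM /= rmorphXn /= central_evalC central_evalX => /eqP.
  rewrite addrC addr_eq0 => /eqP e.
  rewrite -[LHS]mul1r -uz ez -!mulrA -/hi e /c !mulrN -!mulrA; congr (- _).
  by rewrite [RHS](io_central pi) (io_central pi (central_eval y low)) -!mulrA.
have [m [mm Vm mc]] := intB Bc.
pose N := (size m).-1; have szm : size m = N.+1 by rewrite (monic_size mm).
(* The lower part of [pi^N m(X^k / pi)]; since [i < N], each coefficient keeps a factor [pi]. *)
pose Q : {poly F} := \sum_(i < N) (m`_i * pi ^+ (N - i))%:P * 'X^(k * i).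
have Qlow j : JV V Q`_j.
  rewrite coef_sum; have zJ := left_ideal_zsub (JV_left_ideal hV); apply: (zsub_sum zJ) => i _.
  rewrite coefCM coefXn; case: eqP => _; last by rewrite mulr0; apply: (zsub0 zJ).
  rewrite mulr1; apply/hpi; exists (m`_i * pi ^+ (N - i).-1); split.
    by apply: (subringM ringV) => //; apply: (subringX ringV).
  by rewrite -mulrA -exprSr prednK // subn_gt0.
have szQ : (size Q <= k * N)%N.
  apply/leq_sizeP => j hj; rewrite coef_sum big1 // => i _; rewrite coefCM coefXn.
  by rewrite gtn_eqF ?mulr0 // (leq_trans _ hj) // ltn_pmul2l.
have szP : size ('X^(k * N) + Q) = (k * N).+1 by rewrite size_polyDl size_polyXn.
exists ('X^(k * N) + Q); split; first split.
- by rewrite monicE lead_coefDl ?size_polyXn // lead_coefXn.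
- by move=> j; rewrite szP /= => hj; rewrite coefD coefXn ltn_eqF // add0r.
rewrite rmorphD /= [X in X + _]rmorphXn /= central_evalX exprM yk.
have cpow i : (io pi * c) ^+ i = io pi ^+ i * c ^+ i by rewrite exprMn_comm //; apply: io_central.
have -> : central_eval y Q = \sum_(i < N) io m`_i * io pi ^+ N * c ^+ i.
  rewrite rmorph_sum; apply: eq_bigr => i _; rewrite rmorphM rmorphXn /= central_evalC central_evalX.
  rewrite exprM yk cpow rmorphM rmorphXn /= -!mulrA; congr (_ * _); rewrite mulrA -exprD subnK //.
  exact: ltnW.
move: mc; rewrite -{1}[m]coefK poly_def szm rmorph_sum big_ord_recr /=.
rewrite monic_lead // scale1r rmorphXn /= central_evalX => /eqP; rewrite addrC addr_eq0 => /eqP cN.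
rewrite cpow cN mulrN addrC; apply/eqP; rewrite subr_eq0; apply/eqP.
rewrite mulr_sumr; apply: eq_bigr => i _; rewrite -mul_polyC rmorphM rmorphXn /= central_evalC central_evalX.
by rewrite mulrA -rmorphXn [in RHS]io_central.
Qed.

End RadicalOfOrder.

(** * Orders in the crossed product and the left regular representation *)

Section Orders.
Variables (F : fieldType) (L : splittingFieldType F) (V : F -> Prop).
Hypotheses (hV : valuation_domain V) (hG : galois 1%VS (fullv : {subfield L})).
Notation S := (@intclos F L V).
Notation gal := (gal_of (fullv : {subfield L})).

Let ringS : subring *%R 1 S := intclos_subring L hV.
Let zS := subring_zsub ringS.
Let S0 : S 0 := zsub0 zS.
Let S1 : S 1 := subring1 ringS.
Let SM : forall x y, S x -> S y -> S (x * y) := subringM ringS.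
Let Sg (s : gal) x : S x -> S (s x). Proof. exact: intclos_gal. Qed.

(* [P] divides the product of its conjugates, which has coefficients in [V]. *)
Lemma conjugate_product (P : {poly L}) : P \is monic -> (forall k, S P`_k) ->
  exists p : {poly F}, [/\ p \is monic, polyV V p & P %| map_poly (in_alg L) p].
Proof.
move=> mP SP; set Q := \prod_(s : gal) map_poly s P.
have fixQ (t : gal) : map_poly t Q = Q.
  rewrite rmorph_prod /= [RHS](reindex_inj (mulIg t)) /=; apply: eq_bigr => s _.
  by apply/polyP=> k; rewrite !coef_map /= galMx.
have [c hc] := choice (fun i => gal_fixed hG (fun t => etrans (esym (coef_map t Q i)) (congr1 (fun Q : {poly L} => Q`_i) (fixQ t)))).
have e : map_poly (in_alg L) (\poly_(i < size Q) c i) = Q.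
  apply/polyP=> i; rewrite coef_map coef_poly; case: ltnP => h; first exact: esym.
  by rewrite nth_default //; exact: (rmorph0 (in_alg L)).
exists (\poly_(i < size Q) c i); split.
- by rewrite -(map_monic (in_alg L)) e monic_prod // => s _; rewrite map_monic.
- move=> i; apply: (algV_intclos (L := L) hV).
  have -> : ((\poly_(i < size Q) c i)`_i)%:A = Q`_i by rewrite -[in RHS]e coef_map.
  have : forall i, S Q`_i; last exact.
  apply: (big_ind (fun Q : {poly L} => forall i, S Q`_i)).
  + by move=> j; rewrite coef1; case: eqP.
  + move=> T T' hT hT' j; rewrite coefM; apply: (zsub_sum zS) => l _; exact: SM.
  + by move=> s _ j; rewrite coef_map; apply: Sg.
- rewrite e /Q (bigD1 1%g) //= (_ : map_poly _ P = P) ?dvdp_mulr //.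
  by apply/polyP=> k; rewrite coef_map /= gal1x.
Qed.

Variable f : gal -> gal -> L.
Hypothesis hf : normalized_cocycle V f.
Let Sf s t : S (f s t) := cocycle_int hf s t.
Local Notation R := (@Af F L V).
Lemma cpone_neq0 : (1 : cpRing hf) != 0.
Proof. by apply/eqP => /ffunP/(_ 1%g); rewrite !ffunE eqxx => /eqP; rewrite oner_eq0. Qed.

Definition cpNzRing : nzRingType := HB.pack (GRing.PzRing.sort (cpRing hf))
  (GRing.PzSemiRing_isNonZero.Build (cpRing hf) cpone_neq0).
Local Notation A := cpNzRing.

Let ringR : @subring A *%R 1 R := Af_subring hV hf.

Definition cpalg (a : F) : A := cpemb a%:A.

Let cpalgB : zmod_morphism cpalg.
Proof.
move=> a b; apply/ffunP=> u; rewrite cpB !ffunE scalerBl.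
by case: eqP => //; rewrite subrr.
Qed.

Let cpalgM : monoid_morphism cpalg.
Proof.
split; first by rewrite /cpalg scale1r.
move=> a b; apply/ffunP=> u; rewrite (emb_mulE hf) !ffunE -[(a * b)%:A]/(in_alg L _) rmorphM.
by case: eqP; rewrite ?mulr0.
Qed.

HB.instance Definition _ := GRing.isZmodMorphism.Build F A cpalg cpalgB.
HB.instance Definition _ := GRing.isMonoidMorphism.Build F A cpalg cpalgM.

Lemma cpalg_central a (x : A) : cpalg a * x = x * cpalg a.
Proof.
apply/ffunP=> u; rewrite (emb_mulE hf) [RHS](mul_embE hf).
by rewrite rmorph_alg mulrC.
Qed.

Lemma central_eval_sum (b : A) (p : {poly F}) :
  central_eval cpalg_central b p =
  \sum_(i < size p) cpmul f (cpemb (in_alg L p`_i)) (cppow f b i).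
Proof.
have powE i : cppow f b i = b ^+ i by elim: i => [|i IH] //=; rewrite IH exprS.
rewrite -[in LHS](coefK p) poly_def rmorph_sum; apply: eq_bigr => i _.
by rewrite -mul_polyC rmorphM rmorphXn /= central_evalC central_evalX powE.
Qed.

Lemma Vorder_of_integral (B : A -> Prop) : @subring A *%R 1 B -> (forall x, R x -> B x) ->
  (forall b, B b -> exists p, [/\ p \is monic, polyV V p & central_eval cpalg_central b p = 0]) ->
  Vorder V f B.
Proof.
move=> ringB RB intB; split=> //.
- by move=> v Vv; apply: RB; apply: (Af_emb hV); apply: (intclos_alg L hV).
- move=> q; have [a [Va a0 ha]] := intclos_denominators hV hG (fun s => q s).
  exists 1%N, (fun=> cpmul f q (cpemb a%:A)), (fun=> a^-1); split.
    by move=> _; apply: RB => s; rewrite (mul_embE hf) rmorph_alg mulrC.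
  rewrite big_ord1 -[cpemb (in_alg L _)]/(cpalg _) -[cpemb _]/(cpalg a).
  have e : (q : A) = (q : A) * cpalg a * cpalg a^-1 by rewrite -mulrA -rmorphM mulfV // rmorph1 mulr1.
  exact: e.
- by move=> b /intB [p [mp Vp e]]; exists p; split=> //; rewrite -central_eval_sum.
Qed.

Section Representation.
Variables (n : nat) (g : 'I_n.+1 -> gal).
Hypothesis bij_g : bijective g.
Variable w : gal -> L.
Hypothesis w0 : forall s, w s != 0.

(* Left multiplication, in the basis [x_s w_s] of the crossed product as a right [L]-space. *)
Definition left_mx (b : A) : 'M[L]_n.+1 := \matrix_(i, j)
  ((w (g i))^-1 * ((g i)^-1 : gal)%g (cpmul f b (mono (g j) 1) (g i)) * w (g j)).

Let sum_g (h : gal -> L) : \sum_i h (g i) = \sum_s h s.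
Proof. by rewrite [RHS](reindex g) //; apply: onW_bij. Qed.

Lemma left_mxB : zmod_morphism left_mx.
Proof.
move=> b c; apply/matrixP=> i j.
have e : cpmul f (b - c) (mono (g j) 1) = cpmul f b (mono (g j) 1) - cpmul f c (mono (g j) 1).
  exact: (@mulrBl A).
by rewrite !mxE e cpB rmorphB /= mulrBr mulrBl.
Qed.

Lemma left_mxM : monoid_morphism left_mx.
Proof.
split.
  apply/matrixP=> i j; rewrite !mxE (cpmul1l hf) ffunE (bij_eq bij_g).
  by case: eqP => [->|_]; rewrite ?rmorph1 ?mulr1 ?mulVf // rmorph0 mulr0 mul0r.
move=> b c; apply/matrixP=> i j; rewrite !mxE.
have -> : cpmul f (b * c) (mono (g j) 1) = cpmul f b (cpmul f c (mono (g j) 1)).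
  by rewrite (cpmulA hf).
set d := cpmul f c _; under eq_bigr => k _ do rewrite !mxE -/d.
rewrite (sum_g (fun s => (w (g i))^-1 * ((g i)^-1 : gal)%g (cpmul f b (mono s 1) (g i)) * w s *
  ((w s)^-1 * (s^-1)%g (d s) * w (g j)))).
have -> : cpmul f b d (g i) = \sum_s cpmul f b (mono s 1) (g i) * g i ((s^-1)%g (d s)).
  rewrite {1}(mono_sum d) (_ : cpmul f b _ = \sum_s (b : A) * (mono s (d s) : A)); last by rewrite -mulr_sumr.
  rewrite sum_ffunE; apply: eq_bigr => s _; rewrite -(mul_embE hf).
  rewrite -(cpmulA hf); congr (cpmul f b _ (g i)).
  apply/ffunP=> u; rewrite (mul_embE hf) !ffunE.
  by case: eqP => [->|_]; rewrite ?mul0r // mul1r galVKx.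
rewrite rmorph_sum mulr_sumr mulr_suml; apply: eq_bigr => s _.
by rewrite rmorphM /= galKx; field; rewrite !w0.
Qed.

HB.instance Definition _ := GRing.isZmodMorphism.Build A 'M[L]_n.+1 left_mx left_mxB.
HB.instance Definition _ := GRing.isMonoidMorphism.Build A 'M[L]_n.+1 left_mx left_mxM.

Lemma left_mx_alg a : left_mx (cpalg a) = a%:A%:M.
Proof.
apply/matrixP=> i j; rewrite !mxE (emb_mulE hf) ffunE (bij_eq bij_g).
case: eqP => [->|_]; last by rewrite mulr0 rmorph0 mulr0 mul0r.
by rewrite mulr1 rmorph_alg mulrAC mulVf // mul1r.
Qed.

Lemma left_mx_inj b : left_mx b = 0 -> b = 0.
Proof.
have [h hg gh] := bij_g.
move=> /matrixP e; apply/ffunP=> s; rewrite ffunE.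
have := e (h s) (h 1%g); rewrite !mxE !gh => /eqP; rewrite !mulf_eq0 invr_eq0 !(negPf (w0 _)) orbF /=.
rewrite fmorph_eq0 mul_monoE invg1 mul1g (cocycle1r hf) rmorph1 !mulr1.
by move=> /eqP.
Qed.

Lemma left_mx_trace b : \tr (left_mx b) = \sum_(s : gal) s (b 1%g).
Proof.
rewrite [RHS](reindex_inj invg_inj) /= -(sum_g (fun s => (s^-1 : gal)%g (b 1%g))).
apply: eq_bigr => i _.
by rewrite mxE mul_monoE mulVg (cocycle1l hf) gal1x !mulr1 mulrAC mulVf ?mul1r.
Qed.

Lemma left_mx_eval b p : left_mx (central_eval cpalg_central b p) =
  horner_mx (left_mx b) (map_poly (in_alg L) p).
Proof.
rewrite -[in LHS](coefK p) -[in RHS](coefK p) !poly_def !rmorph_sum; apply: eq_bigr => i _.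
rewrite -mul_polyC !rmorphM !rmorphXn /= central_evalC central_evalX map_polyC map_polyX.
by rewrite horner_mx_C horner_mx_X left_mx_alg.
Qed.

(** The characteristic polynomial has its coefficients in [S] only; it divides a monic polynomial
    over [V] by [conjugate_product]. *)
Lemma left_mx_integral b : (forall i j, S (left_mx b i j)) ->
  exists p, [/\ p \is monic, polyV V p & central_eval cpalg_central b p = 0].
Proof.
move=> Sb; have [p [mp Vp /dvdpP [q hq]]] := conjugate_product (char_poly_monic _) (char_poly_sub ringS Sb).
exists p; split=> //; apply: left_mx_inj.
by rewrite left_mx_eval hq rmorphM /= Cayley_Hamilton mulr0.
Qed.

End Representation.

Lemma gal_enumeration : exists n (g : 'I_n.+1 -> gal), bijective g.
Proof.
have N0 : (0 < #|{: gal}|)%N by apply/card_gt0P; exists 1%g.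
exists #|{: gal}|.-1, (fun i => enum_val (cast_ord (prednK N0) i)).
exists (fun s => cast_ord (esym (prednK N0)) (enum_rank s)) => i.
  by rewrite enum_valK cast_ordK.
by rewrite cast_ordKV enum_rankK.
Qed.

Lemma Af_Vorder : Vorder V f R.
Proof.
have [n [g bij_g]] := gal_enumeration.
apply: Vorder_of_integral => // b Rb.
apply: (left_mx_integral bij_g (w := fun=> 1)); first by move=> s; apply: oner_neq0.
move=> i j; rewrite mxE invr1 mul1r mulr1; apply: Sg.
by case: ringR => _ _ _; apply=> //; apply: (Af_mono hV).
Qed.

End Orders.

(** * Extremality and square-free cocycles *)

Section Extremality.
Variables (F : fieldType) (L : splittingFieldType F) (V : F -> Prop).
Hypotheses (hV : valuation_domain V) (hG : galois 1%VS (fullv : {subfield L})).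
Notation S := (@intclos F L V).
Notation gal := (gal_of (fullv : {subfield L})).
Variables (r : nat) (Ms : 'I_r -> L -> Prop).
Hypotheses (hs : spectrum V Ms) (htr : trace_units V Ms) (hprin : principal_JV V).

Let ringV : subring *%R 1 V. Proof. by case: hV. Qed.
Let ringS : subring *%R 1 S := intclos_subring L hV.
Let zS := subring_zsub ringS.
Let S1 : S 1 := subring1 ringS.
Let SM : forall x y, S x -> S y -> S (x * y) := subringM ringS.
Let Sg (s : gal) x : S x -> S (s x). Proof. exact: intclos_gal. Qed.
Let hMs : forall i, maxS V (Ms i). Proof. by case: hs. Qed.

Lemma locS_valuation M : maxS V M -> @valuation_domain L (locS V M).
Proof.
move=> hM; split; last by move=> x; apply: (locS_total hV hG hM).
have l_int := locS_int hV hM; split.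
- by apply: l_int; apply: (zsub0 zS).
- exact: l_int.
- move=> x y lx ly; rewrite -mulN1r; apply: (locSD hV hM) => //.
  by apply: (locSM hV hM) => //; apply: l_int; apply: (zsubN zS).
- by move=> x y; apply: (locSM hV hM).
Qed.

Lemma locS_radical_alg M a : maxS V M -> @JV L (locS V M) a%:A <-> JV V a.
Proof.
move=> hM; rewrite (JVP (locS_valuation hM)); split=> [[la ninv]|Ja].
  have notV : a != 0 -> ~ V a^-1.
    move=> a0 Vi; apply: ninv; first by rewrite -in_algE fmorph_eq0.
    rewrite -in_algE -fmorphV /=; apply: (locS_int hV hM); exact: (intclos_alg L hV).
  apply/(JVP hV); split=> //.
  have [->|a0] := eqVneq a 0; first exact: (zsub0 (subring_zsub ringV)).
  by case: (valuation_total hV a0) => // /(notV a0).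
have Va : V a by have /(JVP hV) [] := Ja.
split; first by apply: (locS_int hV hM); apply: (intclos_alg L hV).
move=> a0 [t [St nt Sta]]; apply: nt; rewrite -(divfK a0 t); apply: (maxSM hM) => //.
exact: (maxS_JV hV hG).
Qed.

Variable f : gal -> gal -> L.
Hypothesis hf : normalized_cocycle V f.
Let Sf s t : S (f s t) := cocycle_int hf s t.
Local Notation R := (@Af F L V).
Local Notation J := (radical_ideal V f).
Local Notation A := (cpNzRing hf).
Let hJ : @left_ideal A *%R R J := radical_ideal_left hV hf.

(* The characteristic polynomial of left multiplication by [y] divides a power of a polynomial
   which is a power of the variable modulo [JV]; by Gauss its trace is in [JV]. *)
Lemma radical_trace (B : A -> Prop) y : Vorder V f B -> @jacobson A *%R B y ->
  exists a, JV V a /\ \sum_(s : gal) s (y 1%g) = a%:A.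
Proof.
move=> [ringB BV _ intB] Jy.
have [|b /intB [p [mp Vp e]]|p [[mp Jp] py]] := radical_residual_monomial hV hprin (io_central := cpalg_central (hf := hf)) (B := B) ringB _ _ Jy.
- by move=> a Va; apply: BV.
- by exists p; rewrite central_eval_sum.
have [n [g bij_g]] := gal_enumeration L.
have w0 (s : gal) : (1 : L) != 0 by apply: oner_neq0.
pose D := left_mx g (fun=> 1) y.
have [i _] : exists i0 : 'I_r, True by case: hs => _ _ cMs; have [M /cMs [i _]] := exists_maxS L hV; exists i.
have hO := locS_valuation (hMs i).
have resP : residual_monomial (locS V (Ms i)) (map_poly (in_alg L) p).
  split; first by rewrite map_monic.
  by move=> k; rewrite size_map_poly coef_map => /Jp /(locS_radical_alg _ (hMs i)).
have /char_poly_dvd_horner/dvdpP [q eq] : horner_mx D (map_poly (in_alg L) p) = 0.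
  by rewrite -(left_mx_eval bij_g w0) py; exact: (rmorph0 (left_mx g (fun=> 1))).
have := residual_monomialX hO n.+1 resP; rewrite eq mulrC => resq.
have mD := char_poly_monic D.
have mq : q \is monic by case: resq; rewrite monicMl.
have [_ /(_ n)] := residual_monomial_factor hO mD mq resq.
rewrite size_char_poly /= => /(_ (ltnSn n)).
rewrite (char_poly_trace D) // => Jtr.
have [a ea] := trace_F hG (y 1%g); exists a; split=> //.
apply/(locS_radical_alg _ (hMs i)); rewrite -ea -(left_mx_trace bij_g w0) -[\tr _]opprK.
exact: (zsubN (left_ideal_zsub (JV_left_ideal hO))).
Qed.

(** For [b] in [B] and [j] in [J] supported at [s^-1], [b j] lies in [J(B)], so its trace is in
    [J(V)]. As [j] may be multiplied by any element of [S], [trace_small] puts [b_s z f(s, s^-1)] in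
    [J(S)], and [coefficient_int] concludes. *)
Lemma square_free_extremal : square_free V f -> extremal V f R.
Proof.
move=> sf; split; first exact: (Af_Vorder hV hG).
have [J0|[pi [pi0 hpi]]] := principal_cases hprin.
  by move=> B _ _ _ x _ s; apply: (trivial_valuation_full hV hG J0).
move=> B hB RB JB b Bb s; apply: (coefficient_int hV hG hs hf hpi pi0 (s := s) sf) => z gz.
apply: (trace_small hV hG hs htr) => t St.
have gz' := generator_gal hV hs hf gz.
pose j := cpmul f (cpemb ((s^-1)%g t)) (mono (s^-1)%g ((s^-1)%g z)).
have Jj : J j by apply: (radical_idealMl hV hf); [apply: (Af_emb hV); apply: Sg | apply: (generator_mono hV hs)].
have [ringB _ _ _] := hB.
have Jb : jacobson (cpmul f) B (cpmul f b j).
  have [_ _ _] := @jacobson_left_ideal A B ringB; apply=> //.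
  by apply: JB; have := jacobsonE hV hs htr hf; rewrite /JAf => ->.
have [a [Ja ea]] := radical_trace hB Jb; exists a; split=> //; rewrite -ea.
apply: eq_bigr => u _; congr (u _).
rewrite /j (cpmulA hf) mul_monoE invgK mulg1 (mul_embE hf) !galVKx.
ring.
Qed.

Section NonTrivialValuation.
Variable pi : F.
Hypotheses (hpi : forall x, JV V x <-> exists v, V v /\ x = v * pi) (pi0 : pi != 0).

(** The [x_s w_s] with [w_s = s^-1(z_s)] form a basis of [J] as a right [S]-module; an element
    mapping [J] into itself has an integral matrix in this basis, hence is integral over [V]. *)
Lemma Ol_Vorder : Vorder V f (Ol f J).
Proof.
have zJ := left_ideal_zsub hJ; have [z hz] := choice (generator_exists hV hG hs f hpi pi0).
have z0 s : z s != 0 by apply: (uniformizer_neq0 hV hs (hz s)).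
have [n [g bij_g]] := gal_enumeration L.
apply: (Vorder_of_integral hV hG (hf := hf)).
- split.
  + by move=> y _; have := zsub0 zJ; rewrite -[X in J X](@mul0r A y).
  + by move=> y Jy; rewrite (cpmul1l hf).
  + move=> x y Ox Oy j Jj; have := zsubB zJ (Ox j Jj) (Oy j Jj).
    by rewrite -(@mulrBl A j x y).
  + by move=> x y Ox Oy j Jj; rewrite -(cpmulA hf); apply: Ox; apply: Oy.
- by move=> x Rx j Jj; apply: (radical_idealMl hV hf).
- move=> b Ob.
  apply: (left_mx_integral hV hG bij_g (w := fun s : gal => (s^-1 : gal)%g (z s))).
    by move=> s; rewrite fmorph_eq0.
  move=> i j; rewrite mxE; move: (g i) (g j) => s t.
  have Jm : J (mono t (z t)).
    by have := @generator_mono _ _ _ hV _ _ hs f t^-1%g (z t); rewrite invgK; apply; apply: hz.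
  have [Sb hb] := Ob _ Jm s.
  have /(Sg (s^-1)%g) : S (cpmul f b (mono t (z t)) s / z s).
    by apply: (uniformizer_div hV hG hs (hz s)) => // k tk; apply: hb.
  rewrite !mul_monoE rmorph1 mulr1 !rmorphM /= fmorphV galMx galKx.
  by congr S; ring.
Qed.

(** [J] is a left ideal of [O_l(J)], and the left inverses of the [1 - j] found in [A_f] stay
    available there, so [J] lies in the radical of the larger order. *)
Lemma extremal_square_free : extremal V f R -> square_free V f.
Proof.
move=> [_ ext]; apply: (Ol_square_free hV hG hs hf hpi pi0) => x.
have [ringO _ _ _] := Ol_Vorder.
have RO y : R y -> Ol f J y by move=> Ry j Jj; apply: (radical_idealMl hV hf).
apply: ext => [|//|y]; first exact: Ol_Vorder.
have -> : jacobson (cpmul f) R y = J y by have := jacobsonE hV hs htr hf; rewrite /JAf => ->.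
apply: (@quasi_regular_jacobson A (Ol f J) ringO J).
  have [sJ J0 BJ _] := hJ; split=> //.
  - by move=> j Jj; apply: RO; apply: sJ.
  - by move=> x' j Ox' Jj; apply: Ox'.
move=> j Jj; have [u [Ru eu]] := radical_quasi_regular hV hs Jj (hf := hf).
by exists u; split=> //; apply: RO.
Qed.

End NonTrivialValuation.
End Extremality.

(** * The opposite cocycle *)

Section Transport.
Variables (T : zmodType) (mul mul' : T -> T -> T) (one one' : T) (th th' : T -> T).
Hypotheses (thK : cancel th th') (th'K : cancel th' th).
Hypotheses (thB : forall x y, th (x - y) = th x - th y) (thM : forall x y, th (mul x y) = mul' (th x) (th y)).
Hypothesis th1 : th one = one'.

Let th0 : th 0 = 0. Proof. by rewrite -[X in th X](subrr 0) thB subrr. Qed.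
Let thD x y : th (x + y) = th x + th y.
Proof. by rewrite -[X in x + X]opprK thB -[- y]sub0r thB th0 sub0r opprK. Qed.

Lemma lprojective_transport (R I : T -> Prop) :
  lprojective mul one (fun x => R (th x)) (fun x => I (th x)) -> lprojective mul' one' R I.
Proof.
move=> proj M N actM actN [M1 M2 M3 M4] [N1 N2 N3 N4] p [pB pM] surj g [gB gM].
have [||||h [[hB hM] hp]] := proj M N (fun r => actM (th r)) (fun r => actN (th r)) _ _ p _ surj (fun x => g (th x)) _.
- split.
  + by move=> r m n Rr; apply: M1.
  + by move=> r s m Rr Rs; rewrite thD; apply: M2.
  + by move=> r s m Rr Rs; rewrite thM; apply: M3.
  + by move=> m; rewrite th1.
- split.
  + by move=> r m n Rr; apply: N1.
  + by move=> r s m Rr Rs; rewrite thD; apply: N2.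
  + by move=> r s m Rr Rs; rewrite thM; apply: N3.
  + by move=> m; rewrite th1.
- by split=> // r m Rr; apply: pM.
- by split=> [x y Ix Iy|r x Rr Ix]; [rewrite thB; apply: gB | rewrite thM; apply: gM].
have th'B x y : th' (x - y) = th' x - th' y by apply: (can_inj thK); rewrite thB !th'K.
have th'M x y : th' (mul' x y) = mul (th' x) (th' y) by apply: (can_inj thK); rewrite thM !th'K.
exists (fun x => h (th' x)); split; [split|].
- by move=> x y Ix Iy; rewrite th'B hB // th'K.
- by move=> r x Rr Ix; rewrite th'M hM ?th'K.
- by move=> x Ix; rewrite hp th'K.
Qed.

Lemma lgen_transport (R : T -> Prop) gs x :
  lgen mul (fun y => R (th y)) gs x <-> lgen mul' R (map th gs) (th x).
Proof.
elim: gs x => [|g gs IH] x /=.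
  by split=> [->|e]; [rewrite th0 | apply: (can_inj thK); rewrite e th0].
split=> [[a [y [Ra /IH hy ->]]]|[a [y [Ra hy e]]]].
  by exists (th a), (th y); rewrite thD thM.
exists (th' a), (th' y); split; [by rewrite th'K | by apply/IH; rewrite th'K |].
by apply: (can_inj thK); rewrite thD thM !th'K.
Qed.

End Transport.

Section OppositeCocycle.
Variables (F : fieldType) (L : splittingFieldType F) (V : F -> Prop).
Hypotheses (hV : valuation_domain V) (hG : galois 1%VS (fullv : {subfield L})).
Notation S := (@intclos F L V).
Notation gal := (gal_of (fullv : {subfield L})).

Let Sg (s : gal) x : S x -> S (s x). Proof. exact: intclos_gal. Qed.

Definition opp_cocycle (f : gal -> gal -> L) (s t : gal) : L := s (t (f (t^-1)%g (s^-1)%g)).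

(* [x_s a |-> a x_(s^-1)], an anti-isomorphism onto the crossed product of [opp_cocycle f]. *)
Definition opp_map (a : cpT L) : cpT L := [ffun s : gal => s (a (s^-1)%g)].

Lemma opp_mapK : involutive opp_map.
Proof. by move=> a; apply/ffunP=> s; rewrite !ffunE invgK galVKx. Qed.

Lemma opp_mapB a b : opp_map (a - b) = opp_map a - opp_map b.
Proof. by apply/ffunP=> s; rewrite cpB !ffunE rmorphB. Qed.

Lemma opp_map1 : opp_map (cpone L) = cpone L.
Proof.
apply/ffunP=> s; rewrite !ffunE (can2_eq invgK invgK) invg1.
by case: eqP => _; rewrite ?rmorph1 ?rmorph0.
Qed.

Lemma opp_map_Af a : Af V (opp_map a) <-> Af V a.
Proof.
split=> h s; last by rewrite ffunE; apply: Sg.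
by have := Sg s (h (s^-1)%g); rewrite ffunE invgK galVKx.
Qed.

Variable f : gal -> gal -> L.
Hypothesis hf : normalized_cocycle V f.

Lemma opp_cocycle_normalized : normalized_cocycle V (opp_cocycle f).
Proof.
split.
- move=> s t; split; first by do 2?apply: Sg; apply: (cocycle_int hf).
  by rewrite !fmorph_eq0; apply: (cocycle_neq0 hf).
- move=> s t g; rewrite /gcomp /opp_cocycle !galMx !invMg.
  have e := cocycleE hf (g^-1)%g (t^-1)%g (s^-1)%g.
  have := congr1 (fun x => s (t (g x))) e.
  by rewrite !rmorphM /= galVKx => <-.
- by move=> s; rewrite /opp_cocycle !invg1 (cocycle1l hf) (cocycle1r hf) !rmorph1.
Qed.

(** The values that decide (4) and the shape of [J] are unchanged, so both pass to the opposite
    side. *)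
Lemma opp_cocycle_inv s : opp_cocycle f s (s^-1)%g = f s (s^-1)%g.
Proof. by rewrite /opp_cocycle invgK galVKx. Qed.

Lemma opp_square_free : square_free V (opp_cocycle f) <-> square_free V f.
Proof. by split=> h M hM s; have := h M hM s; rewrite opp_cocycle_inv. Qed.

Lemma opp_mapM a b : opp_map (cpmul f a b) = cpmul (opp_cocycle f) (opp_map b) (opp_map a).
Proof.
apply/ffunP=> u; rewrite ffunE !cpmulE rmorph_sum.
rewrite (reindex_inj (mulIg u^-1)%g) /=; apply: eq_bigr => t _.
have e1 : (u^-1 * (t * u^-1)^-1 = t^-1)%g by rewrite invMg invgK mulKg.
have e2 x : t ((u * t^-1)%g x) = u x by rewrite -galMx mulgKV.
have e3 : ((u * t^-1)^-1 = t * u^-1)%g by rewrite invMg invgK.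
rewrite !ffunE /opp_cocycle !rmorphM /= e1 e3 !e2 -galMx mulgKV.
ring.
Qed.

End OppositeCocycle.

(** * Comparison of the conditions *)

Section Equivalences.
Variables (F : fieldType) (L : splittingFieldType F) (V : F -> Prop).
Hypotheses (hV : valuation_domain V) (hG : galois 1%VS (fullv : {subfield L})).
Notation gal := (gal_of (fullv : {subfield L})).
Variables (r : nat) (Ms : 'I_r -> L -> Prop).
Hypotheses (hs : spectrum V Ms) (htr : trace_units V Ms) (hprin : principal_JV V).
Variable f : gal -> gal -> L.
Hypothesis hf : normalized_cocycle V f.
Let hf' : normalized_cocycle V (opp_cocycle f) := opp_cocycle_normalized hf.
Local Notation R := (@Af F L V).
Local Notation J := (radical_ideal V f).
Let ringR : @subring (cpRing hf) *%R 1 R := Af_subring hV hf.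
Let hJ : @left_ideal (cpRing hf) *%R R J := radical_ideal_left hV hf.

Lemma opp_map_radical a : radical_ideal V (opp_cocycle f) (opp_map a) <-> J a.
Proof.
split=> Ja s; last first.
  rewrite ffunE opp_cocycle_inv; have [Sa ha] := Ja (s^-1)%g.
  split=> [|M hM nt]; first exact: intclos_gal.
  by apply: (ha _ (maxS_gal hV s hM)); rewrite invgK (cocycle_swap hf).
have := Ja (s^-1)%g; rewrite ffunE opp_cocycle_inv invgK => -[Sa ha].
split=> [|M hM nt]; first by have := intclos_gal s Sa; rewrite galVKx.
by have := ha _ (maxS_gal hV s hM); rewrite galVKx (cocycle_swap hf); apply.
Qed.

Let opp_mulE a b : opp_map (cpmul (opp_cocycle f) a b) = opmul (cpmul f) (opp_map a) (opp_map b).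
Proof. by rewrite -{1}[a]opp_mapK -{1}[b]opp_mapK -opp_mapM opp_mapK. Qed.

Lemma square_free_right_semihereditary (gs : seq (cpT L)) : square_free V f ->
  (forall g, g \in gs -> R g) ->
  lprojective (opmul (cpmul f)) (cpone L) R (lgen (opmul (cpmul f)) R gs).
Proof.
move=> sf Rgs; apply: (lprojective_transport (@opp_mapK F L) (@opp_mapK F L) (@opp_mapB F L) opp_mulE (@opp_map1 F L)).
have eR : (fun x => R (opp_map x)) = R.
  by apply/funext => x; apply/propext; apply: (opp_map_Af V x).
have -> : (fun x => lgen (opmul (cpmul f)) R gs (opp_map x)) = lgen (cpmul (opp_cocycle f)) R (map (@opp_map F L) gs).
  apply/funext => x; apply/propext; apply: iff_sym.
  have := lgen_transport (@opp_mapK F L) (@opp_mapK F L) (@opp_mapB F L) opp_mulE R (map (@opp_map F L) gs) x.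
  by rewrite eR mapK //; apply: opp_mapK.
have sf' : square_free V (opp_cocycle f) by apply/(opp_square_free V f).
have Rgs' g : g \in map (@opp_map F L) gs -> R g.
  by move=> /mapP [h /Rgs Rh ->]; apply/(opp_map_Af V h).
rewrite eR; exact: (square_free_left_semihereditary hV hG hs htr hprin (hf := hf') sf' Rgs').
Qed.

Lemma square_free_semihereditary : square_free V f -> semihereditary (cpmul f) (cpone L) R.
Proof.
move=> sf gs Rgs; split; first exact: (square_free_left_semihereditary hV hG hs htr hprin (hf := hf) sf Rgs).
exact: square_free_right_semihereditary.
Qed.

Let jacE : JAf V f = J := jacobsonE hV hs htr hf.

Lemma semihereditary_projective :
  semihereditary (cpmul f) (cpone L) R -> projective_ideal (cpmul f) (cpone L) R (JAf V f).
Proof.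
rewrite jacE => sh.
suff [gs [Rgs [e1 e2]]] : exists gs : seq (cpT L), (forall g, g \in gs -> R g) /\
    (J = lgen (cpmul f) R gs /\ J = lgen (opmul (cpmul f)) R gs).
  by have [p1 p2] := sh gs Rgs; split; [rewrite e1 | rewrite e2].
have [J0|[pi [pi0 hpi]]] := principal_cases hprin.
  exists [::]; split=> //; have e : J = fun x => x = 0.
    apply/funext => x; apply/propext; split; first exact: (trivial_valuation_radical hV hG hf J0).
    by move=> ->; case: hJ.
  by split; rewrite e.
have [gs [Jgs [e1 e2]]] := radical_generators hV hG hs hf hpi pi0; exists gs; split.
  by move=> g /Jgs; case: hJ => + _ _ _; apply.
by split; apply/funext => x; apply/propext; [apply: e1 | apply: e2].
Qed.

(** Over the opposite ring, right projectivity becomes left projectivity, and the dual basis gives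
    [\sum_i g_i y_i = 1] with [y_i J] in [A_f]. This bounds [{x | J x <= J}], which corresponds
    under [opp_map] to the left order of the radical for the opposite cocycle; and (4) is the same
    for both cocycles. *)
Lemma projective_square_free :
  projective_ideal (cpmul f) (cpone L) R (JAf V f) -> square_free V f.
Proof.
rewrite jacE => -[_ proj].
have [J0|[pi [pi0 hpi]]] := principal_cases hprin; first exact: (trivial_valuation_square_free hV hG hf J0).
have [gs [Jgs [gen1 gen2]]] := radical_generators hV hG hs hf hpi pi0.
have ringRc : @subring (cpRing hf)^c *%R 1 R.
  by case: ringR => R0 R1 RB RM; split=> // a b Ra Rb; apply: RM.
have hJc : @left_ideal (cpRing hf)^c *%R R J.
  by case: hJ => sJ J0 JB _; split=> // a b Ra Jb; apply: (radical_idealMr hV hf).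
(* [pi] is the central unit inside [J] required by [lprojective_dual_basis] and
   [radical_order_sub]. *)
pose p : cpRing hf := cpemb pi%:A; pose q : cpRing hf := cpemb (pi^-1)%:A.
have hpM i : Ms i pi%:A.
  by apply: (maxS_JV hV hG); [case: hs | apply/hpi; exists 1; rewrite mul1r; split=> //; case: hV => -[]].
have Jp : J p.
  apply: (radical_ideal_small hV) => s M hM; have [_ _ /(_ M hM) [i ->]] := hs.
  rewrite ffunE; case: eqP => _ //; apply: (zsub0 (maxS_zsub _)); by case: hs => hMs _ _; apply: hMs.
have pq : q * p = 1.
  rewrite [LHS](emb_mul hf) -[_ * _]/(in_alg L _ * in_alg L _) -rmorphM mulVf //.
  by rewrite rmorph1.
have pC x : p * x = x * p := cpalg_central (hf := hf) pi x.
have gen x : J x -> exists c : 'rV[(cpRing hf)^c]_(size gs), (forall i, R (c 0 i)) /\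
    x = (c *m \col_i (gs : seq (cpRing hf)^c)`_i) 0 0.
  by move=> /gen2 h; apply/(@lgenP (cpRing hf)^c R gs x).
have genl x : J x -> exists c : 'rV[cpRing hf]_(size gs), (forall i, R (c 0 i)) /\
    x = (c *m \col_i (gs : seq (cpRing hf))`_i) 0 0.
  by move=> /gen1 h; apply/(@lgenP (cpRing hf) R gs x).
have Jg i : J ((\col_(i < size gs) (gs : seq (cpRing hf))`_i) i 0) by rewrite mxE; apply: Jgs; apply: mem_nth.
have [y [Ry yg]] := lprojective_dual_basis ringRc hJc gen Jg proj Jp (fun x => esym (pC x)) (etrans (pC q) pq).
apply/(opp_square_free V f); apply: (Ol_square_free hV hG hs hf' hpi pi0) => x Ox.
apply/(opp_map_Af V x).
apply: (radical_order_sub ringR hJ (a := \row_i gs`_i) (b := \col_i y 0 i) (g := \col_i (gs : seq (cpRing hf))`_i) (p := p) (q := q)) => //.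
- exact: (Af_semisimple hV hs htr).
- exact: (radical_quasi_regular hV hs).
- exact: (radical_idealMr hV hf).
- by move=> i; have := Jg i; rewrite !mxE.
- by move=> i z Jz; rewrite mxE; apply: Ry.
- have /matrixP/(_ 0 0) := yg; rewrite !mxE => e; apply/matrixP=> i j; rewrite !ord1 !mxE -[RHS]e.
  by apply: eq_bigr => k _; rewrite !mxE.
- exact: cp_dedekind_finite.
move=> z Jz; apply/opp_map_radical; rewrite opp_mapM opp_mapK.
by apply: Ox; apply/opp_map_radical.
Qed.

End Equivalences.

Theorem theorem3p4 (F : fieldType) (L : splittingFieldType F) (V : F -> Prop)
    (f : gal_of (fullv : {subfield L}) -> gal_of (fullv : {subfield L}) -> L) :
  valuation_domain V -> principal_JV V -> galois 1%VS (fullv : {subfield L}) ->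
  tame_defectless L V -> normalized_cocycle V f ->
  [<-> semihereditary (cpmul f) (cpone L) (Af V);
       extremal V f (Af V);
       (forall x, Ol f (JAf V f) x <-> Af V x);
       (forall M, maxS V M -> forall s, ~ ideal_sq M (f s s^-1%g));
       (forall M, maxS V M -> forall s t, ~ ideal_sq M (f s t));
       projective_ideal (cpmul f) (cpone L) (Af V) (JAf V f)]
  /\ (semihereditary (cpmul f) (cpone L) (Af V) ->
      forall M, maxS V M -> gr_chain f M).
Proof.
move=> hV hprin hG tame hf.
have [r [Ms [hs htr]]] := tame_trace_units hV hG tame.
have jE : JAf V f = radical_ideal V f := jacobsonE hV hs htr hf.
have semi_sf : semihereditary (cpmul f) (cpone L) (Af V) -> square_free V f.
  by move=> sh; apply: (projective_square_free hV hG hs htr hprin hf); apply: (semihereditary_projective hV hG hs htr hprin hf).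
split; last by move=> /semi_sf sf M hM; apply: (square_free_chain hV hf sf hM).
have extr_sf : extremal V f (Af V) -> square_free V f.
  have [J0 _|[pi [pi0 hpi]]] := principal_cases hprin.
    exact: (trivial_valuation_square_free hV hG hf J0).
  exact: (extremal_square_free hV hG hs htr hf hpi pi0).
have Ol_sf : (forall x, Ol f (JAf V f) x <-> Af V x) -> square_free V f.
  rewrite jE => h; have [J0|[pi [pi0 hpi]]] := principal_cases hprin.
    exact: (trivial_valuation_square_free hV hG hf J0).
  by apply: (Ol_square_free hV hG hs hf hpi pi0) => x /h.
have sf_Ol : square_free V f -> forall x, Ol f (JAf V f) x <-> Af V x.
  rewrite jE => sf x; split=> [Ox|Rx y Jy]; last exact: (radical_idealMl hV hf).
  have [J0|[pi [pi0 hpi]]] := principal_cases hprin.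
    by move=> s; apply: (trivial_valuation_full hV hG J0).
  exact: (square_free_Ol hV hG hs hf hpi pi0 sf Ox).
tfae.
- by move=> /semi_sf; apply: (square_free_extremal hV hG hs htr hprin hf).
- by move=> /extr_sf/sf_Ol.
- exact: Ol_sf.
- exact: (square_free_all hV hf).
- move=> sf; apply: (semihereditary_projective hV hG hs htr hprin hf).
  by apply: (square_free_semihereditary hV hG hs htr hprin hf) => M hM s; apply: sf.
- move=> /(projective_square_free hV hG hs htr hprin hf).
  exact: (square_free_semihereditary hV hG hs htr hprin hf).
Qed.
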